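(* Let $M$ be a spacelike Riemann ZMC example in $\mathbb{L}^3$ foliated by pieces of circles contained in spacelike planes (parallel to $x_3=0$), and let $\Pi$ be the vertical plane containing the centers of the circles. Suppose that $M$ is bounded by a conelike point and a straight line $L$ orthogonal to the plane $\Pi$. Then $M$ can be reflected across $L$ and repeated by translations, obtaining a periodic maximal surface foliated by pieces of circles, a discrete set of straight lines in horizontal planes and a discrete set of conelike points. Furthermore, the surface is asymptotic to horizontal planes at the heights where the straight lines are situated.
   Context: $\mathbb{L}^3$ is $\mathbb{R}^3$ with the metric $\langle,\rangle=dx_1^2+dx_2^2-dx_3^2$. A surface or plane is spacelike if its induced metric is Riemannian. A maximal surface is a spacelike surface with zero mean curvature. A Riemann ZMC example is a non-rotational surface with zero mean curvature foliated by pieces of circles contained in parallel planes; circles in planes $x_3=\text{const}$ are Euclidean circles, and their centers lie in a vertical plane. ''Horizontal'' means parallel to $x_3=0$. A conelike point is a point to which the circles of the foliation shrink and at which the surface looks like a half light cone. ''$M$ is bounded by a conelike point $P$ and $L$'' means that $M$ lies in a slab $0<x_3\le z_0$, converges to $P$ as $x_3\to0$, and is the straight line $L$ at the height $x_3=z_0$. If $\mathcal{R}$ denotes the reflection across $L$ (rotation by angle $\pi$ about $L$), the periodic surface is obtained from $M\cup\mathcal{R}(M)$ by the discrete group of translations generated by the vector $\overrightarrow{P\mathcal{R}(P)}$. *)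

(* Defs.v *)
(* Stdlib reals and Coquelicot. *)
From Stdlib Require Export Reals ZArith.
From Coquelicot Require Export Coquelicot.

Open Scope R_scope.

Notation R2 := (R * R)%type.
Notation R3 := (R * R * R)%type.

Definition px (p : R3) : R := fst (fst p).
Definition py (p : R3) : R := snd (fst p).
Definition pz (p : R3) : R := snd p.

(** * The space L^3 *)

Definition lprod (v w : R3) : R := px v * px w + py v * py w - pz v * pz w.

(* Lorentzian cross product, characterised by lprod (lcross v w) x = det (v, w, x). *)
Definition lcross (v w : R3) : R3 :=
  (py v * pz w - pz v * py w,
   pz v * px w - px v * pz w,
   - (px v * py w - py v * px w)).

Definition lin_comb (a : R) (v : R3) (b : R) (w : R3) : R3 :=
  plus (scal a v) (scal b w).

(** * Smooth maps on open subsets of the plane *)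

Definition d1 (f : R2 -> R) : R2 -> R :=
  fun q => Derive (fun s => f (s, snd q)) (fst q).
Definition d2 (f : R2 -> R) : R2 -> R :=
  fun q => Derive (fun s => f (fst q, s)) (snd q).

Fixpoint Ck (k : nat) (U : R2 -> Prop) (f : R2 -> R) : Prop :=
  match k with
  | O => forall q, U q -> continuous f q
  | S k' =>
      (forall q, U q ->
         continuous f q /\
         ex_derive (fun s => f (s, snd q)) (fst q) /\
         ex_derive (fun s => f (fst q, s)) (snd q)) /\
      Ck k' U (d1 f) /\ Ck k' U (d2 f)
  end.

Definition smooth (U : R2 -> Prop) (X : R2 -> R3) : Prop :=
  forall k, Ck k U (fun q => px (X q)) /\
            Ck k U (fun q => py (X q)) /\
            Ck k U (fun q => pz (X q)).

Definition D1 (X : R2 -> R3) : R2 -> R3 := fun q =>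
  (d1 (fun p => px (X p)) q, d1 (fun p => py (X p)) q, d1 (fun p => pz (X p)) q).
Definition D2 (X : R2 -> R3) : R2 -> R3 := fun q =>
  (d2 (fun p => px (X p)) q, d2 (fun p => py (X p)) q, d2 (fun p => pz (X p)) q).

(** * Spacelike surfaces and mean curvature *)

(* X is a regular parametrization of an open piece of S: smooth, with injective
   differential, and a homeomorphism of U onto a relatively open subset of S
   (the last clause, for V = U, says that X(U) is contained and open in S). *)
Definition local_param (S : R3 -> Prop) (U : R2 -> Prop) (X : R2 -> R3) : Prop :=
  open U /\ smooth U X /\
  (forall q, U q -> forall a b : R,
     lin_comb a (D1 X q) b (D2 X q) = zero -> a = 0 /\ b = 0) /\
  (forall q q', U q -> U q' -> X q = X q' -> q = q') /\
  (forall V : R2 -> Prop, open V -> (forall q, V q -> U q) ->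
     exists W : R3 -> Prop, open W /\
       forall p, (exists q, V q /\ X q = p) <-> (S p /\ W p)).

Definition spacelike_param (U : R2 -> Prop) (X : R2 -> R3) : Prop :=
  forall q, U q -> forall a b : R, (a, b) <> (0, 0) ->
    0 < lprod (lin_comb a (D1 X q) b (D2 X q)) (lin_comb a (D1 X q) b (D2 X q)).

(* Unit normal; for a spacelike parametrization it is timelike, lprod N N = -1. *)
Definition unit_normal (X : R2 -> R3) (q : R2) : R3 :=
  let n := lcross (D1 X q) (D2 X q) in
  scal (/ sqrt (Rabs (lprod n n))) n.

(* The sign is lprod N N = -1. *)
Definition mean_curvature (X : R2 -> R3) (q : R2) : R :=
  let E := lprod (D1 X q) (D1 X q) in
  let F := lprod (D1 X q) (D2 X q) in
  let G := lprod (D2 X q) (D2 X q) in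
  let N := unit_normal X q in
  let e := lprod N (D1 (D1 X) q) in
  let f := lprod N (D2 (D1 X) q) in
  let g := lprod N (D2 (D2 X) q) in
  - ((e * G - 2 * f * F + g * E) / (2 * (E * G - F * F))).

Definition maximal_surface (S : R3 -> Prop) : Prop :=
  forall p, S p ->
    exists (U : R2 -> Prop) (X : R2 -> R3),
      local_param S U X /\ (exists q, U q /\ X q = p) /\
      spacelike_param U X /\
      (forall q, U q -> mean_curvature X q = 0).

(** * Rotational surfaces *)

(* A one-parameter group of isometries of L^3, not trivial, fixing a line pointwise.
   The causal character of the axis is arbitrary. *)
Definition rotation_group (phi : R -> R3 -> R3) : Prop :=
  (forall p, phi 0 p = p) /\
  (forall s t p, phi (s + t) p = phi s (phi t p)) /\
  (forall p s, continuous (fun t => phi t p) s) /\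
  (forall s p q, lprod (minus (phi s p) (phi s q)) (minus (phi s p) (phi s q))
                 = lprod (minus p q) (minus p q)) /\
  (exists o d : R3, d <> zero /\
     forall s a, phi s (plus o (scal a d)) = plus o (scal a d)) /\
  (exists s p, phi s p <> p).

(* Invariance is required only for small parameters, so that an open piece of a
   surface of revolution (made of arcs of circles) counts as rotational. *)
Definition rotational (S : R3 -> Prop) : Prop :=
  exists phi, rotation_group phi /\
    forall p, S p -> exists eps : posreal, forall s, Rabs s < eps -> S (phi s p).

(** * Surfaces foliated by pieces of horizontal circles *)

Definition part (S : R3 -> Prop) (t0 t1 : R) : R3 -> Prop :=
  fun p => S p /\ t0 < pz p < t1.

Definition smooth_on_interval (f : R -> R) (t0 t1 : R) : Prop :=
  forall t, t0 < t < t1 -> forall n, ex_derive_n f n t.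

(* At each height t in (t0,t1) the slice of S is an open arc of the circle with
   centre (cx t, cy t) and radius r t; the whole circle is the case
   beta - alpha > 2 PI. *)
Definition foliated_by_circles (S : R3 -> Prop) (t0 t1 : R) (cx cy r : R -> R) : Prop :=
  smooth_on_interval cx t0 t1 /\ smooth_on_interval cy t0 t1 /\
  smooth_on_interval r t0 t1 /\
  forall t, t0 < t < t1 ->
    0 < r t /\
    exists alpha beta, alpha < beta /\
      forall p, pz p = t ->
        (S p <-> exists v, alpha < v < beta /\
                   p = (cx t + r t * cos v, cy t + r t * sin v, t)).

Definition spacelike_riemann_example
    (S : R3 -> Prop) (t0 t1 : R) (cx cy r : R -> R) : Prop :=
  (forall p, S p -> t0 < pz p < t1) /\
  maximal_surface S /\ ~ rotational S /\ foliated_by_circles S t0 t1 cx cy r.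

(** * Lines and planes *)

Definition line (o d : R3) : R3 -> Prop := fun p => exists s : R, p = plus o (scal s d).

Definition vertical_plane (Pi : R3 -> Prop) : Prop :=
  exists o nu : R3, nu <> zero /\ pz nu = 0 /\
    forall p, Pi p <-> lprod (minus p o) nu = 0.

Definition orthogonal_to_plane (d : R3) (Pi : R3 -> Prop) : Prop :=
  forall p p', Pi p -> Pi p' -> lprod (minus p p') d = 0.

(* Rotation by angle PI about the (non-lightlike) line through o with direction d. *)
Definition half_turn (o d p : R3) : R3 :=
  minus (scal 2 (plus o (scal (lprod (minus p o) d / lprod d d) d))) p.

(** * Conelike points and boundary *)

Definition adherent (S : R3 -> Prop) (p : R3) : Prop :=
  forall eps : posreal, exists q, S q /\ ball p eps q.

Definition boundary (S : R3 -> Prop) (p : R3) : Prop := adherent S p /\ ~ S p.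

Definition tangent_cone (S : R3 -> Prop) (P w : R3) : Prop :=
  forall eps : posreal, exists (p : R3) (tau : R),
    S p /\ 0 < tau < eps /\ ball w eps (scal (/ tau) (minus p P)).

(* Conelike point of S, approached from above (sg = 1) or from below (sg = -1):
   the circles shrink to P, and the tangent cone at P of that side of S is the
   whole half light cone. *)
Definition conelike (S : R3 -> Prop) (cx cy r : R -> R) (P : R3) (sg : R) : Prop :=
  filterlim (fun h => r (pz P + sg * h)) (at_right 0) (locally 0) /\
  filterlim (fun h => cx (pz P + sg * h)) (at_right 0) (locally (px P)) /\
  filterlim (fun h => cy (pz P + sg * h)) (at_right 0) (locally (py P)) /\
  forall w, tangent_cone (fun p => S p /\ 0 < sg * (pz p - pz P)) P w <->
            (lprod w w = 0 /\ 0 <= sg * pz w).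

(* M lies in 0 < x3 <= z0, is the line at height z0, and the boundary of
   M minus the line consists exactly of P and the line. *)
Definition bounded_by_cone_and_line (M : R3 -> Prop) (z0 : R) (cx cy r : R -> R)
    (P o d : R3) : Prop :=
  (forall p, M p -> 0 < pz p <= z0) /\
  (forall p, line o d p -> pz p = z0) /\
  (forall p, pz p = z0 -> (M p <-> line o d p)) /\
  pz P = 0 /\
  conelike M cx cy r P 1 /\
  (forall p, boundary (part M 0 z0) p <-> (p = P \/ line o d p)).

(** * The periodic surface *)

Definition translate (n : Z) (w : R3) (S : R3 -> Prop) : R3 -> Prop :=
  fun p => S (minus p (scal (IZR n) w)).

(* half_turn is an involution, so M (half_turn o d p) says that p is in the image of M. *)
Definition doubled (M : R3 -> Prop) (o d : R3) : R3 -> Prop :=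
  fun p => M p \/ M (half_turn o d p).

Definition period (P o d : R3) : R3 := minus (half_turn o d P) P.

Definition periodic_surface (M : R3 -> Prop) (P o d : R3) : R3 -> Prop :=
  fun p => exists n : Z, translate n (period P o d) (doubled M o d) p.

(* Every point of space has a neighbourhood meeting at most one member; in
   particular the members are pairwise distinct and do not accumulate. *)
Definition discrete_family (A : Z -> R3 -> Prop) : Prop :=
  forall p, exists eps : posreal, forall m n,
    (exists q, A m q /\ ball p eps q) -> (exists q, A n q /\ ball p eps q) -> m = n.

Definition horizontal_norm (p : R3) : R := sqrt (px p * px p + py p * py p).

(* Two-sided: far away, points of S are close to the plane x3 = h and points of
   the plane are close to S. *)
Definition asymptotic_to_horizontal_plane (S : R3 -> Prop) (h : R) : Prop :=
  forall eps : posreal, exists rho : R,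
    (forall p, S p -> rho < horizontal_norm p -> Rabs (pz p - h) < eps) /\
    (forall q, pz q = h -> rho < horizontal_norm q -> exists p, S p /\ ball q eps p).

(* Main.v *)
(* In a frame in which the line L is X = 0, z = z0, write the circle at height z as
   (X - C)^2 + Y^2 = r^2. Every circle is complete, since the end points of an arc would be boundary
   points, and zero mean curvature becomes r C'' = 2 r' C', r r'' = r'^2 + C'^2 - 1. Hence
   C' = lam r^2 and r'^2 = 1 + K r^2 + lam^2 r^4; lam is nonzero because M is not rotational, and
   K > 2 |lam| because M is spacelike. The radius blows up at z0, so rho = 1 / r vanishes there and
   solves rho'^2 = lam^2 + K rho^2 + rho^4: extended as an odd function about z0 it is smooth.
   With beta = rho C and gam = rho (C^2 - r^2), which are even and odd about z0, the equation
   rho (X^2 + Y^2) - 2 beta X + gam = 0 describes M below z0, the line at z0 and the rotated copy of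
   M above z0, and it defines a spacelike surface of zero mean curvature across z0. Everything else
   follows by transporting M by translations and half-turns, except that the surface approaches
   every far point of the plane z = z0, which is the intermediate value theorem in z for the
   left-hand side. *)
From Stdlib Require Import Ranalysis5 Lra Lia Psatz Classical FunctionalExtensionality.
Require Import Defs.

(** * Points, balls and isometries *)

(** The charts provided by maximality are arbitrary, so mean curvature is computed from the gradient
    and Hessian of a defining function: its vanishing becomes an equation at a point of space in
    which the chart no longer appears. The same computation is read in both directions, to extract
    the differential equations from [M] and to verify maximality along the line. The obstacle is the
    height [z0], where radius and centre both become infinite; [beta] and [gam] are the combinations
    in which the poles cancel. The centre is recovered from its derivative only up to a constant,
    and the boundary hypothesis fixes it: the extreme points [C - r] of the circles converge at the
    height [z0], so their limit must lie on the line. The bound on [K] acts a second time near the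
    line, in the form [|rho'| > |lam| + rho^2] where [rho] is nonzero, which is the spacelike
    condition on a whole circle at once. A new chart is built along the line only. The orientation
    of the frame is chosen so that [lam > 0]. *)

Lemma R3_eq (p q : R3) : px p = px q -> py p = py q -> pz p = pz q -> p = q.
Proof.
destruct p as [[p1 p2] p3]; destruct q as [[q1 q2] q3]; cbv; now intros -> -> ->.
Qed.

Lemma px_plus (p q : R3) : px (plus p q) = px p + px q. Proof. reflexivity. Qed.
Lemma py_plus (p q : R3) : py (plus p q) = py p + py q. Proof. reflexivity. Qed.
Lemma pz_plus (p q : R3) : pz (plus p q) = pz p + pz q. Proof. reflexivity. Qed.
Lemma px_minus (p q : R3) : px (minus p q) = px p - px q. Proof. reflexivity. Qed.
Lemma py_minus (p q : R3) : py (minus p q) = py p - py q. Proof. reflexivity. Qed.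
Lemma pz_minus (p q : R3) : pz (minus p q) = pz p - pz q. Proof. reflexivity. Qed.
Lemma px_scal a (p : R3) : px (scal a p) = a * px p. Proof. reflexivity. Qed.
Lemma py_scal a (p : R3) : py (scal a p) = a * py p. Proof. reflexivity. Qed.
Lemma pz_scal a (p : R3) : pz (scal a p) = a * pz p. Proof. reflexivity. Qed.
Lemma px_pair x y z : px (x, y, z) = x. Proof. reflexivity. Qed.
Lemma py_pair x y z : py (x, y, z) = y. Proof. reflexivity. Qed.
Lemma pz_pair x y z : pz (x, y, z) = z. Proof. reflexivity. Qed.

Global Hint Rewrite px_plus py_plus pz_plus px_minus py_minus pz_minus
  px_scal py_scal pz_scal px_pair py_pair pz_pair : r3.

Lemma ball3 (p q : R3) (eps : R) :
  ball p eps q <->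
  Rabs (px q - px p) < eps /\ Rabs (py q - py p) < eps /\ Rabs (pz q - pz p) < eps.
Proof.
split.
- intros [[H1 H2] H3]; split; [exact H1 | split; [exact H2 | exact H3]].
- intros [H1 [H2 H3]]; split; [split; [exact H1 | exact H2] | exact H3].
Qed.

Lemma continuous_px (p : R3) : continuous px p.
Proof. apply (continuous_comp fst fst); apply continuous_fst. Qed.

Lemma continuous_py (p : R3) : continuous py p.
Proof. apply (continuous_comp fst snd); [apply continuous_fst | apply continuous_snd]. Qed.

Lemma continuous_pz (p : R3) : continuous pz p.
Proof. apply continuous_snd. Qed.

Lemma open_pos {T : UniformSpace} (U : T -> Prop) (g : T -> R) :
  open U -> (forall q, U q -> continuous g q) -> open (fun q => U q /\ 0 < g q).
Proof.
intros HU Hg q [Hq Hpos].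
apply filter_and; [now apply HU |].
apply (Hg q Hq (fun y => 0 < y)).
now apply (open_gt 0).
Qed.

Lemma open_preim {T V : UniformSpace} (U : T -> Prop) (D : V -> Prop) (f : T -> V) :
  open U -> open D -> (forall q, U q -> continuous f q) -> open (fun q => U q /\ D (f q)).
Proof.
intros HU HD Hf q [Hq Hd].
apply filter_and; [now apply HU |].
apply (Hf q Hq D). now apply HD.
Qed.

Lemma locally_between (a b t : R) : a < t < b -> locally t (fun y => a < y < b).
Proof.
exact (open_and (fun t => a < t) (fun t => t < b) (open_gt a) (open_lt b) t).
Qed.

Lemma open_pz_interval (a b : R) : open (fun p : R3 => a < pz p < b).
Proof.
apply (open_comp pz (fun t => a < t < b)).
- intros p _. apply continuous_pz.
- intros t. apply locally_between.
Qed.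

Lemma Rabs_le_1 x : x * x <= 1 -> Rabs x <= 1.
Proof.
intros Hx. rewrite <- (Rabs_right 1) by lra. apply Rsqr_le_abs_0. unfold Rsqr. lra.
Qed.

(** * Smooth functions of two variables *)

Lemma open_slice1 (U : R2 -> Prop) (q : R2) :
  open U -> U q -> locally (fst q) (fun s => U (s, snd q)).
Proof.
intros HU Hq. destruct (HU q Hq) as [e He]. exists e. intros s Hs. apply He.
split; [exact Hs | apply ball_center].
Qed.

Lemma open_slice2 (U : R2 -> Prop) (q : R2) :
  open U -> U q -> locally (snd q) (fun s => U (fst q, s)).
Proof.
intros HU Hq. destruct (HU q Hq) as [e He]. exists e. intros s Hs. apply He.
split; [apply ball_center | exact Hs].
Qed.

Lemma d1_ext (U : R2 -> Prop) f g (q : R2) :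
  open U -> U q -> (forall p, U p -> f p = g p) -> d1 f q = d1 g q.
Proof.
intros HU Hq H. apply Derive_ext_loc.
generalize (open_slice1 U q HU Hq). apply filter_imp. intros s Hs; now apply H.
Qed.

Lemma d2_ext (U : R2 -> Prop) f g (q : R2) :
  open U -> U q -> (forall p, U p -> f p = g p) -> d2 f q = d2 g q.
Proof.
intros HU Hq H. apply Derive_ext_loc.
generalize (open_slice2 U q HU Hq). apply filter_imp. intros s Hs; now apply H.
Qed.

(** [d1] and [d2] are derivatives along coordinate slices, so equality on an open set passes to
    them. This lets a derivative be replaced by a closed formula at each level of the later
    inductions. *)
Lemma Ck_ext k (U : R2 -> Prop) f g :
  open U -> (forall q, U q -> f q = g q) -> Ck k U f -> Ck k U g.
Proof.
intros HU; revert f g; induction k as [|k IH]; intros f g Hfg.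
- intros Hf q Hq. apply (continuous_ext_loc _ f); [| now apply Hf].
  generalize (HU q Hq). apply filter_imp. exact Hfg.
- intros [H0 [H1 H2]]; split; [|split].
  + intros q Hq. destruct (H0 q Hq) as [Hc [Hd1 Hd2]]. split; [|split].
    * apply (continuous_ext_loc _ f); [| exact Hc].
      generalize (HU q Hq). apply filter_imp. exact Hfg.
    * apply (ex_derive_ext_loc (fun s => f (s, snd q))); [| exact Hd1].
      generalize (open_slice1 U q HU Hq). apply filter_imp. intros s; apply Hfg.
    * apply (ex_derive_ext_loc (fun s => f (fst q, s))); [| exact Hd2].
      generalize (open_slice2 U q HU Hq). apply filter_imp. intros s; apply Hfg.
  + apply (IH (d1 f)); [| exact H1]. intros q Hq; now apply (d1_ext U).
  + apply (IH (d2 f)); [| exact H2]. intros q Hq; now apply (d2_ext U).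
Qed.

Lemma Ck_incl k (U V : R2 -> Prop) f : (forall q, V q -> U q) -> Ck k U f -> Ck k V f.
Proof.
intros HV; revert f; induction k as [|k IH]; intros f.
- intros H q Hq; now apply H, HV.
- intros [H0 [H1 H2]]; split; [|split]; try now apply IH.
  intros q Hq; now apply H0, HV.
Qed.

Lemma Ck_pred k U f : Ck (S k) U f -> Ck k U f.
Proof.
revert f; induction k as [|k IH]; intros f.
- intros [H _] q Hq. now apply H.
- intros [H0 [H1 H2]]; split; [exact H0 | split]; now apply IH.
Qed.

Lemma Ck_const k U c : Ck k U (fun _ => c).
Proof.
revert c; induction k as [|k IH]; intros c; [intros q _; apply continuous_const |].
split; [|split].
- intros q _; split; [apply continuous_const | split; apply ex_derive_const].
- replace (d1 (fun _ => c)) with (fun _ : R2 => 0); [apply IH |].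
  apply functional_extensionality; intros q; symmetry; unfold d1, d2; simpl; apply Derive_const.
- replace (d2 (fun _ => c)) with (fun _ : R2 => 0); [apply IH |].
  apply functional_extensionality; intros q; symmetry; unfold d1, d2; simpl; apply Derive_const.
Qed.

Lemma Ck_fst k U : Ck k U fst.
Proof.
destruct k as [|k]; [intros q _; apply continuous_fst |].
split; [|split].
- intros q _; split; [apply continuous_fst | split]; [apply ex_derive_id | apply (ex_derive_const (fst q))].
- replace (d1 fst) with (fun _ : R2 => 1); [apply Ck_const |].
  apply functional_extensionality; intros q; symmetry; apply (Derive_id (fst q)).
- replace (d2 fst) with (fun _ : R2 => 0); [apply Ck_const |].
  apply functional_extensionality; intros q; symmetry; unfold d1, d2; simpl; apply Derive_const.
Qed.

Lemma Ck_plus k U f g : open U -> Ck k U f -> Ck k U g -> Ck k U (fun q => f q + g q).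
Proof.
intros HU; revert f g; induction k as [|k IH]; intros f g.
- intros Hf Hg q Hq. now apply (continuous_plus f g); [apply Hf | apply Hg].
- intros [F0 [F1 F2]] [G0 [G1 G2]]. split; [|split].
  + intros q Hq; destruct (F0 q Hq) as [a [b c]]; destruct (G0 q Hq) as [a' [b' c']].
    split; [now apply (continuous_plus f g) | split].
    * now apply (ex_derive_plus (fun s => f (s, snd q)) (fun s => g (s, snd q))).
    * now apply (ex_derive_plus (fun s => f (fst q, s)) (fun s => g (fst q, s))).
  + apply (Ck_ext k U (fun q => d1 f q + d1 g q)); [exact HU | | now apply IH].
    intros q Hq; destruct (F0 q Hq) as [_ [b _]]; destruct (G0 q Hq) as [_ [b' _]].
    symmetry; now apply (Derive_plus (fun s => f (s, snd q)) (fun s => g (s, snd q))).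
  + apply (Ck_ext k U (fun q => d2 f q + d2 g q)); [exact HU | | now apply IH].
    intros q Hq; destruct (F0 q Hq) as [_ [_ b]]; destruct (G0 q Hq) as [_ [_ b']].
    symmetry; now apply (Derive_plus (fun s => f (fst q, s)) (fun s => g (fst q, s))).
Qed.

Lemma Ck_mult k U f g : open U -> Ck k U f -> Ck k U g -> Ck k U (fun q => f q * g q).
Proof.
intros HU; revert f g; induction k as [|k IH]; intros f g Hf Hg.
- intros q Hq. now apply (continuous_mult f g); [apply Hf | apply Hg].
- assert (Hf' := Ck_pred _ _ _ Hf); assert (Hg' := Ck_pred _ _ _ Hg).
  destruct Hf as [F0 [F1 F2]]; destruct Hg as [G0 [G1 G2]]. split; [|split].
  + intros q Hq; destruct (F0 q Hq) as [a [b c]]; destruct (G0 q Hq) as [a' [b' c']].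
    split; [now apply (continuous_mult f g) | split].
    * now apply (ex_derive_mult (fun s => f (s, snd q)) (fun s => g (s, snd q))).
    * now apply (ex_derive_mult (fun s => f (fst q, s)) (fun s => g (fst q, s))).
  + apply (Ck_ext k U (fun q => d1 f q * g q + f q * d1 g q));
      [exact HU | | now apply Ck_plus; [exact HU | apply IH | apply IH]].
    intros [x y] Hq; destruct (F0 _ Hq) as [_ [b _]]; destruct (G0 _ Hq) as [_ [b' _]].
    symmetry; now apply (Derive_mult (fun s => f (s, y)) (fun s => g (s, y))).
  + apply (Ck_ext k U (fun q => d2 f q * g q + f q * d2 g q));
      [exact HU | | now apply Ck_plus; [exact HU | apply IH | apply IH]].
    intros [x y] Hq; destruct (F0 _ Hq) as [_ [_ b]]; destruct (G0 _ Hq) as [_ [_ b']].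
    symmetry; now apply (Derive_mult (fun s => f (x, s)) (fun s => g (x, s))).
Qed.

Lemma Ck_continuous k U f q : Ck k U f -> U q -> continuous f q.
Proof. destruct k as [|k]; [now intros H; apply H |]. intros [H _] Hq. now apply H. Qed.

(** The derivative of [1 / f] is [- f' (1 / f)^2], so one more order for [1 / f] costs only the
    order already obtained for [1 / f] itself. [Ck_sqrt] follows the same pattern. *)
Lemma Ck_inv k U f :
  open U -> (forall q, U q -> f q <> 0) -> Ck k U f -> Ck k U (fun q => / f q).
Proof.
intros HU Hnz; induction k as [|k IH]; intros Hf.
- intros q Hq. apply (continuous_comp f Rinv); [now apply Hf |].
  apply continuous_Rinv; now apply Hnz.
- assert (Hi := IH (Ck_pred _ _ _ Hf)).
  assert (Hc := fun q => Ck_continuous _ _ f q Hf).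
  destruct Hf as [F0 [F1 F2]]. split; [|split].
  + intros q Hq; destruct (F0 q Hq) as [_ [b c]]. split; [|split].
    * apply (continuous_comp f Rinv); [now apply Hc |].
      apply continuous_Rinv; now apply Hnz.
    * apply (ex_derive_inv (fun s => f (s, snd q))); [exact b |].
      destruct q; now apply Hnz.
    * apply (ex_derive_inv (fun s => f (fst q, s))); [exact c |].
      destruct q; now apply Hnz.
  + apply (Ck_ext k U (fun q => d1 f q * ((-1) * (/ f q * / f q))));
      [exact HU | | repeat apply Ck_mult; auto; apply Ck_const].
    intros [x y] Hq; destruct (F0 _ Hq) as [_ [b _]]. symmetry.
    etransitivity; [apply (Derive_inv (fun s => f (s, y))); [exact b | now apply Hnz] |].
    simpl; unfold d1; simpl. field. now apply Hnz.
  + apply (Ck_ext k U (fun q => d2 f q * ((-1) * (/ f q * / f q))));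
      [exact HU | | repeat apply Ck_mult; auto; apply Ck_const].
    intros [x y] Hq; destruct (F0 _ Hq) as [_ [_ b]]. symmetry.
    etransitivity; [apply (Derive_inv (fun s => f (x, s))); [exact b | now apply Hnz] |].
    simpl; unfold d2; simpl. field. now apply Hnz.
Qed.

Lemma Ck_sqrt k U f :
  open U -> (forall q, U q -> 0 < f q) -> Ck k U f -> Ck k U (fun q => sqrt (f q)).
Proof.
intros HU Hpos; induction k as [|k IH]; intros Hf.
- intros q Hq. apply (continuous_comp f sqrt); [now apply Hf | apply continuous_sqrt].
- assert (Hi := IH (Ck_pred _ _ _ Hf)).
  assert (Hc := fun q => Ck_continuous _ _ f q Hf).
  destruct Hf as [F0 [F1 F2]].
  assert (Hs : Ck k U (fun q => / (2 * sqrt (f q)))).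
  { apply Ck_inv; [exact HU | | apply Ck_mult; [exact HU | apply Ck_const | exact Hi]].
    intros q Hq; generalize (sqrt_lt_R0 _ (Hpos q Hq)); lra. }
  split; [|split].
  + intros q Hq; destruct (F0 q Hq) as [_ [[b Hb] [c Hc']]]. split; [|split].
    * apply (continuous_comp f sqrt); [now apply Hc | apply continuous_sqrt].
    * eexists; apply (is_derive_sqrt (fun s => f (s, snd q))); [exact Hb |].
      destruct q; now apply Hpos.
    * eexists; apply (is_derive_sqrt (fun s => f (fst q, s))); [exact Hc' |].
      destruct q; now apply Hpos.
  + apply (Ck_ext k U (fun q => d1 f q * / (2 * sqrt (f q))));
      [exact HU | | apply Ck_mult; auto].
    intros [x y] Hq; destruct (F0 _ Hq) as [_ [b _]]. symmetry.
    apply is_derive_unique, (is_derive_sqrt (fun s => f (s, y)));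
      [now apply Derive_correct | now apply Hpos].
  + apply (Ck_ext k U (fun q => d2 f q * / (2 * sqrt (f q))));
      [exact HU | | apply Ck_mult; auto].
    intros [x y] Hq; destruct (F0 _ Hq) as [_ [_ b]]. symmetry.
    apply is_derive_unique, (is_derive_sqrt (fun s => f (x, s)));
      [now apply Derive_correct | now apply Hpos].
Qed.

Lemma Ck_snd k U : Ck k U snd.
Proof.
destruct k as [|k]; [intros q _; apply continuous_snd |].
split; [|split].
- intros q _; split; [apply continuous_snd | split]; [apply (ex_derive_const (snd q)) | apply ex_derive_id].
- replace (d1 snd) with (fun _ : R2 => 0); [apply Ck_const |].
  apply functional_extensionality; intros q; symmetry; unfold d1, d2; simpl; apply Derive_const.
- replace (d2 snd) with (fun _ : R2 => 1); [apply Ck_const |].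
  apply functional_extensionality; intros q; symmetry; apply (Derive_id (snd q)).
Qed.

(** One bootstrap step for a function of the height: when the derivatives of a family are
    polynomials in the family, repeating it gives smoothness of every order. *)
Lemma Ck_S_of_snd k (U : R2 -> Prop) (f f' : R -> R) :
  open U -> (forall q, U q -> is_derive f (snd q) (f' (snd q))) ->
  Ck k U (fun q => f' (snd q)) -> Ck (S k) U (fun q => f (snd q)).
Proof.
intros HU Hd Hk; split; [|split].
- intros q Hq; split; [|split].
  + apply (continuous_comp snd f); [apply continuous_snd |].
    apply (ex_derive_continuous f). eexists; now apply Hd.
  + apply (ex_derive_const (f (snd q))).
  + eexists; now apply Hd.
- apply (Ck_ext k U (fun _ => 0)); [exact HU | | apply Ck_const].
  intros q _; symmetry; unfold d1, d2; simpl; apply Derive_const.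
- apply (Ck_ext k U (fun q => f' (snd q))); [exact HU | | exact Hk].
  intros q Hq; symmetry; now apply is_derive_unique, Hd.
Qed.

(** * Maps into R^3 and affine combinations of their coordinates *)

Lemma continuous_R3 {T : UniformSpace} (f : T -> R3) (q : T) :
  continuous (fun q => px (f q)) q -> continuous (fun q => py (f q)) q ->
  continuous (fun q => pz (f q)) q -> continuous f q.
Proof.
intros H1 H2 H3. apply filterlim_locally. intros eps.
apply filterlim_locally with (eps := eps) in H1.
apply filterlim_locally with (eps := eps) in H2.
apply filterlim_locally with (eps := eps) in H3.
generalize (filter_and _ _ H1 (filter_and _ _ H2 H3)). apply filter_imp.
intros x [a [b c]]. apply ball3. repeat split; assumption.
Qed.

(** Each coordinate of [aff] has literally this shape, the third one because [lin] carries a term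
    with coefficient 0. The companions for [is_derive], [d1], [d2] and [Ck] serve the same
    purpose. *)
Lemma continuous_lin {T : UniformSpace} (f g : T -> R) a b e (q : T) :
  continuous f q -> continuous g q -> continuous (fun q => a * f q + b * g q + e) q.
Proof.
intros Hf Hg.
apply (continuous_plus (V := R_NormedModule) (fun q => a * f q + b * g q) (fun _ => e));
  [| apply continuous_const].
apply (continuous_plus (V := R_NormedModule) (fun q => a * f q) (fun q => b * g q)).
- apply (continuous_mult (K := R_AbsRing) (fun _ => a) f); [apply continuous_const | exact Hf].
- apply (continuous_mult (K := R_AbsRing) (fun _ => b) g); [apply continuous_const | exact Hg].
Qed.

Lemma D1_ext (U : R2 -> Prop) X Y (q : R2) :
  open U -> U q -> (forall p, U p -> X p = Y p) -> D1 X q = D1 Y q.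
Proof.
intros HU Hq H. unfold D1.
rewrite !(d1_ext U _ _ q HU Hq (fun p Hp => f_equal px (H p Hp))).
rewrite !(d1_ext U _ _ q HU Hq (fun p Hp => f_equal py (H p Hp))).
now rewrite !(d1_ext U _ _ q HU Hq (fun p Hp => f_equal pz (H p Hp))).
Qed.

Lemma D2_ext (U : R2 -> Prop) X Y (q : R2) :
  open U -> U q -> (forall p, U p -> X p = Y p) -> D2 X q = D2 Y q.
Proof.
intros HU Hq H. unfold D2.
rewrite !(d2_ext U _ _ q HU Hq (fun p Hp => f_equal px (H p Hp))).
rewrite !(d2_ext U _ _ q HU Hq (fun p Hp => f_equal py (H p Hp))).
now rewrite !(d2_ext U _ _ q HU Hq (fun p Hp => f_equal pz (H p Hp))).
Qed.

Lemma is_derive_lin (f g : R -> R) a b e x l l' :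
  is_derive f x l -> is_derive g x l' ->
  is_derive (fun s => a * f s + b * g s + e) x (a * l + b * l').
Proof.
intros Hf Hg.
apply (is_derive_ext (fun s => plus (plus (scal a (f s)) (scal b (g s))) e)); [reflexivity |].
replace (a * l + b * l') with (plus (plus (scal a l) (scal b l')) 0) by apply Rplus_0_r.
apply (is_derive_plus (V := R_NormedModule)); [| apply (is_derive_const (V := R_NormedModule) e)].
apply (is_derive_plus (V := R_NormedModule)); now apply is_derive_scal.
Qed.

Lemma d1_lin (f g : R2 -> R) a b e q :
  ex_derive (fun s => f (s, snd q)) (fst q) -> ex_derive (fun s => g (s, snd q)) (fst q) ->
  d1 (fun q => a * f q + b * g q + e) q = a * d1 f q + b * d1 g q.
Proof.
intros Hf Hg. apply is_derive_unique.
exact (is_derive_lin _ _ a b e _ _ _ (Derive_correct _ _ Hf) (Derive_correct _ _ Hg)).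
Qed.

Lemma d2_lin (f g : R2 -> R) a b e q :
  ex_derive (fun s => f (fst q, s)) (snd q) -> ex_derive (fun s => g (fst q, s)) (snd q) ->
  d2 (fun q => a * f q + b * g q + e) q = a * d2 f q + b * d2 g q.
Proof.
intros Hf Hg. apply is_derive_unique.
exact (is_derive_lin _ _ a b e _ _ _ (Derive_correct _ _ Hf) (Derive_correct _ _ Hg)).
Qed.

Lemma Ck_lin k U (f g : R2 -> R) a b e :
  open U -> Ck k U f -> Ck k U g -> Ck k U (fun q => a * f q + b * g q + e).
Proof.
intros HU Hf Hg. apply Ck_plus; [exact HU | | apply Ck_const].
apply Ck_plus; [exact HU | |]; apply Ck_mult; auto; apply Ck_const.
Qed.

(** * Isometries preserving the horizontal planes *)

(* For c^2 + d^2 = 1 and s = 1 or -1, these are linear isometries of L^3 of determinant 1. *)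
Definition lin (c d s : R) (v : R3) : R3 :=
  (s * d * px v + - (s * c) * py v, c * px v + d * py v, s * pz v + 0 * pz v).

Definition aff (c d s : R) (t p : R3) : R3 := plus (lin c d s p) t.

Definition aff_inv (c d s : R) (t p : R3) : R3 := lin (- (s * c)) d s (minus p t).

Section Isometry.

Variables (c d s : R) (t : R3).
Hypothesis Hcd : c * c + d * d = 1.
Hypothesis Hs : s * s = 1.

Let Hcc : c * c = 1 - d * d.
Proof. lra. Qed.

Local Ltac r3 := unfold aff_inv, aff, lin, lin_comb, lprod, lcross; autorewrite with r3.

Lemma aff_invK p : aff_inv c d s t (aff c d s t p) = p.
Proof. apply R3_eq; r3; ring [Hcc Hs]. Qed.

Lemma affK p : aff c d s t (aff_inv c d s t p) = p.
Proof. apply R3_eq; r3; ring [Hcc Hs]. Qed.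

Lemma aff_inj p q : aff c d s t p = aff c d s t q -> p = q.
Proof. intros H. now rewrite <- (aff_invK p), H, aff_invK. Qed.

Lemma lprod_lin v w : lprod (lin c d s v) (lin c d s w) = lprod v w.
Proof. r3; ring [Hcc Hs]. Qed.

(** Determinant 1 enters here: determinant -1 would reverse the normal. *)
Lemma lcross_lin v w : lcross (lin c d s v) (lin c d s w) = lin c d s (lcross v w).
Proof. apply R3_eq; r3; ring [Hcc Hs]. Qed.

Lemma lin_comb_lin a v b w :
  lin_comb a (lin c d s v) b (lin c d s w) = lin c d s (lin_comb a v b w).
Proof. apply R3_eq; r3; ring. Qed.

Lemma scal_lin a v : scal a (lin c d s v) = lin c d s (scal a v).
Proof. apply R3_eq; r3; ring. Qed.

Lemma lin_eq0 v : lin c d s v = zero -> v = zero.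
Proof.
intros H.
assert (H1 := f_equal px H); assert (H2 := f_equal py H); assert (H3 := f_equal pz H).
revert H1 H2 H3; unfold lin; autorewrite with r3.
change (px zero) with 0; change (py zero) with 0; change (pz zero) with 0; intros H1 H2 H3.
apply R3_eq; change (px zero) with 0; change (py zero) with 0; change (pz zero) with 0.
- transitivity (s * d * (s * d * px v + - (s * c) * py v) + c * (c * px v + d * py v));
  [ring [Hcc Hs] | rewrite H1, H2; ring].
- transitivity (- (s * c) * (s * d * px v + - (s * c) * py v) + d * (c * px v + d * py v));
  [ring [Hcc Hs] | rewrite H1, H2; ring].
- transitivity (s * (s * pz v + 0 * pz v)); [ring [Hcc Hs] | rewrite H3; ring].
Qed.

Definition C1_map (U : R2 -> Prop) (X : R2 -> R3) : Prop :=
  Ck 1 U (fun q => px (X q)) /\ Ck 1 U (fun q => py (X q)) /\ Ck 1 U (fun q => pz (X q)).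

Lemma D1_aff U X q : C1_map U X -> U q ->
  D1 (fun q => aff c d s t (X q)) q = lin c d s (D1 X q).
Proof.
intros [[Hx _] [[Hy _] [Hz _]]] Hq.
destruct (Hx q Hq) as [_ [Hx1 _]]; destruct (Hy q Hq) as [_ [Hy1 _]];
destruct (Hz q Hq) as [_ [Hz1 _]].
apply R3_eq; unfold D1, lin; autorewrite with r3; now apply d1_lin.
Qed.

Lemma D2_aff U X q : C1_map U X -> U q ->
  D2 (fun q => aff c d s t (X q)) q = lin c d s (D2 X q).
Proof.
intros [[Hx _] [[Hy _] [Hz _]]] Hq.
destruct (Hx q Hq) as [_ [_ Hx1]]; destruct (Hy q Hq) as [_ [_ Hy1]];
destruct (Hz q Hq) as [_ [_ Hz1]].
apply R3_eq; unfold D2, lin; autorewrite with r3; now apply d2_lin.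
Qed.

Lemma continuous_aff p : continuous (aff c d s t) p.
Proof.
apply continuous_R3.
- apply (continuous_lin px py); [apply continuous_px | apply continuous_py].
- apply (continuous_lin px py); [apply continuous_px | apply continuous_py].
- apply (continuous_lin pz pz); apply continuous_pz.
Qed.

End Isometry.

Lemma aff_inv_aff c d s t p :
  aff_inv c d s t p = aff (- (s * c)) d s (scal (-1) (lin (- (s * c)) d s t)) p.
Proof. apply R3_eq; unfold aff_inv, aff, lin; autorewrite with r3; ring. Qed.

Lemma smooth_C1 U X : smooth U X -> C1_map U X.
Proof. intros H; exact (H 1%nat). Qed.

Lemma smooth_D1 U X : smooth U X -> smooth U (D1 X).
Proof.
intros H k. destruct (H (S k)) as [[_ [H1 _]] [[_ [H2 _]] [_ [H3 _]]]].
now split; [|split].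
Qed.

Lemma smooth_D2 U X : smooth U X -> smooth U (D2 X).
Proof.
intros H k. destruct (H (S k)) as [[_ [_ H1]] [[_ [_ H2]] [_ [_ H3]]]].
now split; [|split].
Qed.

Lemma smooth_continuous U X q : smooth U X -> U q -> continuous X q.
Proof.
intros H Hq. destruct (H O) as [H1 [H2 H3]].
apply continuous_R3; [now apply H1 | now apply H2 | now apply H3].
Qed.

Lemma mean_curvature_aff c d s t U X q :
  c * c + d * d = 1 -> s * s = 1 -> open U -> smooth U X -> U q ->
  mean_curvature (fun q => aff c d s t (X q)) q = mean_curvature X q.
Proof.
intros Hcd Hs HU HX Hq.
set (Y := fun q => aff c d s t (X q)).
(* The linear part is written as [aff] with zero translation, so that the rule for first derivatives
   applies again and yields the second derivatives. *)
assert (E1 : forall p, U p -> D1 Y p = aff c d s zero (D1 X p)).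
{ intros p Hp. unfold Y. rewrite (D1_aff c d s t U); [| now apply smooth_C1 | exact Hp].
  apply R3_eq; unfold aff; autorewrite with r3;
  [change (px zero) with 0 | change (py zero) with 0 | change (pz zero) with 0]; ring. }
assert (E2 : forall p, U p -> D2 Y p = aff c d s zero (D2 X p)).
{ intros p Hp. unfold Y. rewrite (D2_aff c d s t U); [| now apply smooth_C1 | exact Hp].
  apply R3_eq; unfold aff; autorewrite with r3;
  [change (px zero) with 0 | change (py zero) with 0 | change (pz zero) with 0]; ring. }
assert (E11 : D1 (D1 Y) q = lin c d s (D1 (D1 X) q)).
{ rewrite (D1_ext U _ _ q HU Hq E1).
  apply (D1_aff c d s zero U); [now apply smooth_C1, smooth_D1 | exact Hq]. }
assert (E12 : D2 (D1 Y) q = lin c d s (D2 (D1 X) q)).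
{ rewrite (D2_ext U _ _ q HU Hq E1).
  apply (D2_aff c d s zero U); [now apply smooth_C1, smooth_D1 | exact Hq]. }
assert (E22 : D2 (D2 Y) q = lin c d s (D2 (D2 X) q)).
{ rewrite (D2_ext U _ _ q HU Hq E2).
  apply (D2_aff c d s zero U); [now apply smooth_C1, smooth_D2 | exact Hq]. }
assert (F1 : D1 Y q = lin c d s (D1 X q))
  by (apply (D1_aff c d s t U); [now apply smooth_C1 | exact Hq]).
assert (F2 : D2 Y q = lin c d s (D2 X q))
  by (apply (D2_aff c d s t U); [now apply smooth_C1 | exact Hq]).
unfold mean_curvature, unit_normal.
now rewrite E11, E12, E22, F1, F2, lcross_lin, !lprod_lin, !scal_lin, !lprod_lin.
Qed.

(** The pointwise form of [maximal_surface], which can be transported from a neighbourhood of one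
    point to another. *)
Definition maximal_at (S : R3 -> Prop) (p : R3) : Prop :=
  exists (U : R2 -> Prop) (X : R2 -> R3),
    local_param S U X /\ (exists q, U q /\ X q = p) /\
    spacelike_param U X /\ (forall q, U q -> mean_curvature X q = 0).

(** Maximality is local: the two surfaces need only correspond inside the open set [N], and the
    chart is restricted to the part that lands there. Hence a single piece of [M] suffices for each
    point of the periodic surface off the lines. *)
Lemma maximal_at_aff c d s t (S S' N : R3 -> Prop) (p : R3) :
  c * c + d * d = 1 -> s * s = 1 -> open N -> N (aff c d s t p) ->
  (forall p', N (aff c d s t p') -> (S' (aff c d s t p') <-> S p')) ->
  maximal_at S p -> maximal_at S' (aff c d s t p).
Proof.
intros Hcd Hs HN HNp HS (U & X & (HU & HX & Hreg & Hinj & Hhom) & (q0 & Hq0 & Eq0) & Hsp & Hmc).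
pose (T := aff c d s t).
exists (fun q => U q /\ N (T (X q))), (fun q => T (X q)).
assert (HU' : open (fun q => U q /\ N (T (X q)))).
{ apply open_preim; [exact HU | exact HN |]. intros q Hq.
  apply (continuous_comp X T); [now apply smooth_continuous with U | apply continuous_aff]. }
assert (HX1 := smooth_C1 _ _ HX).
split; [split; [exact HU' | split; [|split; [|split]]] | split; [|split]].
- intros k. destruct (HX k) as [K1 [K2 K3]].
  assert (I : forall f, Ck k U f -> Ck k (fun q => U q /\ N (T (X q))) f)
    by (intros f; apply Ck_incl; tauto).
  apply I in K1; apply I in K2; apply I in K3.
  split; [|split]; unfold T, aff, lin.
  + now apply (Ck_lin k _ (fun q => px (X q)) (fun q => py (X q))).
  + now apply (Ck_lin k _ (fun q => px (X q)) (fun q => py (X q))).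
  + now apply (Ck_lin k _ (fun q => pz (X q)) (fun q => pz (X q))).
- intros q [Hq _] a b. unfold T.
  rewrite (D1_aff c d s t U), (D2_aff c d s t U), lin_comb_lin by assumption.
  intros H. apply lin_eq0 in H; [| exact Hcd | exact Hs]. now apply (Hreg q).
- intros q q' [Hq _] [Hq' _] H. apply aff_inj in H; [| exact Hcd | exact Hs].
  now apply Hinj.
- intros V HV HVU. destruct (Hhom V HV) as (W & HW & HWV).
  { intros q Hq; now apply HVU. }
  exists (fun p => N p /\ W (aff_inv c d s t p)). split.
  + apply open_preim; [exact HN | exact HW |]. intros p' _.
    apply (continuous_ext _ _ _ (fun p => eq_sym (aff_inv_aff c d s t p))), continuous_aff.
  + intros p'. rewrite <- (affK c d s t Hcd Hs p').
    set (p1 := aff_inv c d s t p').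
    rewrite (aff_invK c d s t Hcd Hs).
    split.
    * intros (q & Hq & E). apply (aff_inj c d s t Hcd Hs) in E. rewrite <- E.
      destruct (HVU q Hq) as [Uq Nq].
      destruct (proj1 (HWV (X q))) as [Sq Wq]; [now exists q |].
      split; [now apply HS | now split].
    * intros (Sp & Np & Wp). apply HS in Sp; [| exact Np].
      destruct (proj2 (HWV p1) (conj Sp Wp)) as (q & Hq & E).
      exists q; split; [exact Hq | unfold T; now rewrite E].
- exists q0. unfold T; rewrite Eq0. tauto.
- intros q [Hq _] a b Hab. unfold T.
  rewrite (D1_aff c d s t U), (D2_aff c d s t U), lin_comb_lin, lprod_lin by assumption.
  now apply Hsp.
- intros q [Hq _]. unfold T. rewrite (mean_curvature_aff c d s t U) by assumption.
  now apply Hmc.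
Qed.

(** * Mean curvature of a level set *)

Section NormalVector.

Variables (v w : R3) (g1 g2 g3 : R).
Hypothesis Hv : g1 * px v + g2 * py v + g3 * pz v = 0.
Hypothesis Hw : g1 * px w + g2 * py w + g3 * pz w = 0.
Hypothesis Hg : 0 < g1 * g1 + g2 * g2 + g3 * g3.

(** Both vectors are Euclidean-orthogonal to [g], so their Euclidean cross product is a multiple of
    [g]; the Lorentzian one differs by the sign of the third coordinate. The factor is the
    projection of that product on [g]. *)
Lemma lcross_parallel :
  exists m, px (lcross v w) = m * g1 /\ py (lcross v w) = m * g2 /\ pz (lcross v w) = - (m * g3).
Proof.
unfold lcross; autorewrite with r3.
set (n1 := py v * pz w - pz v * py w); set (n2 := pz v * px w - px v * pz w);
set (n3 := px v * py w - py v * px w).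
(* [c1], [c2], [c3] say that the cross product of the Euclidean normal with [g] vanishes, by the
   triple product expansion. *)
assert (c1 : n2 * g3 - n3 * g2 = 0).
{ transitivity (px w * (g1 * px v + g2 * py v + g3 * pz v)
                - px v * (g1 * px w + g2 * py w + g3 * pz w));
  [unfold n2, n3; ring | rewrite Hv, Hw; ring]. }
assert (c2 : n3 * g1 - n1 * g3 = 0).
{ transitivity (py w * (g1 * px v + g2 * py v + g3 * pz v)
                - py v * (g1 * px w + g2 * py w + g3 * pz w));
  [unfold n1, n3; ring | rewrite Hv, Hw; ring]. }
assert (c3 : n1 * g2 - n2 * g1 = 0).
{ transitivity (pz w * (g1 * px v + g2 * py v + g3 * pz v)
                - pz v * (g1 * px w + g2 * py w + g3 * pz w));
  [unfold n1, n2; ring | rewrite Hv, Hw; ring]. }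
clearbody n1 n2 n3.
exists ((n1 * g1 + n2 * g2 + n3 * g3) / (g1 * g1 + g2 * g2 + g3 * g3)).
split; [|split].
- apply Rmult_eq_reg_r with (g1 * g1 + g2 * g2 + g3 * g3); [| lra].
  field_simplify; [| lra].
  transitivity ((n1 * g1 + n2 * g2 + n3 * g3) * g1 + g2 * (n1 * g2 - n2 * g1)
                - g3 * (n3 * g1 - n1 * g3)); [ring | rewrite c2, c3; ring].
- apply Rmult_eq_reg_r with (g1 * g1 + g2 * g2 + g3 * g3); [| lra].
  field_simplify; [| lra].
  transitivity ((n1 * g1 + n2 * g2 + n3 * g3) * g2 + g3 * (n2 * g3 - n3 * g2)
                - g1 * (n1 * g2 - n2 * g1)); [ring | rewrite c1, c3; ring].
- apply Rmult_eq_reg_r with (g1 * g1 + g2 * g2 + g3 * g3); [| lra].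
  field_simplify; [| lra].
  transitivity (- ((n1 * g1 + n2 * g2 + n3 * g3) * g3 + g1 * (n3 * g1 - n1 * g3)
                - g2 * (n2 * g3 - n3 * g2))); [ring | rewrite c1, c2; ring].
Qed.

Lemma lprod_lcross :
  lprod (lcross v w) (lcross v w)
  = - (lprod v v * lprod w w - lprod v w * lprod v w).
Proof. unfold lprod, lcross; autorewrite with r3; ring. Qed.

(** The normal is [m] times the gradient up to the sign of the third coordinate, so its Lorentzian
    square is [m^2 (g1^2 + g2^2 - g3^2)]; by Lagrange's identity this is minus the Gram
    determinant. *)
Lemma gradient_timelike :
  0 < lprod v v * lprod w w - lprod v w * lprod v w -> g1 * g1 + g2 * g2 < g3 * g3.
Proof.
intros Hpos. destruct lcross_parallel as (m & E1 & E2 & E3).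
assert (H := lprod_lcross). unfold lprod at 1 in H. rewrite E1, E2, E3 in H. nra.
Qed.

End NormalVector.

(** Differentiating the level equation twice replaces normal components of second derivatives by
    minus the Hessian. Its trace over the tangent plane is the full Lorentzian trace, here
    [2 h - h33], less the normal contribution, so only the gradient survives. The horizontal block
    of the Hessian is [h] times the identity because level functions are quadratic in
    [x^2 + y^2]. *)
Lemma curvature_numerator (v w a11 a12 a22 : R3) (g1 g2 g3 h h13 h23 h33 m c : R) :
  let Hess x y := h * (px x * px y + py x * py y) + h33 * (pz x * pz y)
                  + h13 * (px x * pz y + pz x * px y) + h23 * (py x * pz y + pz x * py y) in
  let n := lcross v w in
  px n = m * g1 -> py n = m * g2 -> pz n = - (m * g3) ->
  g1 * px a11 + g2 * py a11 + g3 * pz a11 + Hess v v = 0 ->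
  g1 * px a12 + g2 * py a12 + g3 * pz a12 + Hess v w = 0 ->
  g1 * px a22 + g2 * py a22 + g3 * pz a22 + Hess w w = 0 ->
  lprod (scal c n) a11 * lprod w w - 2 * lprod (scal c n) a12 * lprod v w
    + lprod (scal c n) a22 * lprod v v
  = c * (m * m * m) * ((g1 * g1 + g2 * g2 - g3 * g3) * (2 * h - h33)
      - (h * (g1 * g1 + g2 * g2) + h33 * (g3 * g3) - 2 * g3 * (g1 * h13 + g2 * h23))).
Proof.
intros Hess n E1 E2 E3 R11 R12 R22.
assert (L : forall x, lprod (scal c n) x = c * m * (g1 * px x + g2 * py x + g3 * pz x)).
{ intros x; unfold lprod; autorewrite with r3. rewrite E1, E2, E3; ring. }
rewrite !L.
replace (g1 * px a11 + g2 * py a11 + g3 * pz a11) with (- Hess v v) by lra.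
replace (g1 * px a12 + g2 * py a12 + g3 * pz a12) with (- Hess v w) by lra.
replace (g1 * px a22 + g2 * py a22 + g3 * pz a22) with (- Hess w w) by lra.
transitivity (c * m * (lprod n n * (2 * h - h33)
  - (h * (px n * px n + py n * py n) + h33 * (pz n * pz n)
     + 2 * h13 * (px n * pz n) + 2 * h23 * (py n * pz n)))).
- unfold Hess, n, lprod, lcross; autorewrite with r3; ring.
- unfold lprod; rewrite E1, E2, E3; ring.
Qed.

Lemma spacelike_disc (U : R2 -> Prop) X q :
  spacelike_param U X -> U q ->
  0 < lprod (D1 X q) (D1 X q) * lprod (D2 X q) (D2 X q)
      - lprod (D1 X q) (D2 X q) * lprod (D1 X q) (D2 X q).
Proof.
intros H Hq. specialize (H q Hq).
set (v := D1 X q) in *; set (w := D2 X q) in *.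
assert (E : forall a b, lprod (lin_comb a v b w) (lin_comb a v b w)
            = a * a * lprod v v + 2 * a * b * lprod v w + b * b * lprod w w).
{ intros a b; unfold lprod, lin_comb; autorewrite with r3; ring. }
assert (H1 : 0 < lprod v v).
{ specialize (H 1 0). rewrite E in H.
  assert (G : (1, 0) <> (0, 0)) by (intros G; injection G; lra). specialize (H G). lra. }
(* The component of [w] orthogonal to [v], cleared of denominators: its square is [lprod v v] times
   the Gram determinant. *)
specialize (H (- lprod v w) (lprod v v)). rewrite E in H.
assert (G : (- lprod v w, lprod v v) <> (0, 0)) by (intros G; injection G; lra).
specialize (H G).
apply Rmult_lt_reg_l with (lprod v v); [exact H1 |]. nra.
Qed.

Lemma mean_curvature_numerator X q :
  0 < lprod (D1 X q) (D1 X q) * lprod (D2 X q) (D2 X q)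
      - lprod (D1 X q) (D2 X q) * lprod (D1 X q) (D2 X q) ->
  mean_curvature X q = 0 <->
  lprod (unit_normal X q) (D1 (D1 X) q) * lprod (D2 X q) (D2 X q)
  - 2 * lprod (unit_normal X q) (D2 (D1 X) q) * lprod (D1 X q) (D2 X q)
  + lprod (unit_normal X q) (D2 (D2 X) q) * lprod (D1 X q) (D1 X q) = 0.
Proof.
intros Hd. unfold mean_curvature.
set (num := _ - 2 * _ * _ + _). set (den := _ - _) in *.
split; intros H.
- assert (H' : num / (2 * den) = 0) by lra.
  apply Rmult_integral in H'; destruct H' as [H' | H']; [exact H' |].
  exfalso; revert H'; apply Rinv_neq_0_compat; lra.
- rewrite H; unfold Rdiv; ring.
Qed.

(* Every circle, line and level set below is a zero set of this shape, in which the circle at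
   height z degenerates to a line when rho z = 0. *)
Definition levelf (rho a k : R -> R) (e1 e2 x y z : R) : R :=
  rho z * (x * x + y * y) - 2 * a z * (e1 * x + e2 * y) + k z.

Section LevelSet.

Variables (rho rho1 rho2 a a1 a2 k k1 k2 : R -> R) (I : R -> Prop) (e1 e2 : R).
Hypothesis Drho : forall z, I z -> is_derive rho z (rho1 z).
Hypothesis Drho1 : forall z, I z -> is_derive rho1 z (rho2 z).
Hypothesis Da : forall z, I z -> is_derive a z (a1 z).
Hypothesis Da1 : forall z, I z -> is_derive a1 z (a2 z).
Hypothesis Dk : forall z, I z -> is_derive k z (k1 z).
Hypothesis Dk1 : forall z, I z -> is_derive k1 z (k2 z).

Definition gr1 x z := 2 * rho z * x - 2 * a z * e1.
Definition gr2 y z := 2 * rho z * y - 2 * a z * e2.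
Definition gr3 x y z := levelf rho1 a1 k1 e1 e2 x y z.
Definition hs13 x z := 2 * rho1 z * x - 2 * a1 z * e1.
Definition hs23 y z := 2 * rho1 z * y - 2 * a1 z * e2.
Definition hs33 x y z := levelf rho2 a2 k2 e1 e2 x y z.

(** The last factor of [curvature_numerator] for [levelf], with [h = 2 rho]. *)
Definition curv x y z :=
  (gr1 x z * gr1 x z + gr2 y z * gr2 y z - gr3 x y z * gr3 x y z) * (4 * rho z - hs33 x y z)
  - (2 * rho z * (gr1 x z * gr1 x z + gr2 y z * gr2 y z) + hs33 x y z * (gr3 x y z * gr3 x y z)
     - 2 * gr3 x y z * (gr1 x z * hs13 x z + gr2 y z * hs23 y z)).

Lemma levelf_curve (x y z : R -> R) s x' y' z' :
  I (z s) -> is_derive x s x' -> is_derive y s y' -> is_derive z s z' ->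
  is_derive (fun s => levelf rho a k e1 e2 (x s) (y s) (z s)) s
    (gr1 (x s) (z s) * x' + gr2 (y s) (z s) * y' + gr3 (x s) (y s) (z s) * z').
Proof.
intros Hz Hx Hy Hz'. unfold levelf.
assert (Ex := ex_intro _ _ Hx : ex_derive x s).
assert (Ey := ex_intro _ _ Hy : ex_derive y s).
assert (Ez := ex_intro _ _ Hz' : ex_derive z s).
assert (Er := ex_intro _ _ (Drho _ Hz) : ex_derive rho (z s)).
assert (Ea := ex_intro _ _ (Da _ Hz) : ex_derive a (z s)).
assert (Ek := ex_intro _ _ (Dk _ Hz) : ex_derive k (z s)).
auto_derive.
- repeat split; assumption.
- rewrite (is_derive_unique (fun s : R => x s) _ _ Hx), (is_derive_unique (fun s : R => y s) _ _ Hy), (is_derive_unique (fun s : R => z s) _ _ Hz').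
  rewrite (is_derive_unique (fun s : R => rho s) _ _ (Drho _ Hz)), (is_derive_unique (fun s : R => a s) _ _ (Da _ Hz)),
    (is_derive_unique (fun s : R => k s) _ _ (Dk _ Hz)).
  unfold gr1, gr2, gr3, levelf; ring.
Qed.

(** To be used with [(u, v, w)] a first derivative of the chart: the gradient annihilates it along
    the whole curve, which gives the second-order relations required by [curvature_numerator]. *)
Lemma gradient_curve (x y z u v w : R -> R) s x' y' z' u' v' w' :
  I (z s) -> is_derive x s x' -> is_derive y s y' -> is_derive z s z' ->
  is_derive u s u' -> is_derive v s v' -> is_derive w s w' ->
  is_derive (fun s => gr1 (x s) (z s) * u s + gr2 (y s) (z s) * v s
                      + gr3 (x s) (y s) (z s) * w s) s
    (gr1 (x s) (z s) * u' + gr2 (y s) (z s) * v' + gr3 (x s) (y s) (z s) * w'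
     + (2 * rho (z s) * (x' * u s + y' * v s) + hs33 (x s) (y s) (z s) * (z' * w s)
        + hs13 (x s) (z s) * (x' * w s + z' * u s) + hs23 (y s) (z s) * (y' * w s + z' * v s))).
Proof.
intros Hz Hx Hy Hz' Hu Hv Hw. unfold gr1, gr2, gr3, levelf.
assert (Ex := ex_intro _ _ Hx : ex_derive x s).
assert (Ey := ex_intro _ _ Hy : ex_derive y s).
assert (Ez := ex_intro _ _ Hz' : ex_derive z s).
assert (Eu := ex_intro _ _ Hu : ex_derive u s).
assert (Ev := ex_intro _ _ Hv : ex_derive v s).
assert (Ew := ex_intro _ _ Hw : ex_derive w s).
assert (Er := ex_intro _ _ (Drho _ Hz) : ex_derive rho (z s)).
assert (Ea := ex_intro _ _ (Da _ Hz) : ex_derive a (z s)).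
assert (Er1 := ex_intro _ _ (Drho1 _ Hz) : ex_derive rho1 (z s)).
assert (Ea1 := ex_intro _ _ (Da1 _ Hz) : ex_derive a1 (z s)).
assert (Ek1 := ex_intro _ _ (Dk1 _ Hz) : ex_derive k1 (z s)).
auto_derive.
- repeat split; assumption.
- rewrite (is_derive_unique (fun s : R => x s) _ _ Hx), (is_derive_unique (fun s : R => y s) _ _ Hy), (is_derive_unique (fun s : R => z s) _ _ Hz').
  rewrite (is_derive_unique (fun s : R => u s) _ _ Hu), (is_derive_unique (fun s : R => v s) _ _ Hv), (is_derive_unique (fun s : R => w s) _ _ Hw).
  rewrite (is_derive_unique (fun s : R => rho s) _ _ (Drho _ Hz)), (is_derive_unique (fun s : R => a s) _ _ (Da _ Hz)).
  rewrite (is_derive_unique (fun s : R => rho1 s) _ _ (Drho1 _ Hz)), (is_derive_unique (fun s : R => a1 s) _ _ (Da1 _ Hz)),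
    (is_derive_unique (fun s : R => k1 s) _ _ (Dk1 _ Hz)).
  unfold hs13, hs23, hs33, levelf; ring.
Qed.

Variables (U : R2 -> Prop) (X : R2 -> R3) (b1 b2 : R).
Hypothesis HU : open U.
Hypothesis HX : smooth U X.
Hypothesis HI : forall q, U q -> I (pz (X q)).
Hypothesis Hlev : forall q, U q -> levelf rho a k e1 e2 (px (X q) - b1) (py (X q) - b2) (pz (X q)) = 0.

Let G1 q := gr1 (px (X q) - b1) (pz (X q)).
Let G2 q := gr2 (py (X q) - b2) (pz (X q)).
Let G3 q := gr3 (px (X q) - b1) (py (X q) - b2) (pz (X q)).

Let Hd q : U q ->
  (is_derive (fun s => px (X (s, snd q)) - b1) (fst q) (px (D1 X q)) /\
   is_derive (fun s => py (X (s, snd q)) - b2) (fst q) (py (D1 X q)) /\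
   is_derive (fun s => pz (X (s, snd q))) (fst q) (pz (D1 X q))) /\
  (is_derive (fun s => px (X (fst q, s)) - b1) (snd q) (px (D2 X q)) /\
   is_derive (fun s => py (X (fst q, s)) - b2) (snd q) (py (D2 X q)) /\
   is_derive (fun s => pz (X (fst q, s))) (snd q) (pz (D2 X q))).
Proof.
intros Hq. destruct (HX 1%nat) as [[H1 _] [[H2 _] [H3 _]]].
destruct (H1 q Hq) as [_ [A1 A2]]; destruct (H2 q Hq) as [_ [B1 B2]];
destruct (H3 q Hq) as [_ [C1 C2]].
apply Derive_correct in A1; apply Derive_correct in A2; apply Derive_correct in B1;
apply Derive_correct in B2; apply Derive_correct in C1; apply Derive_correct in C2.
assert (K : forall (f : R -> R) b x l, is_derive f x l -> is_derive (fun s => f s - b) x l).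
{ intros f b x l Hf. replace l with (minus l 0) by (unfold minus, plus, opp; simpl; ring).
  apply (is_derive_minus (V := R_NormedModule) f (fun _ => b)); [exact Hf |].
  apply (is_derive_const (V := R_NormedModule) b). }
split; (split; [|split]).
- exact (K _ b1 _ _ A1).
- exact (K _ b2 _ _ B1).
- exact C1.
- exact (K _ b1 _ _ A2).
- exact (K _ b2 _ _ B2).
- exact C2.
Qed.

Let Hd1 q : U q -> G1 q * px (D1 X q) + G2 q * py (D1 X q) + G3 q * pz (D1 X q) = 0.
Proof.
intros Hq. destruct (Hd q Hq) as [(A & B & C) _]. destruct q as [s t]; simpl in *.
assert (H := levelf_curve _ _ _ _ _ _ _ (HI _ Hq) A B C).
etransitivity; [symmetry; exact (is_derive_unique _ _ _ H) |].
rewrite <- (Derive_const 0 s). apply Derive_ext_loc.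
generalize (open_slice1 U (s, t) HU Hq). apply filter_imp. intros s' Hs'. now apply Hlev.
Qed.

Let Hd2 q : U q -> G1 q * px (D2 X q) + G2 q * py (D2 X q) + G3 q * pz (D2 X q) = 0.
Proof.
intros Hq. destruct (Hd q Hq) as [_ (A & B & C)]. destruct q as [s t]; simpl in *.
assert (H := levelf_curve _ _ _ _ _ _ _ (HI _ Hq) A B C).
etransitivity; [symmetry; exact (is_derive_unique _ _ _ H) |].
rewrite <- (Derive_const 0 t). apply Derive_ext_loc.
generalize (open_slice2 U (s, t) HU Hq). apply filter_imp. intros s' Hs'. now apply Hlev.
Qed.

Let Hdd q : U q ->
  (is_derive (fun s => px (D1 X (s, snd q))) (fst q) (px (D1 (D1 X) q)) /\
   is_derive (fun s => py (D1 X (s, snd q))) (fst q) (py (D1 (D1 X) q)) /\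
   is_derive (fun s => pz (D1 X (s, snd q))) (fst q) (pz (D1 (D1 X) q))) /\
  (is_derive (fun s => px (D1 X (fst q, s))) (snd q) (px (D2 (D1 X) q)) /\
   is_derive (fun s => py (D1 X (fst q, s))) (snd q) (py (D2 (D1 X) q)) /\
   is_derive (fun s => pz (D1 X (fst q, s))) (snd q) (pz (D2 (D1 X) q))) /\
  (is_derive (fun s => px (D2 X (fst q, s))) (snd q) (px (D2 (D2 X) q)) /\
   is_derive (fun s => py (D2 X (fst q, s))) (snd q) (py (D2 (D2 X) q)) /\
   is_derive (fun s => pz (D2 X (fst q, s))) (snd q) (pz (D2 (D2 X) q))).
Proof.
intros Hq.
destruct (smooth_D1 _ _ HX 1%nat) as [[H1 _] [[H2 _] [H3 _]]].
destruct (smooth_D2 _ _ HX 1%nat) as [[K1 _] [[K2 _] [K3 _]]].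
destruct (H1 q Hq) as [_ [A1 A2]]; destruct (H2 q Hq) as [_ [B1 B2]];
destruct (H3 q Hq) as [_ [C1 C2]]; destruct (K1 q Hq) as [_ [_ A3]];
destruct (K2 q Hq) as [_ [_ B3]]; destruct (K3 q Hq) as [_ [_ C3]].
split; [split; [|split] | split; (split; [|split])].
- exact (Derive_correct _ _ A1).
- exact (Derive_correct _ _ B1).
- exact (Derive_correct _ _ C1).
- exact (Derive_correct _ _ A2).
- exact (Derive_correct _ _ B2).
- exact (Derive_correct _ _ C2).
- exact (Derive_correct _ _ A3).
- exact (Derive_correct _ _ B3).
- exact (Derive_correct _ _ C3).
Qed.

(** The numerator of the mean curvature is [curv] times [c m^3], where [c] normalises the normal and
    [m] compares it with the gradient; neither factor vanishes when the Gram determinant is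
    positive. *)
Lemma level_set_curvature q :
  U q -> 0 < G1 q * G1 q + G2 q * G2 q + G3 q * G3 q ->
  0 < lprod (D1 X q) (D1 X q) * lprod (D2 X q) (D2 X q)
      - lprod (D1 X q) (D2 X q) * lprod (D1 X q) (D2 X q) ->
  mean_curvature X q = 0 <-> curv (px (X q) - b1) (py (X q) - b2) (pz (X q)) = 0.
Proof.
intros Hq Hg Hdisc.
rewrite (mean_curvature_numerator X q Hdisc).
destruct (lcross_parallel _ _ _ _ _ (Hd1 q Hq) (Hd2 q Hq) Hg) as (m & E1 & E2 & E3).
assert (Hn := lprod_lcross (D1 X q) (D2 X q)).
assert (Hm : m <> 0).
{ intros ->. unfold lprod at 1 in Hn. rewrite E1, E2, E3 in Hn. lra. }
destruct (Hd q Hq) as [(A1 & B1 & C1) (A2 & B2 & C2)].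
destruct (Hdd q Hq) as [(A3 & B3 & C3) [(A4 & B4 & C4) (A5 & B5 & C5)]].
unfold unit_normal.
rewrite (curvature_numerator _ _ _ _ _ (G1 q) (G2 q) (G3 q) (2 * rho (pz (X q)))
  (hs13 (px (X q) - b1) (pz (X q))) (hs23 (py (X q) - b2) (pz (X q)))
  (hs33 (px (X q) - b1) (py (X q) - b2) (pz (X q))) m _ E1 E2 E3).
- set (c := / sqrt _).
  assert (Hc : c <> 0).
  { apply Rinv_neq_0_compat. apply Rgt_not_eq, sqrt_lt_R0, Rabs_pos_lt.
    change (lprod (lcross (D1 X q) (D2 X q)) (lcross (D1 X q) (D2 X q)) <> 0).
    rewrite Hn; lra. }
  replace (2 * (2 * rho (pz (X q)))) with (4 * rho (pz (X q))) by ring.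
  fold (curv (px (X q) - b1) (py (X q) - b2) (pz (X q))).
  unfold G1, G2, G3; fold (curv (px (X q) - b1) (py (X q) - b2) (pz (X q))).
  split; intros H; [| rewrite H; ring].
  apply Rmult_integral in H; destruct H as [H | H]; [exfalso; revert H | exact H].
  repeat apply Rmult_integral_contrapositive_currified; assumption.
- destruct q as [s t]; simpl in *.
  assert (H := gradient_curve _ _ _ _ _ _ _ _ _ _ _ _ _ (HI _ Hq) A1 B1 C1 A3 B3 C3).
  etransitivity; [symmetry; exact (is_derive_unique _ _ _ H) |].
  rewrite <- (Derive_const 0 s). apply Derive_ext_loc.
  generalize (open_slice1 U (s, t) HU Hq). apply filter_imp. intros s' Hs'. now apply Hd1.
- destruct q as [s t]; simpl in *.
  (* The mixed relation differentiates the first tangent vector in the second direction, so the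
     Hessian appears with its arguments exchanged. *)
  assert (H := gradient_curve _ _ _ _ _ _ _ _ _ _ _ _ _ (HI _ Hq) A2 B2 C2 A4 B4 C4).
  apply is_derive_unique in H. match type of H with _ = ?r => transitivity r end.
  + unfold G1, G2, G3; simpl; ring.
  + rewrite <- H. rewrite <- (Derive_const 0 t). apply Derive_ext_loc.
    generalize (open_slice2 U (s, t) HU Hq). apply filter_imp. intros s' Hs'. now apply Hd1.
- destruct q as [s t]; simpl in *.
  assert (H := gradient_curve _ _ _ _ _ _ _ _ _ _ _ _ _ (HI _ Hq) A2 B2 C2 A5 B5 C5).
  etransitivity; [symmetry; exact (is_derive_unique _ _ _ H) |].
  rewrite <- (Derive_const 0 t). apply Derive_ext_loc.
  generalize (open_slice2 U (s, t) HU Hq). apply filter_imp. intros s' Hs'. now apply Hd2.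
Qed.

Lemma level_set_timelike q :
  U q -> 0 < G1 q * G1 q + G2 q * G2 q + G3 q * G3 q -> spacelike_param U X ->
  G1 q * G1 q + G2 q * G2 q < G3 q * G3 q.
Proof.
intros Hq Hg Hsp.
apply (gradient_timelike _ _ _ _ _ (Hd1 q Hq) (Hd2 q Hq) Hg).
now apply (spacelike_disc U).
Qed.

(** For a tangent vector, [g3 z = - (g1 x + g2 y)]; Cauchy-Schwarz then gives
    [g3^2 z^2 <= (g1^2 + g2^2)(x^2 + y^2)], which is below [g3^2 (x^2 + y^2)]. *)
Lemma level_set_spacelike q :
  U q -> G1 q * G1 q + G2 q * G2 q < G3 q * G3 q ->
  forall a b, lin_comb a (D1 X q) b (D2 X q) <> zero ->
    0 < lprod (lin_comb a (D1 X q) b (D2 X q)) (lin_comb a (D1 X q) b (D2 X q)).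
Proof.
intros Hq Hg s t Hnz.
assert (H : G1 q * px (lin_comb s (D1 X q) t (D2 X q)) + G2 q * py (lin_comb s (D1 X q) t (D2 X q))
            + G3 q * pz (lin_comb s (D1 X q) t (D2 X q)) = 0).
{ unfold lin_comb; autorewrite with r3.
  assert (H1 := Hd1 q Hq); assert (H2 := Hd2 q Hq).
  transitivity (s * (G1 q * px (D1 X q) + G2 q * py (D1 X q) + G3 q * pz (D1 X q))
    + t * (G1 q * px (D2 X q) + G2 q * py (D2 X q) + G3 q * pz (D2 X q))); [ring |].
  rewrite H1, H2; ring. }
set (v := lin_comb _ _ _ _) in *.
assert (Hv : px v <> 0 \/ py v <> 0 \/ pz v <> 0).
{ apply NNPP; intros K. apply Hnz. apply R3_eq; apply NNPP; intros K'; apply K; tauto. }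
unfold lprod. clearbody v.
generalize dependent (G1 q); generalize dependent (G2 q); generalize dependent (G3 q).
intros g3 g2 g1 Hg H. clear - Hv Hg H.
set (x := px v) in *; set (y := py v) in *; set (z := pz v) in *; clearbody x y z.
assert (Hxy : 0 < x * x + y * y).
{ destruct (Rle_lt_dec (x * x + y * y) 0) as [L | L]; [| exact L].
  assert (x = 0) by nra. assert (y = 0) by nra. subst.
  assert (z <> 0) by tauto. assert (g3 * z = 0) by lra.
  apply Rmult_integral in H1; destruct H1; [subst; nra | tauto]. }
assert (CS : g3 * g3 * (z * z) <= (g1 * g1 + g2 * g2) * (x * x + y * y)).
{ replace (g3 * g3 * (z * z)) with ((g1 * x + g2 * y) * (g1 * x + g2 * y)).
  - assert (0 <= (g1 * y - g2 * x) * (g1 * y - g2 * x)) by apply Rle_0_sqr. lra.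
  - replace (g1 * x + g2 * y) with (- (g3 * z)) by lra. ring. }
assert (0 < g3 * g3) by nra.
apply Rmult_lt_reg_l with (g3 * g3); [assumption |]. nra.
Qed.

End LevelSet.

(** * The radius and the centre of the circles *)

Lemma is_derive_continuity_pt (f : R -> R) x l : is_derive f x l -> continuity_pt f x.
Proof.
intros H. apply continuity_pt_filterlim, (ex_derive_continuous f x). now exists l.
Qed.

Lemma MVT_open (f f' : R -> R) a b s t :
  (forall x, a < x < b -> is_derive f x (f' x)) -> a < s < b -> a < t < b ->
  exists c, Rmin s t <= c <= Rmax s t /\ f t - f s = f' c * (t - s).
Proof.
intros H Hs Ht.
assert (K : forall x, Rmin s t <= x <= Rmax s t -> a < x < b).
{ intros x [H1 H2]. unfold Rmin, Rmax in *; destruct (Rle_dec s t); lra. }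
apply (MVT_gen f s t f').
- intros x Hx; apply H, K; lra.
- intros x Hx. apply (is_derive_continuity_pt f x (f' x)), H, K, Hx.
Qed.

Lemma derive0_const (f f' : R -> R) a b s t :
  (forall x, a < x < b -> is_derive f x (f' x)) -> (forall x, a < x < b -> f' x = 0) ->
  a < s < b -> a < t < b -> f s = f t.
Proof.
intros H H0 Hs Ht. destruct (MVT_open f f' a b s t H Hs Ht) as (c & Hc & E).
rewrite H0 in E; [lra |].
unfold Rmin, Rmax in Hc; destruct (Rle_dec s t); lra.
Qed.

Lemma derive_pos_increasing (f f' : R -> R) a b s t :
  (forall x, a < x < b -> is_derive f x (f' x)) -> (forall x, a < x < b -> 0 < f' x) ->
  a < s -> s < t -> t < b -> f s < f t.
Proof.
intros H H0 Hs Hst Ht. destruct (MVT_open f f' a b s t H) as (c & Hc & E); try lra.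
rewrite Rmin_left, Rmax_right in Hc by lra.
assert (0 < f' c) by (apply H0; lra). nra.
Qed.

(** By the mean value theorem a difference quotient at [x] is a value of [f'] nearby. It serves at
    [z0], where the two halves of the continued profile are glued. *)
Lemma is_derive_of_limit (f f' : R -> R) a b x :
  a < x < b -> (forall y, a < y < b -> y <> x -> is_derive f y (f' y)) ->
  continuous f x -> continuous f' x -> is_derive f x (f' x).
Proof.
intros Hx Hd Hf Hf'. apply is_derive_Reals. intros eps Heps.
apply filterlim_locally with (eps := mkposreal eps Heps) in Hf'.
destruct Hf' as [e He].
assert (Hm : 0 < Rmin e (Rmin (x - a) (b - x))).
{ repeat apply Rmin_pos; [apply cond_pos | lra | lra]. }
exists (mkposreal _ Hm). intros h Hh0 Hh. simpl in Hh.
assert (H1 := Rmin_l e (Rmin (x - a) (b - x))).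
assert (H2 := Rmin_r e (Rmin (x - a) (b - x))).
assert (H3 := Rmin_l (x - a) (b - x)).
assert (H4 := Rmin_r (x - a) (b - x)).
destruct (MVT_gen f x (x + h) f') as (c & Hc & E).
- intros y Hy. apply Hd; unfold Rmin, Rmax in Hy;
    destruct (Rle_dec x (x + h)); destruct (Rabs_def2 _ _ Hh); lra.
- intros y Hy. destruct (Req_dec y x) as [-> | Hyx].
  + now apply continuity_pt_filterlim.
  + apply (is_derive_continuity_pt f y (f' y)), Hd; [| exact Hyx].
    unfold Rmin, Rmax in Hy; destruct (Rle_dec x (x + h)); destruct (Rabs_def2 _ _ Hh); lra.
- rewrite E. replace (f' c * (x + h - x) / h - f' x) with (f' c - f' x) by (field; exact Hh0).
  apply He. change (Rabs (c - x) < e).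
  destruct (Rabs_def2 _ _ Hh).
  unfold Rmin, Rmax in Hc; destruct (Rle_dec x (x + h)); apply Rabs_def1; lra.
Qed.

Section ODE.

Variables (z0 : R) (r r1 r2 c c1 c2 : R -> R).
Hypothesis Hz0 : 0 < z0.
Hypothesis Hr : forall t, 0 < t < z0 -> 0 < r t.
Hypothesis Dr : forall t, 0 < t < z0 -> is_derive r t (r1 t).
Hypothesis Dr1 : forall t, 0 < t < z0 -> is_derive r1 t (r2 t).
Hypothesis Dc : forall t, 0 < t < z0 -> is_derive c t (c1 t).
Hypothesis Dc1 : forall t, 0 < t < z0 -> is_derive c1 t (c2 t).
Hypothesis O1 : forall t, 0 < t < z0 -> r t * c2 t = 2 * r1 t * c1 t.
Hypothesis O2 : forall t, 0 < t < z0 -> 1 - r1 t * r1 t - c1 t * c1 t + r t * r2 t = 0.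

(** The equation [O1] is the vanishing of the derivative of [c1 / r^2]; the constant is read off at
    the middle height. *)
Lemma centre_first_integral :
  exists lam, forall t, 0 < t < z0 -> c1 t = lam * (r t * r t).
Proof.
exists (c1 (z0 / 2) / (r (z0 / 2) * r (z0 / 2))). intros t Ht.
assert (Hh : 0 < z0 / 2 < z0) by lra.
rewrite (derive0_const (fun t => c1 t / (r t * r t))
  (fun t => (c2 t * r t - 2 * r1 t * c1 t) / (r t * r t * r t)) 0 z0 (z0 / 2) t); auto.
- assert (H := Hr t Ht). field. lra.
- intros x Hx. assert (H := Hr x Hx).
  assert (Er := ex_intro _ _ (Dr _ Hx) : ex_derive r x).
  assert (Ec := ex_intro _ _ (Dc1 _ Hx) : ex_derive c1 x).
  auto_derive.
  + repeat split; try assumption. nra.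
  + rewrite (is_derive_unique (fun s : R => r s) _ _ (Dr _ Hx)).
    rewrite (is_derive_unique (fun s : R => c1 s) _ _ (Dc1 _ Hx)). field. lra.
- intros x Hx. assert (H := Hr x Hx). assert (H' := O1 x Hx).
  replace (c2 x * r x - 2 * r1 x * c1 x) with 0 by lra. unfold Rdiv; ring.
Qed.

Variable lam : R.
Hypothesis Hc1 : forall t, 0 < t < z0 -> c1 t = lam * (r t * r t).

(** After [c1] is replaced by [lam r^2], [O2] says exactly that [(r1^2 - 1 - lam^2 r^4) / r^2] has
    derivative zero. *)
Lemma radius_first_integral :
  exists K, forall t, 0 < t < z0 ->
    r1 t * r1 t = 1 + K * (r t * r t) + lam * lam * (r t * r t * (r t * r t)).
Proof.
set (F := fun t => (r1 t * r1 t - 1 - lam * lam * (r t * r t * (r t * r t))) / (r t * r t)).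
exists (F (z0 / 2)). intros t Ht.
assert (Hh : 0 < z0 / 2 < z0) by lra.
rewrite (derive0_const F
  (fun t => 2 * r1 t * (1 - r1 t * r1 t - lam * lam * (r t * r t * (r t * r t)) + r t * r2 t)
            / (r t * r t * r t)) 0 z0 (z0 / 2) t); auto.
- assert (H := Hr t Ht). unfold F. field. lra.
- intros x Hx. assert (H := Hr x Hx).
  assert (Er := ex_intro _ _ (Dr _ Hx) : ex_derive r x).
  assert (Er1 := ex_intro _ _ (Dr1 _ Hx) : ex_derive r1 x).
  unfold F; auto_derive.
  + repeat split; try assumption. nra.
  + rewrite (is_derive_unique (fun s : R => r s) _ _ (Dr _ Hx)).
    rewrite (is_derive_unique (fun s : R => r1 s) _ _ (Dr1 _ Hx)). field. lra.
- intros x Hx. assert (H := Hr x Hx). assert (H' := O2 x Hx). rewrite Hc1 in H' by exact Hx.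
  replace (1 - r1 x * r1 x - lam * lam * (r x * r x * (r x * r x)) + r x * r2 x) with 0 by lra.
  unfold Rdiv; ring.
Qed.

Hypothesis Hlam : 0 < lam.
Hypothesis Hsp : forall t, 0 < t < z0 -> forall x, -1 <= x <= 1 ->
  1 < (c1 t * x + r1 t) * (c1 t * x + r1 t).

Lemma spacelike_speed t : 0 < t < z0 -> 1 + lam * (r t * r t) < Rabs (r1 t).
Proof.
intros Ht. assert (H := Hr t Ht). assert (S := Hsp t Ht). rewrite Hc1 in S by exact Ht.
set (m := lam * (r t * r t)) in *. assert (Hm : 0 < m) by (repeat apply Rmult_lt_0_compat; assumption).
set (w := r1 t) in *. clearbody m w.
destruct (Rle_lt_dec (Rabs w) m) as [L | L].
(* This direction on the circle makes the speed [m x + w] vanish, against [Hsp]. *)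
- exfalso. specialize (S (- w / m)).
  assert (B : -1 <= - w / m <= 1).
  { unfold Rabs in L; destruct (Rcase_abs w).
    - split; apply Rmult_le_reg_r with m; try lra; field_simplify; lra.
    - split; apply Rmult_le_reg_r with m; try lra; field_simplify; lra. }
  specialize (S B). replace (m * (- w / m) + w) with 0 in S by (field; lra). lra.
- unfold Rabs in *; destruct (Rcase_abs w).
  (* The extreme direction in which [m] opposes [w] gives the sharpest bound. *)
  + assert (S1 : 1 < (m * 1 + w) * (m * 1 + w)) by (apply S; lra). nra.
  + assert (S1 : 1 < (m * -1 + w) * (m * -1 + w)) by (apply S; lra). nra.
Qed.

(** Squaring [spacelike_speed] gives [(1 + lam r^2)^2 < 1 + K r^2 + lam^2 r^4]; the terms 1 and
    [lam^2 r^4] cancel. *)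
Lemma spacelike_modulus K :
  (forall t, 0 < t < z0 ->
    r1 t * r1 t = 1 + K * (r t * r t) + lam * lam * (r t * r t * (r t * r t))) ->
  2 * lam < K.
Proof.
intros HK. assert (Hh : 0 < z0 / 2 < z0) by lra.
assert (H1 := HK _ Hh). assert (H2 := spacelike_speed _ Hh). assert (H := Hr _ Hh).
set (u := r (z0 / 2) * r (z0 / 2)) in *. assert (0 < u) by (unfold u; nra).
assert (Hlu : 0 < lam * u) by now apply Rmult_lt_0_compat.
assert (H3 : (1 + lam * u) * (1 + lam * u) < r1 (z0 / 2) * r1 (z0 / 2)).
{ unfold Rabs in H2; destruct (Rcase_abs (r1 (z0 / 2))); nra. }
rewrite H1 in H3. nra.
Qed.

Hypothesis Hlim : filterlim r (at_right 0) (locally 0).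

(** The speed never vanishes, so it has one sign. The radius tends to 0 at the conelike point while
    positive, hence increases somewhere, and the intermediate value theorem excludes a negative sign
    elsewhere. *)
Lemma speed_pos t : 0 < t < z0 -> 0 < r1 t.
Proof.
assert (Hnz : forall t, 0 < t < z0 -> r1 t <> 0).
{ intros s Hs E. assert (H := spacelike_speed s Hs). rewrite E, Rabs_R0 in H.
  assert (Hrs := Hr s Hs). assert (0 < lam * (r s * r s)) by (repeat apply Rmult_lt_0_compat; assumption).
  lra. }
intros Ht. destruct (Rtotal_order (r1 t) 0) as [L | [L | L]]; [| now apply Hnz in L | exact L].
exfalso.
assert (Hrt : 0 < r t / 2) by (generalize (Hr t Ht); lra).
destruct (proj1 (filterlim_locally _ _) Hlim (mkposreal _ Hrt)) as [e He].
set (s := Rmin (e / 2) (t / 2)).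
assert (Hs1 := Rmin_l (e / 2) (t / 2)); assert (Hs2 := Rmin_r (e / 2) (t / 2)).
assert (Hs : 0 < s) by (apply Rmin_pos; [generalize (cond_pos e) |]; lra).
fold s in Hs1, Hs2.
assert (Hrs : r s < r t / 2).
{ assert (B : ball 0 e s) by (apply Rabs_def1; unfold minus, plus, opp; simpl;
    generalize (cond_pos e); lra).
  assert (B' := He s B Hs). change (Rabs (r s - 0) < r t / 2) in B'.
  destruct (Rabs_def2 _ _ B'); lra. }
destruct (MVT_open r r1 0 z0 s t Dr) as (x & Hx & E); try lra.
rewrite Rmin_left, Rmax_right in Hx by lra.
assert (Hx' : 0 < r1 x).
{ apply Rnot_le_lt. intros Q. assert (0 < r t - r s) by (generalize (Hr t Ht); lra). nra. }
destruct (IVT_interv (fun y => - r1 y) x t) as (y & Hy & Ey).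
- intros y Hy. apply continuity_pt_opp, (is_derive_continuity_pt _ _ (r2 y)), Dr1; lra.
- destruct Hx as [_ [Hx | ->]]; lra.
- lra.
- lra.
- apply (Hnz y); lra.
Qed.

End ODE.

(** * Analytic continuation through the line *)

(* At z0 the reciprocal of the radius vanishes; continued as an odd function about z0 it still
   solves rho' = - sqrt (lam^2 + K rho^2 + rho^4), so it is smooth there. *)
Definition invrad (z0 : R) (r : R -> R) (t : R) : R :=
  if Rlt_dec t z0 then / r t else if Rlt_dec z0 t then - / r (2 * z0 - t) else 0.

Definition quartic (lam K x : R) : R := lam * lam + K * (x * x) + x * x * (x * x).

Section Continuation.

Variables (z0 lam K : R) (r r1 : R -> R).
Hypothesis Hz0 : 0 < z0.
Hypothesis Hlam : 0 < lam.
Hypothesis HK : 2 * lam < K.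
Hypothesis Hr : forall t, 0 < t < z0 -> 0 < r t.
Hypothesis Dr : forall t, 0 < t < z0 -> is_derive r t (r1 t).
Hypothesis Hr1 : forall t, 0 < t < z0 -> 0 < r1 t.
Hypothesis HrK : forall t, 0 < t < z0 ->
  r1 t * r1 t = 1 + K * (r t * r t) + lam * lam * (r t * r t * (r t * r t)).
Hypothesis Hinf : forall m, exists e, 0 < e /\ forall t, 0 < t < z0 -> z0 - e < t -> m < r t.

Definition rho := invrad z0 r.
(** The negative root: [r] increases, so [rho] decreases below [z0], and its odd continuation
    decreases above as well. *)
Definition rho1 t := - sqrt (quartic lam K (rho t)).
Definition rho2 t := K * rho t + 2 * (rho t * rho t * rho t).

Lemma rho_below t : t < z0 -> rho t = / r t.
Proof. intros Ht. unfold rho, invrad. now destruct (Rlt_dec t z0). Qed.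

Lemma rho_z0 : rho z0 = 0.
Proof. unfold rho, invrad. destruct (Rlt_dec z0 z0); lra. Qed.

Lemma rho_odd t : rho (2 * z0 - t) = - rho t.
Proof.
unfold rho, invrad.
destruct (Rlt_dec t z0) as [L | L]; destruct (Rlt_dec (2 * z0 - t) z0); try lra.
- destruct (Rlt_dec z0 (2 * z0 - t)); [| lra].
  now replace (2 * z0 - (2 * z0 - t)) with t by ring.
- destruct (Rlt_dec z0 t); lra.
- destruct (Rlt_dec z0 t); try lra. destruct (Rlt_dec z0 (2 * z0 - t)); lra.
Qed.

Lemma rho_pos t : 0 < t < z0 -> 0 < rho t.
Proof. intros Ht. rewrite rho_below by tauto. now apply Rinv_0_lt_compat, Hr. Qed.

Lemma rho_neg t : z0 < t < 2 * z0 -> rho t < 0.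
Proof.
intros Ht. assert (H : 0 < rho (2 * z0 - t)) by (apply rho_pos; lra).
rewrite rho_odd in H; lra.
Qed.

Lemma quartic_pos x : 0 < quartic lam K x.
Proof.
unfold quartic. assert (0 < lam * lam) by nra. assert (0 <= x * x) by nra.
assert (0 <= K * (x * x)) by nra. nra.
Qed.

Lemma rho1_sqr t : rho1 t * rho1 t = quartic lam K (rho t).
Proof.
unfold rho1. transitivity (sqrt (quartic lam K (rho t)) * sqrt (quartic lam K (rho t))); [ring |].
apply sqrt_sqrt. apply Rlt_le, quartic_pos.
Qed.

Lemma rho1_neg t : rho1 t < 0.
Proof. unfold rho1. generalize (sqrt_lt_R0 _ (quartic_pos (rho t))); lra. Qed.

Lemma rho1_even t : rho1 (2 * z0 - t) = rho1 t.
Proof. unfold rho1, quartic. rewrite rho_odd. do 2 f_equal; ring. Qed.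

Lemma rho1_z0 : rho1 z0 = - lam.
Proof.
unfold rho1, quartic. rewrite rho_z0. f_equal.
replace (lam * lam + K * (0 * 0) + 0 * 0 * (0 * 0)) with (lam * lam) by ring.
apply sqrt_square; lra.
Qed.

Lemma rho1_below t : 0 < t < z0 -> rho1 t = - r1 t / (r t * r t).
Proof.
intros Ht. assert (H := Hr t Ht). assert (H1 := Hr1 t Ht).
assert (Hp : 0 < r1 t / (r t * r t)) by (apply Rdiv_lt_0_compat; nra).
unfold rho1. replace (quartic lam K (rho t)) with (r1 t / (r t * r t) * (r1 t / (r t * r t))).
- rewrite sqrt_square by lra. field. lra.
- unfold quartic. rewrite rho_below by lra.
  transitivity (r1 t * r1 t / (r t * r t * (r t * r t))); [field; lra |].
  rewrite HrK by exact Ht. field. lra.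
Qed.

Lemma rho_derive_below t : 0 < t < z0 -> is_derive rho t (rho1 t).
Proof.
intros Ht. assert (H := Hr t Ht).
apply (is_derive_ext_loc (fun s => / r s)).
- generalize (locally_between 0 z0 t Ht). apply filter_imp.
  intros s Hs. symmetry. now apply rho_below.
- rewrite rho1_below by exact Ht. replace (r t * r t) with (r t ^ 2) by ring.
  apply (is_derive_inv r t (r1 t)); [now apply Dr | lra].
Qed.

Lemma rho_derive_above t : z0 < t < 2 * z0 -> is_derive rho t (rho1 t).
Proof.
intros Ht.
apply (is_derive_ext (fun s => - rho (2 * z0 - s))).
- intros s. change (- rho (2 * z0 - s) = rho s). rewrite rho_odd; ring.
- assert (H := rho_derive_below (2 * z0 - t) ltac:(lra)). rewrite rho1_even in H.
  assert (E := ex_intro _ _ H : ex_derive rho (2 * z0 - t)).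
  auto_derive; [now repeat split |].
  replace (2 * z0 + - t) with (2 * z0 - t) by ring.
  rewrite (is_derive_unique (fun s : R => rho s) _ _ H). ring.
Qed.

Lemma rho_small (eps : R) : 0 < eps ->
  exists e, 0 < e /\ forall t, 0 < t < z0 -> z0 - e < t -> rho t < eps.
Proof.
intros He. destruct (Hinf (/ eps)) as (e & He0 & H). exists e. split; [exact He0 |].
intros t Ht Ht'. rewrite rho_below by lra. rewrite <- (Rinv_inv eps).
apply Rinv_lt_contravar; [| now apply H].
apply Rmult_lt_0_compat; [now apply Rinv_0_lt_compat | now apply Hr].
Qed.

Lemma rho_continuous_z0 : continuous rho z0.
Proof.
apply filterlim_locally. intros eps. rewrite rho_z0.
destruct (rho_small eps (cond_pos eps)) as (e & He & H).
assert (Hm : 0 < Rmin e z0) by (apply Rmin_pos; lra).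
exists (mkposreal _ Hm). intros t Ht. change (Rabs (t - z0) < Rmin e z0) in Ht.
destruct (Rabs_def2 _ _ Ht) as [Ht1 Ht2].
assert (H1 := Rmin_l e z0); assert (H2 := Rmin_r e z0).
change (Rabs (rho t - 0) < eps). rewrite Rminus_0_r.
destruct (Rtotal_order t z0) as [L | [-> | L]].
- rewrite Rabs_right by (apply Rle_ge, Rlt_le, rho_pos; lra). apply H; lra.
- rewrite rho_z0, Rabs_R0. apply cond_pos.
- rewrite Rabs_left by (apply rho_neg; lra). rewrite <- rho_odd. apply H; lra.
Qed.

Lemma quartic_continuous x : continuous (quartic lam K) x.
Proof.
apply (ex_derive_continuous (K := R_AbsRing) (V := R_NormedModule)). unfold quartic. auto_derive; trivial.
Qed.

Lemma rho1_continuous t : continuous rho t -> continuous rho1 t.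
Proof.
intros H. unfold rho1.
apply (continuous_opp (V := R_NormedModule) (fun t => sqrt (quartic lam K (rho t)))).
apply (continuous_comp (fun t => quartic lam K (rho t)) sqrt); [| apply continuous_sqrt].
apply (continuous_comp rho (quartic lam K)); [exact H | apply quartic_continuous].
Qed.

(** Only [z0] needs an argument: [rho] is continuous there because [r] blows up, and [rho1] is a
    continuous function of [rho], so the derivative extends. *)
Lemma rho_derive t : 0 < t < 2 * z0 -> is_derive rho t (rho1 t).
Proof.
intros Ht. destruct (Rtotal_order t z0) as [L | [-> | L]].
- apply rho_derive_below; lra.
- apply (is_derive_of_limit rho rho1 0 (2 * z0)); [lra | | apply rho_continuous_z0 |
    apply rho1_continuous, rho_continuous_z0].
  intros y Hy Hne. destruct (Rtotal_order y z0) as [L | [E | L]].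
  + apply rho_derive_below; lra.
  + lra.
  + apply rho_derive_above; lra.
- apply rho_derive_above; lra.
Qed.

Lemma rho1_derive t : 0 < t < 2 * z0 -> is_derive rho1 t (rho2 t).
Proof.
intros Ht. assert (H := rho_derive t Ht). assert (Hp := quartic_pos (rho t)).
assert (E := ex_intro _ _ H : ex_derive rho t).
unfold rho1, quartic in *. auto_derive.
- repeat split; assumption.
- rewrite (is_derive_unique (fun s : R => rho s) _ _ H). unfold rho2.
  assert (0 < sqrt (lam * lam + K * (rho t * rho t) + rho t * rho t * (rho t * rho t)))
    by now apply sqrt_lt_R0.
  field. lra.
Qed.

(** An antiderivative of [lam r^2 = lam / rho^2] has a pole at [z0]. Since
    [(- rho1 / rho)' = lam^2 / rho^2 - rho^2], the function [(zet - rho1 / rho) / lam] is such an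
    antiderivative, and its product with [rho] is regular. *)
Definition zet t := RInt (fun s => rho s * rho s) z0 t.

Lemma zet_z0 : zet z0 = 0.
Proof. apply (RInt_point (V := R_CompleteNormedModule)). Qed.

Lemma rho_sqr_continuous t : 0 < t < 2 * z0 -> continuous (fun s => rho s * rho s) t.
Proof.
intros Ht. assert (H : continuous rho t) by (apply (ex_derive_continuous rho); exists (rho1 t); now apply rho_derive).
now apply (continuous_mult (K := R_AbsRing) rho rho).
Qed.

Lemma zet_derive t : 0 < t < 2 * z0 -> is_derive zet t (rho t * rho t).
Proof.
intros Ht. apply (is_derive_RInt (V := R_NormedModule) (fun s => rho s * rho s) zet z0 t);
  [| now apply rho_sqr_continuous].
generalize (locally_between 0 (2 * z0) t Ht). apply filter_imp. intros s Hs.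
apply (RInt_correct (V := R_CompleteNormedModule)).
apply (ex_RInt_continuous (V := R_CompleteNormedModule)).
intros x Hx. apply rho_sqr_continuous. unfold Rmin, Rmax in Hx; destruct (Rle_dec z0 s); lra.
Qed.

Lemma zet_odd t : 0 < t < 2 * z0 -> zet (2 * z0 - t) = - zet t.
Proof.
intros Ht.
assert (H : zet t + zet (2 * z0 - t) = zet z0 + zet (2 * z0 - z0)).
{ apply (derive0_const (fun t => zet t + zet (2 * z0 - t))
    (fun t => rho t * rho t - rho (2 * z0 - t) * rho (2 * z0 - t)) 0 (2 * z0) t z0); try lra.
  - intros x Hx. assert (Ha := zet_derive x Hx).
    assert (Hb := zet_derive (2 * z0 - x) ltac:(lra)).
    assert (Ea := ex_intro _ _ Ha : ex_derive zet x).
    assert (Eb := ex_intro _ _ Hb : ex_derive zet (2 * z0 - x)).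
    auto_derive; [now repeat split |].
    replace (2 * z0 + - x) with (2 * z0 - x) by ring.
    rewrite (is_derive_unique (fun s : R => zet s) _ _ Ha).
    rewrite (is_derive_unique (fun s : R => zet s) _ _ Hb). ring.
  - intros x Hx. rewrite rho_odd. ring. }
replace (2 * z0 - z0) with z0 in H by ring. rewrite zet_z0 in H. lra.
Qed.

(* On (0, z0) these are beta = rho C and gam = rho (C^2 - r^2), C being the coordinate of the
   centre measured from the line; the circles are rho (X^2 + Y^2) - 2 beta X + gam = 0. *)
Definition beta t := (rho t * zet t - rho1 t) / lam.
Definition beta1 t := (rho1 t * zet t - K * rho t - rho t * rho t * rho t) / lam.
Definition beta2 t := (K + 2 * (rho t * rho t)) * beta t.
Definition gam t :=
  (rho t * (zet t * zet t) - 2 * rho1 t * zet t + K * rho t + rho t * rho t * rho t) / (lam * lam).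
Definition gam1 t :=
  (rho1 t * (zet t * zet t) - 2 * (K * rho t + rho t * rho t * rho t) * zet t
   + rho1 t * (K + rho t * rho t)) / (lam * lam).
Definition gam2 t := (K + 2 * (rho t * rho t)) * gam t + 2 * rho t.

Local Ltac derive_profile t Ht :=
  let H := fresh in let H1 := fresh in let Hz := fresh in
  assert (H := rho_derive t Ht); assert (H1 := rho1_derive t Ht); assert (Hz := zet_derive t Ht);
  pose proof (ex_intro _ _ H : ex_derive rho t); pose proof (ex_intro _ _ H1 : ex_derive rho1 t);
  pose proof (ex_intro _ _ Hz : ex_derive zet t);
  auto_derive;
  [ repeat split; assumption
  | rewrite (is_derive_unique (fun s : R => rho s) _ _ H);
    rewrite ?(is_derive_unique (fun s : R => rho1 s) _ _ H1);
    rewrite ?(is_derive_unique (fun s : R => zet s) _ _ Hz) ].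

Lemma beta_derive t : 0 < t < 2 * z0 -> is_derive beta t (beta1 t).
Proof. intros Ht. unfold beta. derive_profile t Ht. unfold beta1, rho2. field. lra. Qed.

Lemma beta1_derive t : 0 < t < 2 * z0 -> is_derive beta1 t (beta2 t).
Proof. intros Ht. unfold beta1. derive_profile t Ht. unfold beta2, beta, rho2. field. lra. Qed.

Lemma gam_derive t : 0 < t < 2 * z0 -> is_derive gam t (gam1 t).
Proof. intros Ht. unfold gam. derive_profile t Ht. unfold gam1, rho2. field. lra. Qed.

Lemma gam1_derive t : 0 < t < 2 * z0 -> is_derive gam1 t (gam2 t).
Proof.
intros Ht. unfold gam1. derive_profile t Ht.
assert (Hs := rho1_sqr t). unfold quartic in Hs. unfold gam2, gam, rho2.
apply Rmult_eq_reg_r with (lam * lam); [| nra]. field_simplify; [| lra | lra].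
replace (rho1 t ^ 2) with (rho1 t * rho1 t) by ring. rewrite Hs. ring.
Qed.

(** The normalisation that makes the circle of centre [beta / rho] have radius [1 / |rho|]. That
    [gam] is nevertheless regular comes from [rho1^2 - lam^2] being divisible by [rho]. *)
Lemma beta_gam t : beta t * beta t - rho t * gam t = 1.
Proof.
assert (Hs := rho1_sqr t). unfold quartic in Hs. unfold beta, gam.
apply Rmult_eq_reg_r with (lam * lam); [| nra]. field_simplify; [| lra].
replace (rho1 t ^ 2) with (rho1 t * rho1 t) by ring. rewrite Hs. ring.
Qed.

Lemma beta_gam1 t : 2 * beta t * beta1 t - rho1 t * gam t - rho t * gam1 t = 0.
Proof.
assert (Hs := rho1_sqr t). unfold quartic in Hs. unfold beta, gam, beta1, gam1.
apply Rmult_eq_reg_r with (lam * lam); [| nra]. field_simplify; [| lra].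
ring [Hs].
Qed.

(** This is [rho^2] times the derivative of the centre [beta / rho]. Its constancy reflects that
    [rho] and [beta] both solve [y'' = (K + 2 rho^2) y]. *)
Lemma wronskian t : beta1 t * rho t - beta t * rho1 t = lam.
Proof.
assert (Hs := rho1_sqr t). unfold quartic in Hs. unfold beta, beta1.
apply Rmult_eq_reg_r with lam; [| lra]. field_simplify; [| lra].
replace (rho1 t ^ 2) with (rho1 t * rho1 t) by ring. rewrite Hs. ring.
Qed.

Lemma beta_even t : 0 < t < 2 * z0 -> beta (2 * z0 - t) = beta t.
Proof. intros Ht. unfold beta. rewrite rho_odd, rho1_even, zet_odd by exact Ht. field. lra. Qed.

Lemma gam_odd t : 0 < t < 2 * z0 -> gam (2 * z0 - t) = - gam t.
Proof. intros Ht. unfold gam. rewrite rho_odd, rho1_even, zet_odd by exact Ht. field. lra. Qed.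

Lemma beta_z0 : beta z0 = 1.
Proof. unfold beta. rewrite rho_z0, rho1_z0, zet_z0. field. lra. Qed.

Lemma gam_z0 : gam z0 = 0.
Proof. unfold gam. rewrite rho_z0, rho1_z0, zet_z0. field. lra. Qed.

Lemma gam1_z0 : gam1 z0 = - K / lam.
Proof. unfold gam1. rewrite rho_z0, rho1_z0, zet_z0. field. lra. Qed.

Section Frame.

Variables (e1 e2 : R).
Hypothesis He : e1 * e1 + e2 * e2 = 1.

Definition surf x y z := levelf rho beta gam e1 e2 x y z.

Let g1 x z := gr1 rho beta e1 x z.
Let g2 y z := gr2 rho beta e2 y z.
Let g3 x y z := gr3 rho1 beta1 gam1 e1 e2 x y z.

(** The horizontal gradient is [2 (rho X - beta e)]. Multiplying the equation by [rho] and
    completing the square shows that this vector has length 2, also where the circle is a line. *)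
Lemma surf_horizontal x y z : surf x y z = 0 -> g1 x z * g1 x z + g2 y z * g2 y z = 4.
Proof.
unfold surf, levelf, g1, g2, gr1, gr2. intros H. assert (B := beta_gam z).
transitivity (4 * (rho z * (rho z * (x * x + y * y) - 2 * beta z * (e1 * x + e2 * y) + gam z)
  + beta z * beta z * (e1 * e1 + e2 * e2) - rho z * gam z)); [ring |].
rewrite H, He. lra.
Qed.

(* beta and gam solve the same linear equation as rho, up to the term 2 rho for gam, so on the
   surface the second derivative in z is 2 rho; the mixed terms come from differentiating
   gr1^2 + gr2^2 = 4 (1 + rho surf). *)
Lemma surf_curv x y z : surf x y z = 0 ->
  curv rho rho1 rho2 beta beta1 beta2 gam1 gam2 e1 e2 x y z = 0.
Proof.
intros H. assert (H4 := surf_horizontal x y z H). unfold curv.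
fold (g1 x z) (g2 y z) (g3 x y z). rewrite H4.
assert (E33 : hs33 rho2 beta2 gam2 e1 e2 x y z = 2 * rho z).
{ transitivity ((K + 2 * (rho z * rho z)) * surf x y z + 2 * rho z); [| rewrite H; ring].
  unfold hs33, surf, levelf, rho2, beta2, gam2. ring. }
assert (E3 : g1 x z * hs13 rho1 beta1 e1 x z + g2 y z * hs23 rho1 beta1 e2 y z
             = 2 * rho z * g3 x y z).
{ transitivity (2 * (rho1 z * surf x y z + rho z * g3 x y z)
    + 4 * beta z * beta1 z * (e1 * e1 + e2 * e2) - 2 * (rho1 z * gam z + rho z * gam1 z)).
  - unfold g1, g2, g3, gr1, gr2, gr3, hs13, hs23, surf, levelf. ring.
  - rewrite H, He. assert (B := beta_gam1 z). lra. }
rewrite E33, E3. ring.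
Qed.

(** The horizontal gradient has square 4, so the vertical derivative must exceed 2 in absolute
    value; it turns out to be below -2. On the line itself it is [- lam |X|^2 - K / lam], and the
    claim is [K > 2 lam]. *)
Lemma surf_timelike x y z : 0 < z < 2 * z0 -> surf x y z = 0 ->
  g1 x z * g1 x z + g2 y z * g2 y z < g3 x y z * g3 x y z.
Proof.
intros Hz H. assert (H4 := surf_horizontal x y z H). rewrite H4.
assert (H3 : g3 x y z < -2); [| nra].
destruct (Req_dec (rho z) 0) as [E | E].
- assert (z = z0).
  { destruct (Rtotal_order z z0) as [L | [L | L]]; [| exact L |].
    - generalize (rho_pos z); lra.
    - generalize (rho_neg z); lra. }
  subst z. revert H. unfold g3, gr3, surf, levelf, beta1.
  rewrite rho_z0, rho1_z0, zet_z0, beta_z0, gam_z0, gam1_z0. intros H.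
  replace (2 * ((- lam * 0 - K * 0 - 0 * 0 * 0) / lam) * (e1 * x + e2 * y)) with 0 by (field; lra).
  assert (2 < K / lam) by (apply Rlt_div_r; lra).
  replace (- K / lam) with (- (K / lam)) by (unfold Rdiv; ring).
  assert (0 <= lam * (x * x + y * y)) by (apply Rmult_le_pos; nra). lra.
- assert (Hp : 0 < rho z * rho z) by nra.
  (* [u] is the cosine of the angle from [e] on the circle, up to the sign of [rho]. Only [-1 <= u]
     is required, since the vertical derivative times [rho^2] is [2 (rho1 - lam u)]. *)
  set (u := rho z * (e1 * x + e2 * y) - beta z).
  assert (E3 : rho z * rho z * g3 x y z = 2 * (rho1 z - lam * u)).
  { assert (W := wronskian z). assert (B := beta_gam z). assert (B1 := beta_gam1 z).
    set (ex := e1 * x + e2 * y) in *.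
    transitivity (rho z * (rho1 z * surf x y z)
      - 2 * (beta1 z * rho z - beta z * rho1 z) * (rho z * ex)
      + rho z * (rho1 z * gam z + rho z * gam1 z) - 2 * rho1 z * (rho z * gam z)).
    { unfold g3, gr3, surf, levelf; fold ex; ring. }
    rewrite H, W.
    replace (rho1 z * gam z + rho z * gam1 z) with (2 * beta z * beta1 z) by lra.
    replace (rho z * gam z) with (beta z * beta z - 1) by lra.
    unfold u. replace lam with (beta1 z * rho z - beta z * rho1 z) by exact W. ring. }
  assert (Hu : -1 <= u).
  { assert (4 * (u * u) <= 4).
    { apply Rle_trans with (g1 x z * g1 x z + g2 y z * g2 y z); [| lra]. unfold g1, g2, gr1, gr2.
      replace u with ((rho z * x - beta z * e1) * e1 + (rho z * y - beta z * e2) * e2)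
        by (unfold u; replace (beta z) with (beta z * (e1 * e1 + e2 * e2)) at 3 by (rewrite He; ring); ring).
      set (p := rho z * x - beta z * e1). set (q := rho z * y - beta z * e2).
      replace (2 * rho z * x - 2 * beta z * e1) with (2 * p) by (unfold p; ring).
      replace (2 * rho z * y - 2 * beta z * e2) with (2 * q) by (unfold q; ring).
      assert (S := Rle_0_sqr (p * e2 - q * e1)). unfold Rsqr in S.
      assert (L : (p * e1 + q * e2) * (p * e1 + q * e2) + (p * e2 - q * e1) * (p * e2 - q * e1)
        = (p * p + q * q) * (e1 * e1 + e2 * e2)) by ring.
      rewrite He in L. lra. }
    nra. }
  (* [rho1^2 - (lam + rho^2)^2 = (K - 2 lam) rho^2], which is positive off the line. *)
  assert (Hr' : rho1 z < - (lam + rho z * rho z)).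
  { assert (S := rho1_sqr z). unfold quartic in S. assert (N := rho1_neg z).
    apply Rnot_le_lt; intros Q.
    assert (0 < (K - 2 * lam) * (rho z * rho z)) by (apply Rmult_lt_0_compat; lra).
    assert (0 <= (lam + rho z * rho z + rho1 z) * (lam + rho z * rho z - rho1 z))
      by (apply Rmult_le_pos; lra).
    lra. }
  assert (rho z * rho z * g3 x y z < rho z * rho z * (-2)) by (rewrite E3; nra).
  apply Rmult_lt_reg_l with (rho z * rho z); assumption.
Qed.

(** * A chart around the straight line, as a graph over the vertical plane containing it *)

Section LineChart.

Variables (b1 b2 : R) (S : R3 -> Prop).
Hypothesis HS : forall p, 0 < pz p < 2 * z0 ->
  (S p <-> surf (px p - b1) (py p - b2) (pz p) = 0).

(* For fixed y and t the surface is rho X^2 - 2 beta X + (gam + rho y^2) = 0 with discriminant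
   disc; A is the root that stays finite when rho vanishes, with its numerator rationalised. *)
Let disc (q : R2) := 1 - rho (snd q) * rho (snd q) * (fst q * fst q).
Let A (q : R2) :=
  (gam (snd q) + rho (snd q) * (fst q * fst q)) / (beta (snd q) + sqrt (disc q)).
Let X (q : R2) : R3 :=
  (e1 * A q + - e2 * fst q + b1, e2 * A q + e1 * fst q + b2, snd q).
(** A positive discriminant separates the two roots and positive [beta] keeps the denominator of [A]
    away from zero. At [z0] both conditions hold for every [y], so one chart covers the entire
    line. *)
Let U (q : R2) := ((0 < snd q < 2 * z0) /\ 0 < disc q) /\ 0 < beta (snd q).

(** The derivatives of [rho], [rho1], [zet] are polynomials in [rho] and [rho1], so the three gain
    regularity together. *)
Let Ck_profile k (V : R2 -> Prop) : open V -> (forall q, V q -> 0 < snd q < 2 * z0) ->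
  Ck k V (fun q => rho (snd q)) /\ Ck k V (fun q => rho1 (snd q)) /\ Ck k V (fun q => zet (snd q)).
Proof.
intros HV Hz.
induction k as [|k (I1 & I2 & I3)].
- split; [|split]; intros q Hq.
  + apply (continuous_comp snd rho); [apply continuous_snd | apply (ex_derive_continuous rho)].
    exists (rho1 (snd q)); apply rho_derive, Hz, Hq.
  + apply (continuous_comp snd rho1); [apply continuous_snd | apply (ex_derive_continuous rho1)].
    exists (rho2 (snd q)); apply rho1_derive, Hz, Hq.
  + apply (continuous_comp snd zet); [apply continuous_snd | apply (ex_derive_continuous zet)].
    eexists; apply zet_derive, Hz, Hq.
- split; [|split].
  + apply (Ck_S_of_snd k V rho rho1); [exact HV | | exact I2].
    intros q Hq; apply rho_derive, Hz, Hq.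
  + apply (Ck_S_of_snd k V rho1 rho2); [exact HV | |].
    * intros q Hq; apply rho1_derive, Hz, Hq.
    * unfold rho2. apply Ck_plus; [exact HV | |]; apply Ck_mult; auto; try apply Ck_const.
      apply Ck_mult; auto; apply Ck_mult; auto.
  + apply (Ck_S_of_snd k V zet (fun t => rho t * rho t)); [exact HV | | now apply Ck_mult].
    intros q Hq; apply zet_derive, Hz, Hq.
Qed.

Let Ck_beta_gam k (V : R2 -> Prop) : open V -> (forall q, V q -> 0 < snd q < 2 * z0) ->
  Ck k V (fun q => beta (snd q)) /\ Ck k V (fun q => gam (snd q)).
Proof.
intros HV Hz. destruct (Ck_profile k V HV Hz) as (I1 & I2 & I3). split.
- apply (Ck_ext k V (fun q => (rho (snd q) * zet (snd q) + (-1) * rho1 (snd q)) * / lam));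
    [exact HV | intros q _; unfold beta; field; lra |].
  apply Ck_mult; [exact HV | apply Ck_plus | apply Ck_const]; auto; apply Ck_mult; auto;
  apply Ck_const.
- apply (Ck_ext k V (fun q => (rho (snd q) * (zet (snd q) * zet (snd q))
    + ((-2) * (rho1 (snd q) * zet (snd q)) + (K * rho (snd q)
    + rho (snd q) * (rho (snd q) * rho (snd q))))) * / (lam * lam)));
    [exact HV | intros q _; unfold gam; field; lra |].
  repeat first [exact HV | apply Ck_const | exact I1 | exact I2 | exact I3
    | apply Ck_plus | apply Ck_mult].
Qed.

Let slab_open : open (fun q : R2 => 0 < snd q < 2 * z0).
Proof.
apply (open_comp (snd : R2 -> R) (fun t => 0 < t < 2 * z0)).
- intros q _. apply continuous_snd.
- intros t. apply locally_between.
Qed.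

Let Ck_disc k (V : R2 -> Prop) : open V -> (forall q, V q -> 0 < snd q < 2 * z0) -> Ck k V disc.
Proof.
intros HV Hz. destruct (Ck_profile k V HV Hz) as (I1 & _ & _).
apply (Ck_ext k V (fun q => 1 + (-1) * (rho (snd q) * rho (snd q) * (fst q * fst q))));
  [exact HV | intros q _; unfold disc; ring |].
repeat first [exact HV | apply Ck_const | exact I1 | apply Ck_fst | apply Ck_plus | apply Ck_mult].
Qed.

Let U_open : open U.
Proof.
unfold U. apply open_pos; [apply open_pos; [exact slab_open |] |].
- intros q Hq. exact (Ck_disc 0 _ slab_open (fun q H => H) q Hq).
- intros q [Hq _]. exact (proj1 (Ck_beta_gam 0 _ slab_open (fun q H => H)) q Hq).
Qed.

Let U_slab q : U q -> 0 < snd q < 2 * z0.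
Proof. unfold U; tauto. Qed.

Let A_Ck k : Ck k U A.
Proof.
destruct (Ck_profile k U U_open U_slab) as (I1 & _ & _).
destruct (Ck_beta_gam k U U_open U_slab) as (I2 & I3).
assert (I4 := Ck_disc k U U_open U_slab).
unfold A. apply (Ck_mult k U (fun q => _ + _) (fun q => / (_ + _))); [exact U_open | |].
- repeat first [exact U_open | exact I1 | exact I3 | apply Ck_fst | apply Ck_plus | apply Ck_mult].
- apply (Ck_inv k U (fun q => beta (snd q) + sqrt (disc q))); [exact U_open | |].
  + intros q [[_ Hd] Hb]. apply Rgt_not_eq. apply Rplus_lt_0_compat; [exact Hb | exact (sqrt_lt_R0 _ Hd)].
  + apply Ck_plus; [exact U_open | exact I2 |].
    apply (Ck_sqrt k U disc); [exact U_open | | exact I4]. intros q Hq; apply Hq.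
Qed.

Let X_smooth : smooth U X.
Proof.
intros k. split; [|split].
- apply (Ck_lin k U A fst); [exact U_open | apply A_Ck | apply Ck_fst].
- apply (Ck_lin k U A fst); [exact U_open | apply A_Ck | apply Ck_fst].
- apply Ck_snd.
Qed.

Let A_spec q : U q ->
  rho (snd q) * (A q * A q + fst q * fst q) - 2 * beta (snd q) * A q + gam (snd q) = 0 /\
  beta (snd q) - rho (snd q) * A q = sqrt (disc q).
Proof.
intros [[_ Hd] Hb]. assert (Hs := sqrt_lt_R0 _ Hd).
assert (Hss := sqrt_sqrt _ (Rlt_le _ _ Hd)). assert (B := beta_gam (snd q)).
set (s := sqrt (disc q)) in *.
assert (EA : A q * (beta (snd q) + s) = gam (snd q) + rho (snd q) * (fst q * fst q))
  by (unfold A; fold s; field; lra).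
assert (E : beta (snd q) - rho (snd q) * A q = s).
{ apply Rmult_eq_reg_r with (beta (snd q) + s); [| lra].
  transitivity (beta (snd q) * (beta (snd q) + s) - rho (snd q) * (A q * (beta (snd q) + s)));
    [ring |].
  rewrite EA. unfold disc in Hss.
  replace (s * (beta (snd q) + s)) with (s * beta (snd q) + s * s) by ring. rewrite Hss.
  replace 1 with (beta (snd q) * beta (snd q) - rho (snd q) * gam (snd q)) by exact B. ring. }
split; [| exact E].
replace (2 * beta (snd q) * A q)
  with (A q * (beta (snd q) + (beta (snd q) - rho (snd q) * A q)) + rho (snd q) * A q * A q) by ring.
rewrite E, EA. ring.
Qed.

Let X_surf q : U q -> surf (px (X q) - b1) (py (X q) - b2) (pz (X q)) = 0.
Proof.
intros Hq. destruct (A_spec q Hq) as [E _]. unfold X; autorewrite with r3.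
unfold surf, levelf. rewrite <- E.
transitivity (rho (snd q) * ((A q * A q + fst q * fst q) * (e1 * e1 + e2 * e2))
  - 2 * beta (snd q) * (A q * (e1 * e1 + e2 * e2)) + gam (snd q)); [ring |].
rewrite He. ring.
Qed.

Let X_regular q : U q -> forall a b, lin_comb a (D1 X q) b (D2 X q) = zero -> a = 0 /\ b = 0.
Proof.
intros Hq a b H.
destruct (X_smooth 1%nat) as [[H1 _] [[H2 _] _]].
destruct (H1 q Hq) as [_ [Hx1 Hx2]]; destruct (H2 q Hq) as [_ [Hy1 Hy2]].
assert (Hz := f_equal pz H). assert (Hx := f_equal px H). assert (Hy := f_equal py H).
unfold lin_comb in Hx, Hy, Hz; autorewrite with r3 in Hx, Hy, Hz.
change (px zero) with 0 in Hx; change (py zero) with 0 in Hy; change (pz zero) with 0 in Hz.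
assert (Ez1 : pz (D1 X q) = 0) by (apply (Derive_const (snd q))).
assert (Ez2 : pz (D2 X q) = 1) by (apply (Derive_id (snd q))).
rewrite Ez1, Ez2 in Hz. assert (Hb : b = 0) by lra. split; [| exact Hb]. subst b.
(* The component of the chart along the line is the first parameter up to a constant, so its
   derivative is 1; the height has already given [b = 0]. *)
assert (Ey : - e2 * px (D1 X q) + e1 * py (D1 X q) = 1).
{ unfold D1; autorewrite with r3. rewrite <- (d1_lin _ _ (- e2) e1 (e2 * b1 - e1 * b2) q Hx1 Hy1).
  transitivity (d1 fst q); [| apply (Derive_id (fst q))].
  apply (d1_ext U); [exact U_open | exact Hq |]. intros p _. unfold X; autorewrite with r3.
  transitivity (fst p * (e1 * e1 + e2 * e2)); [ring | rewrite He; ring]. }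
transitivity (a * (- e2 * px (D1 X q) + e1 * py (D1 X q))); [rewrite Ey; ring |].
transitivity (- e2 * (a * px (D1 X q) + 0 * px (D2 X q)) + e1 * (a * py (D1 X q) + 0 * py (D2 X q)));
  [ring | rewrite Hx, Hy; ring].
Qed.

Let X_spacelike : spacelike_param U X.
Proof.
intros q Hq a b Hab.
apply (level_set_spacelike rho rho1 beta beta1 gam gam1 (fun z => 0 < z < 2 * z0) e1 e2
  rho_derive beta_derive gam_derive U X b1 b2 U_open X_smooth U_slab X_surf q Hq).
- apply surf_timelike; [now apply U_slab | now apply X_surf].
- intros H. apply Hab. destruct (X_regular q Hq a b H) as [-> ->]. reflexivity.
Qed.

Let X_maximal q : U q -> mean_curvature X q = 0.
Proof.
intros Hq. assert (Es := X_surf q Hq).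
apply (level_set_curvature rho rho1 rho2 beta beta1 beta2 gam gam1 gam2
  (fun z => 0 < z < 2 * z0) e1 e2 rho_derive rho1_derive beta_derive beta1_derive gam_derive
  gam1_derive U X b1 b2 U_open X_smooth U_slab X_surf q Hq).
- assert (H4 := surf_horizontal _ _ _ Es); unfold g1, g2 in H4; rewrite H4. assert (H := Rle_0_sqr (gr3 rho1 beta1 gam1 e1 e2
    (px (X q) - b1) (py (X q) - b2) (pz (X q)))). unfold Rsqr in H. lra.
- now apply (spacelike_disc U).
- now apply surf_curv.
Qed.

(** The parameters are recovered by the projection [T] to position along the line and height. Over
    one parameter the surface may have a second point, the other root; the roots satisfy
    [beta - rho N = sqrt disc] and [beta - rho N = - sqrt disc], so positivity of this quantity is
    the open condition that selects the chart. *)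
Let X_homeo (V : R2 -> Prop) : open V -> (forall q, V q -> U q) ->
  exists W : R3 -> Prop, open W /\ forall p, (exists q, V q /\ X q = p) <-> (S p /\ W p).
Proof.
intros HV HVU.
pose (N := fun p : R3 => e1 * px p + e2 * py p + - (e1 * b1 + e2 * b2)).
pose (Y := fun p : R3 => - e2 * px p + e1 * py p + (e2 * b1 - e1 * b2)).
pose (T := fun p : R3 => (Y p, pz p)).
assert (HT : forall p, continuous T p).
{ intros p. apply filterlim_locally. intros eps.
  assert (H1 : continuous Y p)
    by (apply (continuous_lin px py); [apply continuous_px | apply continuous_py]).
  apply filterlim_locally with (eps := eps) in H1.
  assert (H2 := continuous_pz p). apply filterlim_locally with (eps := eps) in H2.
  generalize (filter_and _ _ H1 H2). apply filter_imp. intros p' [h1 h2]; split; assumption. }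
assert (HW1 : open (fun p => 0 < pz p < 2 * z0 /\ V (T p))).
{ apply (open_preim (fun p : R3 => 0 < pz p < 2 * z0) V T); [apply open_pz_interval | exact HV |].
  intros p _; apply HT. }
exists (fun p => (0 < pz p < 2 * z0 /\ V (T p)) /\ 0 < beta (pz p) + - (rho (pz p) * N p)).
split.
- apply open_pos; [exact HW1 |]. intros p [Hp _].
  assert (Hr' : continuous rho (pz p))
    by (apply (ex_derive_continuous rho); exists (rho1 (pz p)); now apply rho_derive).
  assert (Hb' : continuous beta (pz p))
    by (apply (ex_derive_continuous beta); exists (beta1 (pz p)); now apply beta_derive).
  apply (continuous_plus (V := R_NormedModule) (fun p : R3 => beta (pz p))
    (fun p : R3 => - (rho (pz p) * N p))).
  + apply (continuous_comp pz beta); [apply continuous_pz | exact Hb'].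
  + apply (continuous_opp (V := R_NormedModule) (fun p : R3 => rho (pz p) * N p)).
    apply (continuous_mult (K := R_AbsRing) (fun p : R3 => rho (pz p)) N).
    * apply (continuous_comp pz rho); [apply continuous_pz | exact Hr'].
    * apply (continuous_lin px py); [apply continuous_px | apply continuous_py].
- intros p. split.
  + intros (q & Vq & <-). assert (Hq := HVU q Vq). assert (Es := X_surf q Hq).
    split; [apply HS; [now apply U_slab | exact Es] |].
    assert (EN : N (X q) = A q).
    { unfold N, X; autorewrite with r3.
      transitivity (A q * (e1 * e1 + e2 * e2)); [ring | rewrite He; ring]. }
    assert (EY : Y (X q) = fst q).
    { unfold Y, X; autorewrite with r3.
      transitivity (fst q * (e1 * e1 + e2 * e2)); [ring | rewrite He; ring]. }
    rewrite EN. unfold T. rewrite EY. change (pz (X q)) with (snd q).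
    destruct (A_spec q Hq) as [_ E].
    split; [split; [now apply U_slab | now destruct q] |].
    replace (beta (snd q) + - (rho (snd q) * A q)) with (sqrt (disc q)) by lra.
    apply sqrt_lt_R0, Hq.
  + intros (Sp & (Hz & VT) & Hpos). apply HS in Sp; [| exact Hz].
    assert (Hq := HVU _ VT). exists (T p). split; [exact VT |].
    destruct (A_spec _ Hq) as [E1' E2']. destruct Hq as [[_ Hd] Hb].
    assert (Hs := sqrt_lt_R0 _ Hd). assert (Hss := sqrt_sqrt _ (Rlt_le _ _ Hd)).
    assert (Es : rho (pz p) * (N p * N p + Y p * Y p) - 2 * beta (pz p) * N p + gam (pz p) = 0).
    { rewrite <- Sp. unfold surf, levelf, N, Y.
      set (x := px p - b1); set (y := py p - b2).
      replace (px p) with (x + b1) by (unfold x; ring).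
      replace (py p) with (y + b2) by (unfold y; ring).
      replace (x * x + y * y) with ((x * x + y * y) * (e1 * e1 + e2 * e2)) by (rewrite He; ring).
      ring. }
    unfold T in *; cbn [fst snd] in *. unfold disc in Hss, Hs, Hd, E2'; cbn [fst snd] in *.
    set (s := sqrt _) in *.
    assert (B := beta_gam (pz p)).
    (* The equation makes [beta - rho N] a square root of the discriminant, and membership in the
       open set leaves only the positive one. *)
    assert (EN : beta (pz p) - rho (pz p) * N p = s).
    { assert (Q : (beta (pz p) - rho (pz p) * N p - s) * (beta (pz p) - rho (pz p) * N p + s) = 0).
      { transitivity (rho (pz p) * (rho (pz p) * (N p * N p + Y p * Y p)
            - 2 * beta (pz p) * N p + gam (pz p))
          + (beta (pz p) * beta (pz p) - rho (pz p) * gam (pz p)) - s * s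
          - rho (pz p) * rho (pz p) * (Y p * Y p)); [ring |].
        rewrite Es, B, Hss. ring. }
      apply Rmult_integral in Q; destruct Q; lra. }
    assert (EA : A (Y p, pz p) = N p).
    { apply Rmult_eq_reg_r with (beta (pz p) + s); [| lra].
      transitivity (gam (pz p) + rho (pz p) * (Y p * Y p)).
      - unfold A, disc; cbn [fst snd]. fold s. field. lra.
      - transitivity (N p * (beta (pz p) + (beta (pz p) - rho (pz p) * N p))); [lra |].
        now rewrite EN. }
    apply R3_eq; unfold X; autorewrite with r3; rewrite ?EA; cbn [fst snd]; unfold N, Y.
    * transitivity (px p * (e1 * e1 + e2 * e2) - b1 * (e1 * e1 + e2 * e2) + b1);
        [ring | rewrite He; ring].
    * transitivity (py p * (e1 * e1 + e2 * e2) - b2 * (e1 * e1 + e2 * e2) + b2);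
        [ring | rewrite He; ring].
    * reflexivity.
Qed.

Lemma maximal_at_line p : pz p = z0 -> S p -> maximal_at S p.
Proof.
intros Hp Sp. exists U, X.
assert (X_inj : forall q q', U q -> U q' -> X q = X q' -> q = q').
{ intros q q' _ _ E.
  assert (E1' := f_equal px E); assert (E2' := f_equal py E); assert (E3' := f_equal pz E).
  unfold X in E1', E2', E3'; autorewrite with r3 in E1', E2', E3'.
  destruct q as [y t], q' as [y' t']; cbn [fst snd] in *. f_equal; [| exact E3'].
  transitivity (- e2 * (e1 * A (y, t) + - e2 * y + b1) + e1 * (e2 * A (y, t) + e1 * y + b2)
    + (e2 * b1 - e1 * b2)); [transitivity (y * (e1 * e1 + e2 * e2)); [rewrite He|]; ring |].
  rewrite E1', E2'. transitivity (y' * (e1 * e1 + e2 * e2)); [|rewrite He]; ring. }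
split; [exact (conj U_open (conj X_smooth (conj X_regular (conj X_inj X_homeo)))) |].
split; [| exact (conj X_spacelike X_maximal)].
apply HS in Sp; [| lra]. rewrite Hp in Sp.
unfold surf, levelf in Sp. rewrite rho_z0, beta_z0, gam_z0 in Sp.
set (y := - e2 * (px p - b1) + e1 * (py p - b2)).
assert (Hq : U (y, z0)).
{ unfold U, disc; cbn [fst snd]. rewrite rho_z0, beta_z0. lra. }
exists (y, z0). split; [exact Hq |].
assert (EA : A (y, z0) = 0).
{ unfold A, disc; cbn [fst snd]. rewrite rho_z0, beta_z0, gam_z0. unfold Rdiv; ring. }
apply R3_eq; unfold X; autorewrite with r3; rewrite ?EA; cbn [fst snd]; unfold y.
- transitivity ((px p - b1) * (e1 * e1 + e2 * e2) - e1 * (e1 * (px p - b1) + e2 * (py p - b2)) + b1);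
    [ring |]. rewrite He. replace (e1 * (px p - b1) + e2 * (py p - b2)) with 0 by lra. ring.
- transitivity ((py p - b2) * (e1 * e1 + e2 * e2) - e2 * (e1 * (px p - b1) + e2 * (py p - b2)) + b2);
    [ring |]. rewrite He. replace (e1 * (px p - b1) + e2 * (py p - b2)) with 0 by lra. ring.
- symmetry; exact Hp.
Qed.

End LineChart.

(** Under the half-turn [rho] and [gam] change sign by oddness, while [beta] is even and multiplies
    a term that changes sign. The zero set is therefore invariant. *)
Lemma surf_turn x y x' y' z : 0 < z < 2 * z0 ->
  x' * x' + y' * y' = x * x + y * y -> e1 * x' + e2 * y' = - (e1 * x + e2 * y) ->
  surf x' y' (2 * z0 - z) = - surf x y z.
Proof.
intros Hz H H'. unfold surf, levelf.
rewrite rho_odd, (beta_even z Hz), (gam_odd z Hz), H, H'. ring.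
Qed.

Lemma surf_z0 x y : surf x y z0 = 0 <-> e1 * x + e2 * y = 0.
Proof. unfold surf, levelf. rewrite rho_z0, beta_z0, gam_z0. split; lra. Qed.

(** By [beta_gam], [gam / rho] is [c^2 - r^2]: below the line, [surf] is the monic circle equation
    times [rho]. *)
Lemma surf_below c x y z : 0 < z < z0 -> c z = beta z / rho z ->
  surf x y z = rho z * levelf (fun _ => 1) c (fun t => c t * c t - r t * r t) e1 e2 x y z.
Proof.
intros Hz Hc. unfold surf, levelf. rewrite Hc. assert (Hp := rho_pos z Hz). assert (H := Hr z Hz).
replace (r z) with (/ rho z) by (rewrite rho_below by lra; field; lra).
assert (B := beta_gam z).
replace (gam z) with ((beta z * beta z - 1) / rho z) by (apply Rmult_eq_reg_r with (rho z); [field_simplify; lra | lra]).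
field. lra.
Qed.

Lemma surf_continuous b1 b2 p : 0 < pz p < 2 * z0 ->
  continuous (fun p : R3 => surf (px p - b1) (py p - b2) (pz p)) p.
Proof.
intros Hp.
assert (Cx : continuous (fun p : R3 => px p - b1) p).
{ apply (continuous_minus (V := R_NormedModule) px (fun _ => b1));
  [apply continuous_px | apply continuous_const]. }
assert (Cy : continuous (fun p : R3 => py p - b2) p).
{ apply (continuous_minus (V := R_NormedModule) py (fun _ => b2));
  [apply continuous_py | apply continuous_const]. }
assert (C1 : continuous (fun p : R3 => rho (pz p)) p).
{ apply (continuous_comp pz rho); [apply continuous_pz | apply (ex_derive_continuous rho)].
  eexists; now apply rho_derive. }
assert (C2 : continuous (fun p : R3 => beta (pz p)) p).
{ apply (continuous_comp pz beta); [apply continuous_pz | apply (ex_derive_continuous beta)].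
  eexists; now apply beta_derive. }
assert (C3 : continuous (fun p : R3 => gam (pz p)) p).
{ apply (continuous_comp pz gam); [apply continuous_pz | apply (ex_derive_continuous gam)].
  eexists; now apply gam_derive. }
assert (Cm : forall f g : R3 -> R, continuous f p -> continuous g p ->
  continuous (fun p => f p * g p) p)
  by (intros f g; apply (continuous_mult (K := R_AbsRing) f g)).
assert (Cp : forall f g : R3 -> R, continuous f p -> continuous g p ->
  continuous (fun p => f p + g p) p)
  by (intros f g; apply (continuous_plus (V := R_NormedModule) f g)).
assert (Cs : forall f g : R3 -> R, continuous f p -> continuous g p ->
  continuous (fun p => f p - g p) p)
  by (intros f g; apply (continuous_minus (V := R_NormedModule) f g)).
assert (Cc : forall a : R, continuous (fun _ : R3 => a) p) by (intros a; apply continuous_const).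
unfold surf, levelf.
apply Cp; [apply Cs | exact C3].
- apply Cm; [exact C1 | apply Cp; apply Cm; assumption].
- apply Cm; [apply Cm; auto | apply Cp; apply Cm; auto].
Qed.

(** At [z0 - de] the coefficient [rho] is positive, so far out the quadratic term dominates and
    [surf] is positive; at [z0 + de] parity makes it negative. *)
Lemma surf_far de : 0 < de < z0 ->
  exists R, forall x y, R < sqrt (x * x + y * y) ->
    exists z, z0 - de <= z <= z0 + de /\ surf x y z = 0.
Proof.
intros Hde. set (z := z0 - de). assert (Hz : 0 < z < z0) by (unfold z; lra).
(* For distance [R > 1] the linear and constant terms are at most [m R], which [rho R^2] exceeds
   once [R > m / rho]. *)
assert (Hp := rho_pos z Hz). set (m := 2 * Rabs (beta z) + Rabs (gam z)).
assert (Hm : 0 <= m) by (unfold m; generalize (Rabs_pos (beta z)) (Rabs_pos (gam z)); lra).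
exists (m / rho z + 1). intros x y HR.
set (R := sqrt (x * x + y * y)) in *.
assert (HRR : R * R = x * x + y * y) by (apply sqrt_sqrt; nra).
assert (HmR : m < rho z * R).
{ apply Rle_lt_trans with (rho z * (m / rho z)); [right; field; lra |].
  apply Rmult_lt_compat_l; lra. }
assert (HR1 : 1 < R).
{ assert (0 <= m / rho z) by (apply Rmult_le_pos; [lra | apply Rlt_le, Rinv_0_lt_compat; lra]). lra. }
assert (Hex : Rabs (e1 * x + e2 * y) <= R).
{ rewrite <- (Rabs_right R) by lra. apply Rsqr_le_abs_0. unfold Rsqr. rewrite HRR.
  assert (S := Rle_0_sqr (e1 * y - e2 * x)). unfold Rsqr in S.
  assert (L : (e1 * x + e2 * y) * (e1 * x + e2 * y) + (e1 * y - e2 * x) * (e1 * y - e2 * x)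
    = (e1 * e1 + e2 * e2) * (x * x + y * y)) by ring. rewrite He in L. lra. }
assert (Hbx : Rabs (2 * beta z * (e1 * x + e2 * y)) <= 2 * Rabs (beta z) * R).
{ rewrite !Rabs_mult, (Rabs_right 2) by lra. apply Rmult_le_compat_l; [| exact Hex].
  generalize (Rabs_pos (beta z)); lra. }
assert (Hbig : 2 * Rabs (beta z) * R + Rabs (gam z) < rho z * (x * x + y * y)).
{ rewrite <- HRR. apply Rle_lt_trans with (m * R).
  - unfold m. assert (Rabs (gam z) * 1 <= Rabs (gam z) * R)
      by (apply Rmult_le_compat_l; [apply Rabs_pos | lra]). lra.
  - rewrite <- Rmult_assoc. apply Rmult_lt_compat_r; lra. }
(* The bound simplifies to [rho (x^2 + y^2) - |gam|]. *)
destruct (Rabs_def2 (2 * beta z * (e1 * x + e2 * y)) (2 * Rabs (beta z) * R + 0 + (rho z * (x * x + y * y) - (2 * Rabs (beta z) * R + Rabs (gam z))))) as [A1 A2]; [lra |].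
assert (G1 := Rle_abs (gam z)). assert (G2 := Rle_abs (- gam z)). rewrite Rabs_Ropp in G2.
destruct (IVT_interv (fun s => - surf x y s) z (2 * z0 - z)) as (s & Hs & Es).
- intros s Hs. apply continuity_pt_opp.
  apply (is_derive_continuity_pt _ _ (gr1 rho beta e1 x s * 0 + gr2 rho beta e2 y s * 0
    + gr3 rho1 beta1 gam1 e1 e2 x y s * 1)).
  apply (levelf_curve rho rho1 beta beta1 gam gam1 (fun z => 0 < z < 2 * z0) e1 e2
    rho_derive beta_derive gam_derive (fun _ => x) (fun _ => y) (fun s => s)).
  + lra.
  + apply (is_derive_const (V := R_NormedModule) x).
  + apply (is_derive_const (V := R_NormedModule) y).
  + apply (is_derive_id (K := R_AbsRing)).
- lra.
- unfold surf, levelf. lra.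
- unfold surf, levelf. rewrite rho_odd, beta_even, gam_odd by lra. lra.
- exists s. split; [unfold z in *; lra | lra].
Qed.

End Frame.

(** [beta / rho] has derivative [lam / rho^2 = lam r^2] by [wronskian], the same as [c]. *)
Lemma centre_offset c : (forall t, 0 < t < z0 -> is_derive c t (lam * (r t * r t))) ->
  exists kap, forall t, 0 < t < z0 -> c t = beta t / rho t + kap.
Proof.
intros Dc. exists (c (z0 / 2) - beta (z0 / 2) / rho (z0 / 2)). intros t Ht.
assert (E : c t - beta t / rho t = c (z0 / 2) - beta (z0 / 2) / rho (z0 / 2)); [| lra].
apply (derive0_const (fun t => c t - beta t / rho t)
  (fun t => lam * (r t * r t) - lam / (rho t * rho t)) 0 z0); try lra.
- intros x Hx. assert (Hp := rho_pos x Hx).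
  assert (H := rho_derive x ltac:(lra)). assert (Hb := beta_derive x ltac:(lra)).
  assert (Hc := Dc x Hx).
  pose proof (ex_intro _ _ H : ex_derive rho x). pose proof (ex_intro _ _ Hb : ex_derive beta x).
  pose proof (ex_intro _ _ Hc : ex_derive c x).
  auto_derive; [repeat split; try assumption; lra |].
  rewrite (is_derive_unique (fun s : R => rho s) _ _ H).
  rewrite (is_derive_unique (fun s : R => beta s) _ _ Hb).
  rewrite (is_derive_unique (fun s : R => c s) _ _ Hc).
  assert (W := wronskian x).
  replace (lam / (rho x * rho x)) with ((beta1 x * rho x - beta x * rho1 x) / (rho x * rho x))
    by (rewrite W; reflexivity).
  field. lra.
- intros x Hx. rewrite rho_below by lra. assert (Hp := Hr x Hx). field. lra.
Qed.

(** With [r = 1 / rho] and [beta^2 - 1 = rho gam], the difference of the two infinite terms is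
    [gam / (beta + 1)], which is continuous at [z0] and vanishes there. *)
Lemma edge_tends eps : 0 < eps ->
  exists e, 0 < e /\ forall t, 0 < t < z0 -> z0 - e < t -> Rabs (beta t / rho t - r t) < eps.
Proof.
intros Heps.
assert (C : continuous (fun t => gam t / (beta t + 1)) z0).
{ assert (Hb := beta_derive z0 ltac:(lra)). assert (Hg := gam_derive z0 ltac:(lra)).
  pose proof (ex_intro _ _ Hb : ex_derive beta z0). pose proof (ex_intro _ _ Hg : ex_derive gam z0).
  apply (ex_derive_continuous (fun t => gam t / (beta t + 1))). auto_derive.
  repeat split; try assumption. rewrite beta_z0; lra. }
assert (Cb : continuous beta z0)
  by (apply (ex_derive_continuous beta); exists (beta1 z0); apply beta_derive; lra).
apply filterlim_locally with (eps := mkposreal eps Heps) in C.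
apply filterlim_locally with (eps := mkposreal 1 Rlt_0_1) in Cb.
destruct (filter_and _ _ C Cb) as [e H]. exists e. split; [apply cond_pos |].
intros t Ht Hte. destruct (H t) as [H1 H2].
{ change (Rabs (t - z0) < e). apply Rabs_def1; lra. }
change (Rabs (gam t / (beta t + 1) - gam z0 / (beta z0 + 1)) < eps) in H1.
change (Rabs (beta t - beta z0) < 1) in H2. rewrite beta_z0 in H2. rewrite gam_z0 in H1.
destruct (Rabs_def2 _ _ H2) as [_ H3].
replace (beta t / rho t - r t) with (gam t / (beta t + 1) - 0 / (beta z0 + 1)); [exact H1 |].
assert (Hp := rho_pos t Ht). assert (Hrt := Hr t Ht). assert (B := beta_gam t).
replace (r t) with (/ rho t) by (rewrite rho_below by lra; field; lra).
replace (gam t) with ((beta t * beta t - 1) / rho t)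
  by (apply Rmult_eq_reg_r with (rho t); [field_simplify; lra | lra]).
rewrite beta_z0. field. lra.
Qed.

End Continuation.

(** * Angles *)

Lemma cos_sin_period (n : Z) v :
  cos (v + 2 * IZR n * PI) = cos v /\ sin (v + 2 * IZR n * PI) = sin v.
Proof.
assert (N : forall (m : nat) w, cos (w + 2 * IZR (Z.of_nat m) * PI) = cos w /\
                               sin (w + 2 * IZR (Z.of_nat m) * PI) = sin w).
{ intros m w. rewrite <- INR_IZR_INZ. split; [apply cos_period | apply sin_period]. }
destruct (Z_le_dec 0 n) as [H | H].
- rewrite <- (Z2Nat.id n H). apply N.
- assert (E : n = (- Z.of_nat (Z.to_nat (- n)))%Z) by lia.
  destruct (N (Z.to_nat (- n)) (v + 2 * IZR n * PI)) as [H1 H2].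
  assert (E' : v + 2 * IZR n * PI + 2 * IZR (Z.of_nat (Z.to_nat (- n))) * PI = v).
  { rewrite E at 1. rewrite opp_IZR. ring. }
  rewrite E' in H1, H2. now split.
Qed.

Lemma polar_angle (a x y R : R) :
  0 < R -> x * x + y * y = R * R ->
  exists v, a < v <= a + 2 * PI /\ x = R * cos v /\ y = R * sin v.
Proof.
intros HR H.
assert (V : exists v, x = R * cos v /\ y = R * sin v).
{ assert (Hx : -1 <= x / R <= 1).
  { assert (x * x <= R * R) by nra.
    split; apply Rmult_le_reg_r with R; try lra; field_simplify; nra. }
  assert (Hs : R * sqrt (1 - (x / R)²) = Rabs y).
  { rewrite <- (sqrt_Rsqr_abs y). rewrite <- (sqrt_square R) at 1 by lra.
    rewrite <- sqrt_mult_alt by nra. f_equal. unfold Rsqr. field_simplify; nra. }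
  destruct (Rle_dec 0 y).
  - exists (acos (x / R)). rewrite cos_acos, sin_acos by exact Hx. split; [field; lra |].
    rewrite Hs, Rabs_right; lra.
  - exists (- acos (x / R)). rewrite cos_neg, sin_neg, cos_acos, sin_acos by exact Hx.
    split; [field; lra |].
    rewrite <- Ropp_mult_distr_r, Hs, Rabs_left; lra. }
destruct V as (v & Ex & Ey). assert (HPI := PI_RGT_0).
(* [up] gives the number of turns that brings the angle into the half-open window starting at [a];
   an arc longer than [2 PI] contains that window. *)
exists (v + 2 * IZR (up ((a - v) / (2 * PI))) * PI).
destruct (cos_sin_period (up ((a - v) / (2 * PI))) v) as [-> ->].
split; [| now split].
destruct (archimed ((a - v) / (2 * PI))) as [A1 A2].
set (n := IZR (up ((a - v) / (2 * PI)))) in *. set (w := (a - v) / (2 * PI)) in *.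
assert (Ew : a - v = w * (2 * PI)) by (unfold w; field; lra).
assert (w * (2 * PI) < n * (2 * PI)) by (apply Rmult_lt_compat_r; lra).
assert ((n - w) * (2 * PI) <= 1 * (2 * PI)) by (apply Rmult_le_compat_r; lra).
lra.
Qed.

Lemma angle_unique v w : 0 < w - v < 2 * PI -> cos v = cos w -> sin v = sin w -> False.
Proof.
intros H Ec Es.
assert (E : cos (w - v) = 1).
{ rewrite cos_minus, Ec, Es. generalize (sin2_cos2 w). unfold Rsqr. lra. }
replace (w - v) with (2 * ((w - v) / 2)) in E by field.
rewrite cos_2a_sin in E.
assert (0 < sin ((w - v) / 2)) by (apply sin_gt_0; lra). nra.
Qed.

(** * The equations satisfied by the circles of a maximal surface *)

Section Slices.

Variables (M : R3 -> Prop) (z0 : R) (cx cy r : R -> R) (P o d : R3).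
Hypothesis Hz0 : 0 < z0.
Hypothesis Hmax : maximal_surface (part M 0 z0).
Hypothesis Hrot : ~ rotational (part M 0 z0).
Hypothesis Hfol : foliated_by_circles (part M 0 z0) 0 z0 cx cy r.
Hypothesis Hline : forall p, line o d p -> pz p = z0.
Hypothesis HP : pz P = 0.
Hypothesis Hbd : forall p, boundary (part M 0 z0) p <-> (p = P \/ line o d p).

Lemma radius_pos t : 0 < t < z0 -> 0 < r t.
Proof. intros Ht. now apply Hfol. Qed.

(* An end point of an open arc of angle at most 2 PI would be a boundary point. *)
Lemma slice_full t alpha beta : 0 < t < z0 -> alpha < beta ->
  (forall p, pz p = t -> (part M 0 z0 p <-> exists v, alpha < v < beta /\
                   p = (cx t + r t * cos v, cy t + r t * sin v, t))) ->
  2 * PI < beta - alpha.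
Proof.
intros Ht Hab Harc. apply Rnot_le_lt. intros Hle.
assert (Hr := radius_pos t Ht).
set (b := (cx t + r t * cos beta, cy t + r t * sin beta, t) : R3).
assert (B : boundary (part M 0 z0) b).
{ split.
  - intros eps.
    assert (Cc : continuous (fun v => cx t + r t * cos v) beta)
      by (apply (ex_derive_continuous (K := R_AbsRing) (V := R_NormedModule)); auto_derive; trivial).
    assert (Cs : continuous (fun v => cy t + r t * sin v) beta)
      by (apply (ex_derive_continuous (K := R_AbsRing) (V := R_NormedModule)); auto_derive; trivial).
    apply filterlim_locally with (eps := eps) in Cc.
    apply filterlim_locally with (eps := eps) in Cs.
    destruct (filter_and _ _ Cc Cs) as [e He].
    set (v := beta - Rmin (e / 2) ((beta - alpha) / 2)).
    assert (H1 := Rmin_l (e / 2) ((beta - alpha) / 2)).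
    assert (H2 := Rmin_r (e / 2) ((beta - alpha) / 2)).
    assert (H3 : 0 < Rmin (e / 2) ((beta - alpha) / 2))
      by (apply Rmin_pos; [generalize (cond_pos e) |]; lra).
    destruct (He v) as [K1 K2].
    { apply Rabs_def1; unfold minus, plus, opp; simpl; unfold v; generalize (cond_pos e); lra. }
    exists (cx t + r t * cos v, cy t + r t * sin v, t). split.
    + apply Harc; [reflexivity |]. exists v. split; [unfold v; lra | reflexivity].
    + apply ball3. unfold b; autorewrite with r3. split; [exact K1 | split; [exact K2 |]].
      rewrite Rminus_diag, Rabs_R0. apply cond_pos.
  - intros Hb. apply Harc in Hb; [| reflexivity]. destruct Hb as (v & Hv & E).
    injection E; intros E2 E1.
    apply (angle_unique v beta); [lra | |]; apply Rmult_eq_reg_l with (r t); lra. }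
apply Hbd in B. destruct B as [B | B].
- assert (E := f_equal pz B). rewrite HP in E. unfold b in E; autorewrite with r3 in E. lra.
- apply Hline in B. unfold b in B; autorewrite with r3 in B. lra.
Qed.

Lemma slice_circle p : 0 < pz p < z0 ->
  (M p <-> (px p - cx (pz p)) * (px p - cx (pz p)) + (py p - cy (pz p)) * (py p - cy (pz p))
           = r (pz p) * r (pz p)).
Proof.
intros Hp. destruct Hfol as (_ & _ & _ & Hf). destruct (Hf _ Hp) as [Hr (al & be & Hab & Harc)].
assert (Hfull := slice_full _ _ _ Hp Hab Harc).
assert (Hpart : M p <-> part M 0 z0 p) by (unfold part; tauto).
rewrite Hpart, (Harc p eq_refl). split.
- intros (v & _ & E).
  assert (E1 := f_equal px E); assert (E2 := f_equal py E).
  rewrite px_pair in E1. rewrite py_pair in E2. rewrite E1, E2.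
  assert (S := sin2_cos2 v). unfold Rsqr in S.
  set (t := pz p) in *.
  transitivity (r t * r t * (sin v * sin v + cos v * cos v)); [| rewrite S]; ring.
- intros E. destruct (polar_angle al _ _ _ Hr E) as (v & Hv & E1 & E2).
  exists v. split; [lra |]. apply R3_eq; autorewrite with r3; lra.
Qed.

Section Frame.

Variables (b1 b2 e1 e2 : R) (c c1 c2 r1 r2 : R -> R).
Hypothesis He : e1 * e1 + e2 * e2 = 1.
Hypothesis Hcx : forall t, 0 < t < z0 -> cx t = b1 + c t * e1.
Hypothesis Hcy : forall t, 0 < t < z0 -> cy t = b2 + c t * e2.
Hypothesis Dr : forall t, 0 < t < z0 -> is_derive r t (r1 t).
Hypothesis Dr1 : forall t, 0 < t < z0 -> is_derive r1 t (r2 t).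
Hypothesis Dc : forall t, 0 < t < z0 -> is_derive c t (c1 t).
Hypothesis Dc1 : forall t, 0 < t < z0 -> is_derive c1 t (c2 t).

Let k t := c t * c t - r t * r t.
Let k1 t := 2 * c t * c1 t - 2 * r t * r1 t.
Let k2 t := 2 * (c1 t * c1 t + c t * c2 t) - 2 * (r1 t * r1 t + r t * r2 t).

Let Dk t : 0 < t < z0 -> is_derive k t (k1 t).
Proof.
intros Ht. assert (H := Dr t Ht); assert (H' := Dc t Ht).
assert (E := ex_intro _ _ H : ex_derive r t). assert (E' := ex_intro _ _ H' : ex_derive c t).
unfold k; auto_derive; [now repeat split |].
rewrite (is_derive_unique (fun s : R => r s) _ _ H), (is_derive_unique (fun s : R => c s) _ _ H').
unfold k1; ring.
Qed.

Let Dk1 t : 0 < t < z0 -> is_derive k1 t (k2 t).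
Proof.
intros Ht. assert (H := Dr t Ht); assert (H' := Dc t Ht).
assert (H1 := Dr1 t Ht); assert (H1' := Dc1 t Ht).
assert (E := ex_intro _ _ H : ex_derive r t). assert (E' := ex_intro _ _ H' : ex_derive c t).
assert (E1 := ex_intro _ _ H1 : ex_derive r1 t). assert (E1' := ex_intro _ _ H1' : ex_derive c1 t).
unfold k1; auto_derive; [now repeat split |].
rewrite (is_derive_unique (fun s : R => r s) _ _ H), (is_derive_unique (fun s : R => c s) _ _ H').
rewrite (is_derive_unique (fun s : R => r1 s) _ _ H1), (is_derive_unique (fun s : R => c1 s) _ _ H1').
unfold k2; ring.
Qed.

Lemma slice_level p : 0 < pz p < z0 ->
  (M p <-> levelf (fun _ => 1) c k e1 e2 (px p - b1) (py p - b2) (pz p) = 0).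
Proof.
intros Hp. rewrite (slice_circle p Hp), Hcx, Hcy by exact Hp. unfold levelf, k.
set (t := pz p). set (x := px p - b1). set (y := py p - b2).
replace (px p - (b1 + c t * e1)) with (x - c t * e1) by (unfold x; ring).
replace (py p - (b2 + c t * e2)) with (y - c t * e2) by (unfold y; ring).
assert (E : (x - c t * e1) * (x - c t * e1) + (y - c t * e2) * (y - c t * e2)
  = x * x + y * y - 2 * c t * (e1 * x + e2 * y) + c t * c t * (e1 * e1 + e2 * e2)) by ring.
rewrite E, He. split; intros H; lra.
Qed.

(** [w] is the cosine of the angle between the radius of the point and [e]. Along one circle zero
    mean curvature is an affine equation in [w], so its two coefficients can be separated
    afterwards. *)
Lemma slice_equations t u v : 0 < t < z0 -> u * u + v * v = 1 ->
  let w := e1 * u + e2 * v in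
  1 - r1 t * r1 t - c1 t * c1 t + r t * r2 t + w * (r t * c2 t - 2 * r1 t * c1 t) = 0 /\
  1 < (c1 t * w + r1 t) * (c1 t * w + r1 t).
Proof.
intros Ht Huv w. assert (Hr := radius_pos t Ht).
set (p := (b1 + c t * e1 + r t * u, b2 + c t * e2 + r t * v, t) : R3).
assert (Mp : part M 0 z0 p).
{ split; [| exact Ht]. apply slice_circle; [exact Ht |]. unfold p; autorewrite with r3.
  rewrite Hcx, Hcy by exact Ht.
  transitivity (r t * r t * (u * u + v * v)); [ring | rewrite Huv; ring]. }
destruct (Hmax p Mp) as (U & X & (HU & HX & _ & _ & Hhom) & (q & Hq & Eq) & Hsp & Hmc).
destruct (Hhom U HU (fun q H => H)) as (W & _ & HW).
assert (HXM : forall q', U q' -> part M 0 z0 (X q')).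
{ intros q' Hq'. destruct (proj1 (HW (X q'))) as [S _]; [now exists q' | exact S]. }
assert (HI : forall q', U q' -> 0 < pz (X q') < z0) by (intros q' Hq'; apply (HXM q' Hq')).
assert (Hlev : forall q', U q' ->
  levelf (fun _ => 1) c k e1 e2 (px (X q') - b1) (py (X q') - b2) (pz (X q')) = 0).
{ intros q' Hq'. apply slice_level; [now apply HI | apply (HXM q' Hq')]. }
assert (D1' : forall z, 0 < z < z0 -> is_derive (fun _ : R => 1) z ((fun _ : R => 0) z))
  by (intros z _; apply (is_derive_const (V := R_NormedModule) 1)).
assert (D0' : forall z, 0 < z < z0 -> is_derive (fun _ : R => 0) z ((fun _ : R => 0) z))
  by (intros z _; apply (is_derive_const (V := R_NormedModule) 0)).
assert (TL := level_set_timelike (fun _ => 1) (fun _ => 0) c c1 k k1 (fun z => 0 < z < z0) e1 e2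
  D1' Dc Dk U X b1 b2 HU HX HI Hlev q Hq).
assert (CV := level_set_curvature (fun _ => 1) (fun _ => 0) (fun _ => 0) c c1 c2 k k1 k2
  (fun z => 0 < z < z0) e1 e2 D1' D0' Dc Dc1 Dk Dk1 U X b1 b2 HU HX HI Hlev q Hq).
cbv zeta beta in TL, CV. rewrite Eq in TL, CV.
set (g1 := gr1 _ _ _ _ _) in TL, CV. set (g2 := gr2 _ _ _ _ _) in TL, CV.
set (g3 := gr3 _ _ _ _ _ _ _ _) in TL, CV.
assert (E1 : g1 = 2 * r t * u) by (unfold g1, gr1, p; autorewrite with r3; ring).
assert (E2 : g2 = 2 * r t * v) by (unfold g2, gr2, p; autorewrite with r3; ring).
assert (E3 : g3 = - 2 * r t * (c1 t * w + r1 t)).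
{ unfold g3, gr3, levelf, k1, w, p; autorewrite with r3.
  transitivity (- 2 * r t * (c1 t * (e1 * u + e2 * v) + r1 t)
    - 2 * c t * c1 t * (e1 * e1 + e2 * e2) + 2 * c t * c1 t); [ring | rewrite He; ring]. }
assert (E12 : g1 * g1 + g2 * g2 = 4 * (r t * r t)).
{ rewrite E1, E2. transitivity (4 * (r t * r t) * (u * u + v * v)); [ring | rewrite Huv; ring]. }
assert (Hrr : 0 < r t * r t) by nra.
assert (Hg : 0 < g1 * g1 + g2 * g2 + g3 * g3).
{ rewrite E12. assert (S := Rle_0_sqr g3). unfold Rsqr in S. lra. }
specialize (TL Hg Hsp). specialize (CV Hg (spacelike_disc U X q Hsp Hq)).
apply CV in Hmc; [| exact Hq]. clear CV.
split.
- revert Hmc. unfold curv. change (gr1 (fun _ => 1) c e1 (px p - b1) (pz p)) with g1.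
  change (gr2 (fun _ => 1) c e2 (py p - b2) (pz p)) with g2.
  change (gr3 (fun _ => 0) c1 k1 e1 e2 (px p - b1) (py p - b2) (pz p)) with g3.
  set (h33 := hs33 _ _ _ _ _ _ _ _).
  assert (E33 : h33 = - 2 * c2 t * (r t * w) + 2 * (c1 t * c1 t)
                      - 2 * (r1 t * r1 t + r t * r2 t)).
  { unfold h33, hs33, levelf, k2, w, p; autorewrite with r3.
    transitivity (- 2 * c2 t * (r t * (e1 * u + e2 * v)) + 2 * (c1 t * c1 t)
      - 2 * (r1 t * r1 t + r t * r2 t)
      - 2 * c t * c2 t * (e1 * e1 + e2 * e2) + 2 * c t * c2 t); [ring | rewrite He; ring]. }
  assert (E13 : g1 * hs13 (fun _ => 0) c1 e1 (px p - b1) (pz p)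
                + g2 * hs23 (fun _ => 0) c1 e2 (py p - b2) (pz p) = - 4 * r t * c1 t * w).
  { rewrite E1, E2. unfold hs13, hs23, w, p; autorewrite with r3. ring. }
  rewrite E12, E13, E33, E3. intros H.
  (* [curv] at this point is [8 r^2] times the stated left-hand side. *)
  apply Rmult_eq_reg_l with (8 * (r t * r t)); [| lra]. rewrite Rmult_0_r, <- H. ring.
- rewrite E12, E3 in TL.
  apply Rmult_lt_reg_l with (4 * (r t * r t)); [lra |]. lra.
Qed.

(** The points of the circle with [w = 1] and [w = -1] give the two coefficients of the affine
    equation separately. *)
Lemma slice_ode1 t : 0 < t < z0 -> r t * c2 t = 2 * r1 t * c1 t.
Proof.
intros Ht. destruct (slice_equations t e1 e2 Ht He) as [H1 _].
destruct (slice_equations t (- e1) (- e2) Ht) as [H2 _]; [rewrite <- He; ring |].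
rewrite He in H1. replace (e1 * - e1 + e2 * - e2) with (- (e1 * e1 + e2 * e2)) in H2 by ring.
rewrite He in H2. lra.
Qed.

Lemma slice_ode2 t : 0 < t < z0 -> 1 - r1 t * r1 t - c1 t * c1 t + r t * r2 t = 0.
Proof.
intros Ht. destruct (slice_equations t e1 e2 Ht He) as [H1 _].
rewrite (slice_ode1 t Ht) in H1. lra.
Qed.

Lemma slice_spacelike t : 0 < t < z0 -> forall x, -1 <= x <= 1 ->
  1 < (c1 t * x + r1 t) * (c1 t * x + r1 t).
Proof.
intros Ht x Hx.
assert (Hs : sqrt (1 - x * x) * sqrt (1 - x * x) = 1 - x * x) by (apply sqrt_sqrt; nra).
set (s := sqrt (1 - x * x)) in *.
(* The unit vector whose component along [e] is [x], completed by [s] in the orthogonal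
   direction. *)
destruct (slice_equations t (x * e1 - s * e2) (x * e2 + s * e1) Ht) as [_ H].
- transitivity ((x * x + s * s) * (e1 * e1 + e2 * e2)); [ring | rewrite Hs, He; ring].
- replace (e1 * (x * e1 - s * e2) + e2 * (x * e2 + s * e1)) with (x * (e1 * e1 + e2 * e2)) in H by ring.
  rewrite He, Rmult_1_r in H. exact H.
Qed.

(* Otherwise all circles have their centres on one vertical line. *)
Lemma centre_moves lam : (forall t, 0 < t < z0 -> c1 t = lam * (r t * r t)) -> lam <> 0.
Proof.
intros Hc1 ->. apply Hrot.
set (a1 := b1 + c (z0 / 2) * e1). set (a2 := b2 + c (z0 / 2) * e2).
assert (Ec : forall t, 0 < t < z0 -> c t = c (z0 / 2)).
{ intros t Ht. apply (derive0_const c c1 0 z0 t (z0 / 2) Dc); try lra.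
  intros x Hx. rewrite Hc1 by exact Hx. ring. }
pose (phi := fun (s : R) (p : R3) =>
  (a1 + (cos s * (px p - a1) - sin s * (py p - a2)),
   a2 + (sin s * (px p - a1) + cos s * (py p - a2)), pz p) : R3).
exists phi. split.
- split; [|split; [|split; [|split; [|split]]]].
  + intros p. apply R3_eq; unfold phi; autorewrite with r3; rewrite ?cos_0, ?sin_0; ring.
  + intros s t p. apply R3_eq; unfold phi; autorewrite with r3; rewrite ?cos_plus, ?sin_plus; ring.
  + intros p s. apply continuous_R3.
    * apply (ex_derive_continuous (K := R_AbsRing) (V := R_NormedModule)
        (fun t => a1 + (cos t * (px p - a1) - sin t * (py p - a2)))). auto_derive; trivial.
    * apply (ex_derive_continuous (K := R_AbsRing) (V := R_NormedModule)
        (fun t => a2 + (sin t * (px p - a1) + cos t * (py p - a2)))). auto_derive; trivial.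
    * apply continuous_const.
  + intros s p q. unfold lprod; autorewrite with r3. unfold phi; autorewrite with r3.
    assert (S := sin2_cos2 s). unfold Rsqr in S.
    transitivity (((px p - px q) * (px p - px q) + (py p - py q) * (py p - py q))
      * (sin s * sin s + cos s * cos s) - (pz p - pz q) * (pz p - pz q)); [ring |].
    rewrite S. ring.
  + exists (a1, a2, 0), (0, 0, 1). split.
    * intros E. assert (E' := f_equal pz E). change (1 = 0) in E'. lra.
    * intros s a. apply R3_eq; unfold phi; autorewrite with r3; ring.
  + exists PI, (a1 + 1, a2, 0). intros E. assert (E' := f_equal px E).
    unfold phi in E'; autorewrite with r3 in E'. rewrite cos_PI, sin_PI in E'. lra.
- intros p [Mp Hp]. exists (mkposreal 1 Rlt_0_1). intros s _. split; [| exact Hp].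
  apply slice_circle; [exact Hp |]. apply slice_circle in Mp; [| exact Hp].
  unfold phi; autorewrite with r3. rewrite <- Mp.
  rewrite !Hcx, !Hcy, !(Ec _ Hp) by exact Hp. fold a1 a2.
  assert (S := sin2_cos2 s). unfold Rsqr in S.
  transitivity (((px p - a1) * (px p - a1) + (py p - a2) * (py p - a2))
      * (sin s * sin s + cos s * cos s)); [ring | rewrite S; ring].
Qed.

Section Continued.

Variables (lam K : R).
Hypothesis Hlam : 0 < lam.
Hypothesis Hc1 : forall t, 0 < t < z0 -> c1 t = lam * (r t * r t).
Hypothesis HrK : forall t, 0 < t < z0 ->
  r1 t * r1 t = 1 + K * (r t * r t) + lam * lam * (r t * r t * (r t * r t)).
Hypothesis Hlim : filterlim r (at_right 0) (locally 0).
Hypothesis Hlines : forall p, line o d p <->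
  (pz p = z0 /\ e1 * (px p - b1) + e2 * (py p - b2) = 0).

Let Hr1 t : 0 < t < z0 -> 0 < r1 t.
Proof.
intros Ht.
exact (speed_pos z0 r r1 r2 c1 radius_pos Dr Dr1 lam Hc1 Hlam slice_spacelike Hlim t Ht).
Qed.

Let HK : 2 * lam < K.
Proof.
exact (spacelike_modulus z0 r r1 c1 Hz0 radius_pos lam Hc1 Hlam slice_spacelike K HrK).
Qed.

Lemma radius_increasing s t : 0 < s -> s < t -> t < z0 -> r s < r t.
Proof. apply (derive_pos_increasing r r1 0 z0 s t Dr Hr1). Qed.

Lemma centre_increasing s t : 0 < s -> s < t -> t < z0 -> c s < c t.
Proof.
apply (derive_pos_increasing c c1 0 z0 s t Dc).
intros x Hx. rewrite Hc1 by exact Hx. assert (H := radius_pos x Hx).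
repeat apply Rmult_lt_0_compat; assumption.
Qed.

(** Points of the surface in the vertical plane of the centres whose positions converge as the
    height tends to [z0] have a limit in the boundary. That limit is not [P], so it lies on the
    line, which meets this plane only at coordinate 0. *)
Lemma edge_limit f l :
  (forall t, 0 < t < z0 -> M (b1 + f t * e1, b2 + f t * e2, t)) ->
  (forall eps, 0 < eps -> exists e, 0 < e /\
     forall t, 0 < t < z0 -> z0 - e < t -> Rabs (f t - l) < eps) -> l = 0.
Proof.
intros HM Hf.
set (p := (b1 + l * e1, b2 + l * e2, z0) : R3).
assert (B : boundary (part M 0 z0) p).
{ split.
  - intros eps. destruct (Hf eps (cond_pos eps)) as (e & He' & H).
    set (t := z0 - Rmin (z0 / 2) (Rmin (e / 2) (eps / 2))).
    assert (H1 := Rmin_l (z0 / 2) (Rmin (e / 2) (eps / 2))).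
    assert (H2 := Rmin_r (z0 / 2) (Rmin (e / 2) (eps / 2))).
    assert (H3 := Rmin_l (e / 2) (eps / 2)). assert (H4 := Rmin_r (e / 2) (eps / 2)).
    assert (Heps := cond_pos eps).
    assert (H5 : 0 < Rmin (z0 / 2) (Rmin (e / 2) (eps / 2))) by (repeat apply Rmin_pos; lra).
    assert (Ht : 0 < t < z0) by (unfold t; lra).
    exists (b1 + f t * e1, b2 + f t * e2, t). split; [split; [now apply HM | exact Ht] |].
    assert (Hfl : Rabs (f t - l) < eps) by (apply H; [exact Ht | unfold t; lra]).
    assert (Bd : forall x, x * x <= 1 -> Rabs ((f t - l) * x) < eps).
    { intros x Hx. rewrite Rabs_mult.
      apply Rle_lt_trans with (Rabs (f t - l) * 1); [| lra].
      apply Rmult_le_compat_l; [apply Rabs_pos | now apply Rabs_le_1]. }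
    apply ball3. unfold p; autorewrite with r3. split; [|split].
    + replace (b1 + f t * e1 - (b1 + l * e1)) with ((f t - l) * e1) by ring. apply Bd; nra.
    + replace (b2 + f t * e2 - (b2 + l * e2)) with ((f t - l) * e2) by ring. apply Bd; nra.
    + apply Rabs_def1; unfold t; lra.
  - intros [_ H]. unfold p in H; autorewrite with r3 in H. lra. }
apply Hbd in B. destruct B as [B | B].
- assert (E := f_equal pz B). rewrite HP in E. unfold p in E; autorewrite with r3 in E. lra.
- apply Hlines in B. destruct B as [_ B]. unfold p in B; autorewrite with r3 in B.
  transitivity (l * (e1 * e1 + e2 * e2)); [rewrite He; ring | lra].
Qed.

Let extreme_point s t : s * s = 1 -> 0 < t < z0 ->
  M (b1 + (c t + s * r t) * e1, b2 + (c t + s * r t) * e2, t).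
Proof.
intros Hs Ht. apply slice_circle; [exact Ht |]. autorewrite with r3.
rewrite Hcx, Hcy by exact Ht.
transitivity (r t * r t * (s * s) * (e1 * e1 + e2 * e2)); [ring | rewrite He, Hs; ring].
Qed.

Let increasing_limit f m :
  (forall s t, 0 < s -> s < t -> t < z0 -> f s < f t) -> (forall t, 0 < t < z0 -> f t <= m) ->
  exists l, (forall t, 0 < t < z0 -> f t <= l) /\
    forall eps, 0 < eps -> exists e, 0 < e /\
      forall t, 0 < t < z0 -> z0 - e < t -> Rabs (f t - l) < eps.
Proof.
intros Hf Hm.
destruct (completeness (fun y => exists t, 0 < t < z0 /\ y = f t)) as [l [Hl1 Hl2]].
- exists m. intros y (t & Ht & ->). now apply Hm.
- exists (f (z0 / 2)), (z0 / 2). split; [lra | reflexivity].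
- exists l. split; [intros t Ht; apply Hl1; now exists t |].
  intros eps Heps.
  assert (X : exists t, 0 < t < z0 /\ l - eps < f t).
  { apply NNPP. intros N. assert (l <= l - eps); [| lra].
    apply Hl2. intros y (t & Ht & ->). apply Rnot_lt_le. intros L. apply N. now exists t. }
  destruct X as (t & Ht & L). exists (z0 - t). split; [lra |].
  intros s Hs Hs'. assert (f s <= l) by (apply Hl1; now exists s).
  assert (f t < f s) by (apply Hf; lra). apply Rabs_def1; lra.
Qed.

(* If the circles stayed bounded they would converge to a circle in the plane of the line. *)
Lemma radius_unbounded m : exists e, 0 < e /\ forall t, 0 < t < z0 -> z0 - e < t -> m < r t.
Proof.
apply NNPP. intros N.
assert (Hm : forall t, 0 < t < z0 -> r t <= m).
{ intros t Ht. apply Rnot_lt_le. intros L. apply N. exists (z0 - t). split; [lra |].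
  intros s Hs Hs'. apply Rlt_trans with (r t); [exact L | apply radius_increasing; lra]. }
destruct (increasing_limit r m radius_increasing Hm) as (lr & Hlr & Lr).
assert (Hh : 0 < z0 / 2 < z0) by lra.
(* Up to the middle height monotonicity bounds the centre; beyond it, the bound [lam m^2] on its
   speed does. *)
assert (Hmc : forall t, 0 < t < z0 -> c t <= Rmax (c (z0 / 2)) (c (z0 / 2) + lam * (m * m) * z0)).
{ intros t Ht. destruct (Rle_lt_dec t (z0 / 2)) as [L | L].
  - eapply Rle_trans; [| apply Rmax_l]. destruct L as [L | ->]; [| lra].
    apply Rlt_le, centre_increasing; lra.
  - eapply Rle_trans; [| apply Rmax_r].
    destruct (MVT_open c c1 0 z0 (z0 / 2) t Dc Hh Ht) as (x & Hx & E).
    rewrite Rmin_left, Rmax_right in Hx by lra.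
    assert (Hx0 : 0 < x < z0) by lra. rewrite (Hc1 x Hx0) in E.
    assert (H1 := radius_pos x Hx0). assert (H2 := Hm x Hx0).
    assert (r x * r x <= m * m) by nra.
    assert (lam * (r x * r x) * (t - z0 / 2) <= lam * (m * m) * z0); [| lra].
    apply Rmult_le_compat; try lra.
    - apply Rmult_le_pos; nra.
    - apply Rmult_le_compat_l; lra. }
destruct (increasing_limit c _ centre_increasing Hmc) as (lc & _ & Lc).
assert (Lim : forall s, s * s = 1 -> lc + s * lr = 0).
{ intros s Hs. apply (edge_limit (fun t => c t + s * r t)); [now intros t; apply extreme_point |].
  intros eps Heps. destruct (Lr (eps / 2)) as (e & H0 & H); [lra |].
  destruct (Lc (eps / 2)) as (e' & H0' & H'); [lra |].
  exists (Rmin e e'). split; [now apply Rmin_pos |]. intros t Ht Hte.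
  assert (E1 := Rmin_l e e'). assert (E2 := Rmin_r e e').
  replace (c t + s * r t - (lc + s * lr)) with ((c t - lc) + s * (r t - lr)) by ring.
  eapply Rle_lt_trans; [apply Rabs_triang |]. rewrite Rabs_mult.
  assert (Es : Rabs s = 1).
  { rewrite <- (sqrt_Rsqr_abs s). unfold Rsqr. rewrite Hs. apply sqrt_1. }
  assert (A1 := H t Ht ltac:(lra)). assert (A2 := H' t Ht ltac:(lra)). rewrite Es. lra. }
(* Both ends of the limiting diameter would be at coordinate 0, which forces the limiting radius to
   vanish. *)
assert (L1 := Lim 1 ltac:(ring)). assert (L2 := Lim (-1) ltac:(ring)).
assert (L3 := Hlr _ Hh). assert (L4 := radius_pos _ Hh). lra.
Qed.

(** The offset is the limit of [c - r], because [beta / rho - r] tends to 0; [edge_limit] makes it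
    zero. *)
Lemma centre_profile t : 0 < t < z0 -> c t = beta z0 lam K r t / rho z0 r t.
Proof.
assert (Dc' : forall t, 0 < t < z0 -> is_derive c t (lam * (r t * r t)))
  by (intros s Hs; rewrite <- Hc1 by exact Hs; now apply Dc).
destruct (centre_offset z0 lam K r r1 Hz0 Hlam HK radius_pos Dr Hr1 HrK radius_unbounded c Dc')
  as (kap & Hkap).
assert (E : kap = 0); [| intros Ht; rewrite (Hkap t Ht), E; ring].
apply (edge_limit (fun t => c t + -1 * r t)).
- intros s Hs; apply extreme_point; [ring | exact Hs].
- intros eps Heps.
  destruct (edge_tends z0 lam K r r1 Hz0 Hlam HK radius_pos Dr Hr1 HrK radius_unbounded eps Heps)
    as (e & He0 & H).
  exists e. split; [exact He0 |]. intros s Hs Hse. rewrite (Hkap s Hs).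
  replace (beta z0 lam K r s / rho z0 r s + kap + -1 * r s - kap)
    with (beta z0 lam K r s / rho z0 r s - r s) by ring.
  now apply H.
Qed.

Hypothesis HMz : forall p, M p -> 0 < pz p <= z0.
Hypothesis HMl : forall p, pz p = z0 -> (M p <-> line o d p).
Hypothesis Hturn : forall p,
  pz (half_turn o d p) = 2 * z0 - pz p /\
  e1 * (px (half_turn o d p) - b1) + e2 * (py (half_turn o d p) - b2)
  = - (e1 * (px p - b1) + e2 * (py p - b2)) /\
  (px (half_turn o d p) - b1) * (px (half_turn o d p) - b1)
  + (py (half_turn o d p) - b2) * (py (half_turn o d p) - b2)
  = (px p - b1) * (px p - b1) + (py p - b2) * (py p - b2).

Let sf := surf z0 lam K r e1 e2.

Let M_surf p : 0 < pz p <= z0 -> (M p <-> sf (px p - b1) (py p - b2) (pz p) = 0).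
Proof.
intros [H1 [H2 | H2]].
- assert (Hp : 0 < pz p < z0) by lra. rewrite (slice_level p Hp). unfold sf.
  rewrite (surf_below z0 lam K r Hlam HK radius_pos e1 e2 c _ _ _ Hp (centre_profile _ Hp)).
  assert (Hr0 := rho_pos z0 r radius_pos _ Hp). fold k.
  split; intros H; [rewrite H; ring |].
  apply Rmult_integral in H; destruct H; [lra | assumption].
- rewrite (HMl p H2), Hlines, H2. unfold sf. rewrite (surf_z0 z0 lam K r Hlam). tauto.
Qed.

Lemma doubled_surf p : 0 < pz p < 2 * z0 ->
  (doubled M o d p <-> sf (px p - b1) (py p - b2) (pz p) = 0).
Proof.
intros Hp. destruct (Hturn p) as (T1 & T2 & T3). unfold doubled.
assert (E : sf (px (half_turn o d p) - b1) (py (half_turn o d p) - b2) (pz (half_turn o d p))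
            = - sf (px p - b1) (py p - b2) (pz p)).
{ rewrite T1. unfold sf.
  now apply (surf_turn z0 lam K r r1 Hz0 Hlam radius_pos Dr Hr1 HrK radius_unbounded). }
destruct (Rle_lt_dec (pz p) z0) as [L | L].
- split; [| intros H; left; apply M_surf; tauto].
  intros [H | H]; [apply M_surf; tauto |].
  assert (H' := HMz _ H). apply M_surf in H; [| exact H']. lra.
- split.
  + intros [H | H]; [apply HMz in H; lra |].
    apply M_surf in H; [| rewrite T1; lra]. lra.
  + intros H. right. apply M_surf; [rewrite T1; lra |]. lra.
Qed.

(** The interface to the global argument: an existential defining function keeps the profile
    functions out of the construction of the periodic surface. *)
Lemma doubled_implicit : exists F : R -> R -> R -> R,
  (forall p, 0 < pz p < 2 * z0 ->
     (doubled M o d p <-> F (px p - b1) (py p - b2) (pz p) = 0)) /\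
  (forall p, 0 < pz p < 2 * z0 ->
     continuous (fun p : R3 => F (px p - b1) (py p - b2) (pz p)) p) /\
  (forall de, 0 < de < z0 -> exists R, forall x y, R < sqrt (x * x + y * y) ->
     exists z, z0 - de <= z <= z0 + de /\ F x y z = 0) /\
  (forall p, pz p = z0 -> doubled M o d p -> maximal_at (doubled M o d) p).
Proof.
exists sf. split; [exact doubled_surf | split; [|split]].
- intros p Hp.
  exact (surf_continuous z0 lam K r r1 Hz0 Hlam HK radius_pos Dr Hr1 HrK radius_unbounded
    e1 e2 b1 b2 p Hp).
- exact (surf_far z0 lam K r r1 Hz0 Hlam HK radius_pos Dr Hr1 HrK radius_unbounded e1 e2 He).
- exact (maximal_at_line z0 lam K r r1 Hz0 Hlam HK radius_pos Dr Hr1 HrK radius_unbounded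
    e1 e2 He b1 b2 (doubled M o d) doubled_surf).
Qed.

End Continued.

End Frame.

End Slices.

(** * Transport of boundaries, tangent cones and foliations *)

Lemma affT t p : aff 0 1 1 t p = plus p t.
Proof. apply R3_eq; unfold aff, lin; autorewrite with r3; ring. Qed.

Lemma pz_aff c d s t p : pz (aff c d s t p) = s * pz p + pz t.
Proof. unfold aff, lin; autorewrite with r3; ring. Qed.

Lemma adherent_local (S S' N : R3 -> Prop) p :
  open N -> N p -> (forall q, N q -> S q -> S' q) -> adherent S p -> adherent S' p.
Proof.
intros HN Np HS H eps. destruct (HN p Np) as [e He].
assert (Hm : 0 < Rmin e eps) by (apply Rmin_pos; apply cond_pos).
destruct (H (mkposreal _ Hm)) as (q & Sq & Bq). simpl in Bq.
exists q. split.
- apply HS; [| exact Sq]. apply He. apply ball_le with (Rmin e eps); [apply Rmin_l | exact Bq].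
- apply ball_le with (Rmin e eps); [apply Rmin_r | exact Bq].
Qed.

Lemma adherent_aff c d s t (S S' : R3 -> Prop) p :
  (forall q, S q -> S' (aff c d s t q)) -> adherent S p -> adherent S' (aff c d s t p).
Proof.
intros HS H eps.
assert (C := continuous_aff c d s t p). apply filterlim_locally with (eps := eps) in C.
destruct C as [e He]. destruct (H e) as (q & Sq & Bq).
exists (aff c d s t q). split; [now apply HS | now apply He].
Qed.

Lemma adherent_or (S S' : R3 -> Prop) p :
  adherent (fun q => S q \/ S' q) p -> adherent S p \/ adherent S' p.
Proof.
intros H. destruct (classic (adherent S p)) as [A | A]; [now left | right].
apply not_all_ex_not in A. destruct A as [e He]. intros eps.
assert (Hm : 0 < Rmin e eps) by (apply Rmin_pos; apply cond_pos).
destruct (H (mkposreal _ Hm)) as (q & [Sq | Sq] & Bq); simpl in Bq.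
- exfalso. apply He. exists q. split; [exact Sq |].
  apply ball_le with (Rmin e eps); [apply Rmin_l | exact Bq].
- exists q. split; [exact Sq |]. apply ball_le with (Rmin e eps); [apply Rmin_r | exact Bq].
Qed.

Lemma adherent_closed (G : R3 -> R) (S : R3 -> Prop) p :
  continuous G p -> (forall q, S q -> G q = 0) -> adherent S p -> G p = 0.
Proof.
intros HG HS H. apply NNPP. intros N.
assert (Hp : 0 < Rabs (G p)) by now apply Rabs_pos_lt.
apply filterlim_locally with (eps := mkposreal _ Hp) in HG. destruct HG as [e He].
destruct (H e) as (q & Sq & Bq). specialize (He q Bq).
change (Rabs (G q - G p) < Rabs (G p)) in He. rewrite (HS q Sq) in He.
rewrite Rminus_0_l, Rabs_Ropp in He. lra.
Qed.

(** Tangent directions depend only on points near the vertex, so the inclusion is assumed only in a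
    slab around its height. *)
Lemma tangent_cone_aff c d s t (A B : R3 -> Prop) P de v :
  c * c + d * d = 1 -> s * s = 1 -> 0 < de ->
  (forall p, Rabs (pz p - pz P) < de -> A p -> B (aff c d s t p)) ->
  tangent_cone A P v -> tangent_cone B (aff c d s t P) (lin c d s v).
Proof.
intros Hcd Hs Hde HAB H eps.
assert (Hv := Rabs_pos (pz v)).
assert (Hq : 0 < de / (Rabs (pz v) + 1)) by (apply Rdiv_lt_0_compat; lra).
(* Half of [eps], since a new horizontal coordinate mixes two errors with coefficients at most 1.
   The other bounds keep the chosen point in the slab: its rescaled height differs from [pz v] by
   less than 1. *)
set (e := Rmin (eps / 2) (Rmin 1 (de / (Rabs (pz v) + 1)))).
assert (He : 0 < e).
{ apply Rmin_pos; [generalize (cond_pos eps); lra |]. apply Rmin_pos; [lra | exact Hq]. }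
assert (E1 : e <= eps / 2) by apply Rmin_l.
assert (E2 : e <= 1) by (eapply Rle_trans; [apply Rmin_r | apply Rmin_l]).
assert (E3 : e <= de / (Rabs (pz v) + 1)) by (eapply Rle_trans; [apply Rmin_r | apply Rmin_r]).
clearbody e.
destruct (H (mkposreal e He)) as (p & tau & Ap & Htau & B3). simpl in Htau.
apply ball3 in B3. cbn [pos] in B3. autorewrite with r3 in B3. destruct B3 as (X & Y & Z).
exists (aff c d s t p), tau. split; [apply HAB; [| exact Ap] | split; [lra |]].
- assert (Ez : pz p - pz P = tau * (/ tau * (pz p - pz P))) by (field; lra).
  rewrite Ez, Rabs_mult, (Rabs_right tau) by lra.
  assert (L : Rabs (/ tau * (pz p - pz P)) < Rabs (pz v) + 1).
  { replace (/ tau * (pz p - pz P)) with ((/ tau * (pz p - pz P) - pz v) + pz v) by ring.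
    eapply Rle_lt_trans; [apply Rabs_triang | lra]. }
  apply Rlt_le_trans with (tau * (Rabs (pz v) + 1)); [apply Rmult_lt_compat_l; lra |].
  apply Rle_trans with (de / (Rabs (pz v) + 1) * (Rabs (pz v) + 1));
    [apply Rmult_le_compat_r; lra | right; field; lra].
- set (x := / tau * (px p - px P) - px v) in *. set (y := / tau * (py p - py P) - py v) in *.
  set (z := / tau * (pz p - pz P) - pz v) in *.
  assert (Bm : forall a u, a * a <= 1 -> Rabs u < e -> Rabs (a * u) <= Rabs u).
  { intros a u Ha Hu. rewrite Rabs_mult. rewrite <- (Rmult_1_l (Rabs u)) at 2.
    apply Rmult_le_compat_r; [apply Rabs_pos | now apply Rabs_le_1]. }
  assert (Hsd : s * d * (s * d) <= 1) by (replace (s * d * (s * d)) with (s * s * (d * d)) by ring; rewrite Hs; nra).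
  assert (Hsc : - (s * c) * - (s * c) <= 1) by (replace (- (s * c) * - (s * c)) with (s * s * (c * c)) by ring; rewrite Hs; nra).
  apply ball3. unfold aff, lin; autorewrite with r3. split; [|split].
  + replace (/ tau * _ - _) with (s * d * x + - (s * c) * y) by (unfold x, y; ring).
    eapply Rle_lt_trans; [apply Rabs_triang |].
    assert (K1 := Bm (s * d) x Hsd X). assert (K2 := Bm (- (s * c)) y Hsc Y). lra.
  + replace (/ tau * _ - _) with (c * x + d * y) by (unfold x, y; ring).
    eapply Rle_lt_trans; [apply Rabs_triang |].
    assert (K1 := Bm c x ltac:(nra) X). assert (K2 := Bm d y ltac:(nra) Y). lra.
  + replace (/ tau * _ - _) with (s * z) by (unfold z; ring).
    assert (K1 := Bm s z ltac:(lra) Z). lra.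
Qed.

(** The preceding inclusion is applied to the isometry and to its inverse. The light cone is
    invariant, and [s] records whether the upper half becomes the lower one. *)
Lemma light_cone_aff c d s t (A B : R3 -> Prop) P de :
  c * c + d * d = 1 -> s * s = 1 -> 0 < de ->
  (forall p, Rabs (pz p - pz P) < de -> (A p <-> B (aff c d s t p))) ->
  (forall v, tangent_cone A P v <-> (lprod v v = 0 /\ 0 <= 1 * pz v)) ->
  forall v, tangent_cone B (aff c d s t P) v <-> (lprod v v = 0 /\ 0 <= s * pz v).
Proof.
intros Hcd Hs Hde HAB HA v.
assert (Hcd' : - (s * c) * - (s * c) + d * d = 1).
{ replace (- (s * c) * - (s * c)) with (s * s * (c * c)) by ring. rewrite Hs. lra. }
set (u := lin (- (s * c)) d s v).
assert (Ev : v = lin c d s u).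
{ assert (K := affK c d s zero Hcd Hs v). unfold aff, aff_inv in K.
  assert (M0 : forall x : R3, minus x zero = x) by (intros x; apply R3_eq; autorewrite with r3;
    [change (px zero) with 0 | change (py zero) with 0 | change (pz zero) with 0]; ring).
  assert (P0 : forall x : R3, plus x zero = x) by (intros x; apply R3_eq; autorewrite with r3;
    [change (px zero) with 0 | change (py zero) with 0 | change (pz zero) with 0]; ring).
  rewrite M0, P0 in K. now symmetry. }
assert (Ez : s * pz v = 1 * pz u).
{ unfold u, lin; autorewrite with r3. ring. }
assert (El : lprod v v = lprod u u) by (rewrite Ev; now apply lprod_lin).
rewrite Ez, El, <- HA. split; intros H.
- rewrite <- (aff_invK c d s t Hcd Hs P), aff_inv_aff.
  apply (tangent_cone_aff _ _ _ _ B A (aff c d s t P) de); try assumption.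
  intros p Hp Bp. rewrite <- aff_inv_aff. apply HAB.
  + rewrite <- (affK c d s t Hcd Hs p) in Hp. rewrite !pz_aff in Hp.
    replace (s * pz (aff_inv c d s t p) + pz t - (s * pz P + pz t))
      with (s * (pz (aff_inv c d s t p) - pz P)) in Hp by ring.
    rewrite Rabs_mult in Hp.
    assert (As : Rabs s = 1) by (rewrite <- sqrt_Rsqr_abs; unfold Rsqr; rewrite Hs; apply sqrt_1).
    rewrite As in Hp. lra.
  + now rewrite (affK c d s t Hcd Hs).
- rewrite Ev. apply (tangent_cone_aff c d s t A B P de); try assumption.
  intros p Hp Ap. now apply HAB.
Qed.

Lemma smooth_on_affine (f g : R -> R) a b a0 b0 al sg tau s0 :
  smooth_on_interval f a b ->
  (forall t, a0 < t < b0 -> a < tau * t + s0 < b) ->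
  (forall t, a0 < t < b0 -> g t = sg * f (tau * t + s0) + al) ->
  smooth_on_interval g a0 b0.
Proof.
intros Hf Hin Hg t Ht n.
apply (ex_derive_n_ext_loc (fun t => sg * f (tau * t + s0) + al)).
- generalize (locally_between a0 b0 t Ht). apply filter_imp. intros y Hy. symmetry. now apply Hg.
- assert (K : forall m, ex_derive_n (fun t => f (tau * t + s0)) m t /\
    locally t (fun y => ex_derive_n (fun t => f (tau * t + s0)) m y)).
  { assert (K : forall y, a0 < y < b0 -> forall m, ex_derive_n (fun t => f (tau * t + s0)) m y).
    { intros y Hy m. apply (ex_derive_n_comp_scal (fun x => f (x + s0)) tau m y).
      assert (Hy' := Hin y Hy).
      generalize (locally_between (a - s0) (b - s0) (tau * y) ltac:(lra)). apply filter_imp.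
      intros x Hx j _. apply ex_derive_n_comp_trans, Hf. lra. }
    intros m. split; [now apply K |].
    generalize (locally_between a0 b0 t Ht). apply filter_imp. intros y Hy. now apply K. }
  apply ex_derive_n_plus.
  + assert (L' : forall m, locally t
      (fun y => forall j, (j <= m)%nat -> ex_derive_n (fun t => f (tau * t + s0)) j y)).
    { induction m as [|m IH].
      - generalize (proj2 (K O)). apply filter_imp. intros y Hy j Hj. now replace j with O by lia.
      - generalize (filter_and _ _ IH (proj2 (K (Datatypes.S m)))). apply filter_imp.
        intros y [Y1 Y2] j Hj.
        destruct (Nat.eq_dec j (Datatypes.S m)) as [-> | Hne]; [exact Y2 | apply Y1; lia]. }
    generalize (L' n). apply filter_imp. intros y Hy j Hj. apply ex_derive_n_scal_l. now apply Hy.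
  + exists (mkposreal 1 Rlt_0_1). intros y _ j _. apply ex_derive_n_const.
Qed.

Lemma foliated_of_circles (S : R3 -> Prop) t0 t1 Cx Cy Rad :
  smooth_on_interval Cx t0 t1 -> smooth_on_interval Cy t0 t1 -> smooth_on_interval Rad t0 t1 ->
  (forall t, t0 < t < t1 -> 0 < Rad t) ->
  (forall p, t0 < pz p < t1 -> (S p <-> (px p - Cx (pz p)) * (px p - Cx (pz p))
     + (py p - Cy (pz p)) * (py p - Cy (pz p)) = Rad (pz p) * Rad (pz p))) ->
  foliated_by_circles S t0 t1 Cx Cy Rad.
Proof.
intros HX HY HR Hpos HS. split; [exact HX | split; [exact HY | split; [exact HR |]]].
intros t Ht. assert (Hp := Hpos t Ht). assert (HPI := PI_RGT_0). split; [exact Hp |].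
(* Arcs are open, so an angle interval longer than [2 PI] is needed to obtain every point of the
   circle. *)
exists 0, (4 * PI). split; [lra |]. intros p <-. rewrite (HS p Ht). split.
- intros E. destruct (polar_angle 0 _ _ _ Hp E) as (v & Hv & E1 & E2).
  exists v. split; [lra |]. apply R3_eq; autorewrite with r3; lra.
- intros (v & _ & E). assert (E1 := f_equal px E). assert (E2 := f_equal py E).
  rewrite px_pair in E1. rewrite py_pair in E2. rewrite E1, E2.
  assert (Q := sin2_cos2 v). unfold Rsqr in Q. set (t := pz p) in *.
  transitivity (Rad t * Rad t * (sin v * sin v + cos v * cos v)); [| rewrite Q]; ring.
Qed.

Lemma norm_shift x y a b :
  sqrt ((x + a) * (x + a) + (y + b) * (y + b)) <= sqrt (x * x + y * y) + Rabs a + Rabs b.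
Proof.
assert (Hs : sqrt (x * x + y * y) * sqrt (x * x + y * y) = x * x + y * y) by (apply sqrt_sqrt; nra).
assert (Hs0 := sqrt_pos (x * x + y * y)). set (s := sqrt (x * x + y * y)) in *.
assert (Ha := Rabs_pos a). assert (Hb := Rabs_pos b).
rewrite <- (sqrt_square (s + Rabs a + Rabs b)) by lra. apply sqrt_le_1_alt.
assert (Aa : Rabs a * Rabs a = a * a) by (rewrite <- Rabs_mult; apply Rabs_right; nra).
assert (Bb : Rabs b * Rabs b = b * b) by (rewrite <- Rabs_mult; apply Rabs_right; nra).
assert (Hx : Rabs x <= s) by (rewrite <- (Rabs_right s) by lra; apply Rsqr_le_abs_0; unfold Rsqr; nra).
assert (Hy : Rabs y <= s) by (rewrite <- (Rabs_right s) by lra; apply Rsqr_le_abs_0; unfold Rsqr; nra).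
assert (Xa : x * a <= s * Rabs a).
{ eapply Rle_trans; [apply Rle_abs |]. rewrite Rabs_mult. now apply Rmult_le_compat_r. }
assert (Yb : y * b <= s * Rabs b).
{ eapply Rle_trans; [apply Rle_abs |]. rewrite Rabs_mult. now apply Rmult_le_compat_r. }
nra.
Qed.

Lemma filterlim_affine {T : Type} (F : (T -> Prop) -> Prop) {FF : Filter F} (f : T -> R) l a b :
  filterlim f F (locally l) -> filterlim (fun x => a * f x + b) F (locally (a * l + b)).
Proof.
intros H. apply (filterlim_comp _ _ _ f (fun x => a * x + b) _ (locally l)); [exact H |].
apply (ex_derive_continuous (K := R_AbsRing) (V := R_NormedModule) (fun x => a * x + b)).
auto_derive; trivial.
Qed.

(** * The periodic surface *)

Definition periodic_maximal_continuation (M : R3 -> Prop) (z0 : R) (P o d : R3) : Prop :=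
    let w := period P o d in
    let S := periodic_surface M P o d in
    maximal_surface (doubled M o d) /\
    maximal_surface S /\
    w <> zero /\ (forall p, S (plus p w) <-> S p) /\
    (exists Cx Cy Rad : R -> R,
       (forall n : Z,
          foliated_by_circles S (IZR n * z0) (IZR (n + 1) * z0) Cx Cy Rad) /\
       (forall (n : Z) p, pz p = IZR (2 * n + 1) * z0 ->
          (S p <-> translate n w (line o d) p)) /\
       (forall (n : Z) p, pz p = IZR (2 * n) * z0 ->
          ~ S p /\ (boundary S p <-> p = plus P (scal (IZR n) w))) /\
       (forall p, boundary S p <-> exists n : Z, p = plus P (scal (IZR n) w)) /\
       (forall n : Z,
          conelike S Cx Cy Rad (plus P (scal (IZR n) w)) 1 /\
          conelike S Cx Cy Rad (plus P (scal (IZR n) w)) (-1))) /\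
    discrete_family (fun n => translate n w (line o d)) /\
    (forall (n : Z) p, translate n w (line o d) p -> pz p = IZR (2 * n + 1) * z0) /\
    discrete_family (fun n p => p = plus P (scal (IZR n) w)) /\
    (forall n : Z,
       asymptotic_to_horizontal_plane
         (part S (IZR (2 * n) * z0) (IZR (2 * n + 2) * z0))
         (IZR (2 * n + 1) * z0)).

Section Periodic.

Variables (M : R3 -> Prop) (z0 : R) (cx cy r : R -> R) (P o d : R3).
Hypothesis Hz0 : 0 < z0.
Hypothesis Hmax : maximal_surface (part M 0 z0).
Hypothesis Hfol : foliated_by_circles (part M 0 z0) 0 z0 cx cy r.
Hypothesis HMz : forall p, M p -> 0 < pz p <= z0.
Hypothesis HMl : forall p, pz p = z0 -> (M p <-> line o d p).
Hypothesis HP : pz P = 0.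
Hypothesis Hcone : conelike M cx cy r P 1.
Hypothesis Hbd : forall p, boundary (part M 0 z0) p <-> (p = P \/ line o d p).

Variables (b1 b2 e1 e2 : R) (c : R -> R).
Hypothesis He : e1 * e1 + e2 * e2 = 1.
Hypothesis Hcx : forall t, 0 < t < z0 -> cx t = b1 + c t * e1.
Hypothesis Hcy : forall t, 0 < t < z0 -> cy t = b2 + c t * e2.
Hypothesis Hrinc : forall s t, 0 < s -> s < t -> t < z0 -> r s < r t.
Hypothesis Hcinc : forall s t, 0 < s -> s < t -> t < z0 -> c s < c t.
Hypothesis Hlines : forall p, line o d p <->
  (pz p = z0 /\ e1 * (px p - b1) + e2 * (py p - b2) = 0).

(** For [e = (cos a, sin a)] these are [- sin (2 a)] and [cos (2 a)]: horizontally the half-turn is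
    the reflection in the line orthogonal to [e]. The translation [ht] fixes the point
    [(b1, b2, z0)]. *)
Let hc := - 2 * e1 * e2.
Let hd := e1 * e1 - e2 * e2.
Let ht : R3 := (b1 + hd * b1 - hc * b2, b2 - hc * b1 - hd * b2, 2 * z0).
Hypothesis Hturn : forall p, half_turn o d p = aff hc hd (-1) ht p.

Variable F : R -> R -> R -> R.
Hypothesis HF : forall p, 0 < pz p < 2 * z0 ->
  (doubled M o d p <-> F (px p - b1) (py p - b2) (pz p) = 0).
Hypothesis HFc : forall p, 0 < pz p < 2 * z0 ->
  continuous (fun p : R3 => F (px p - b1) (py p - b2) (pz p)) p.
Hypothesis HFfar : forall de, 0 < de < z0 -> exists R, forall x y, R < sqrt (x * x + y * y) ->
  exists z, z0 - de <= z <= z0 + de /\ F x y z = 0.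
Hypothesis Hline_max : forall p, pz p = z0 -> doubled M o d p -> maximal_at (doubled M o d) p.

Let turn := half_turn o d.
Let w := period P o d.
Let D := doubled M o d.
Let S := periodic_surface M P o d.
Let shift (n : Z) : R3 := scal (IZR n) w.

Let Hhcd : hc * hc + hd * hd = 1.
Proof.
unfold hc, hd. transitivity ((e1 * e1 + e2 * e2) * (e1 * e1 + e2 * e2)); [ring | rewrite He; ring].
Qed.

Let pz_turn p : pz (turn p) = 2 * z0 - pz p.
Proof. unfold turn. rewrite Hturn, pz_aff. unfold ht; autorewrite with r3. ring. Qed.

Let px_turn p : px (turn p) = b1 - hd * (px p - b1) + hc * (py p - b2).
Proof. unfold turn. rewrite Hturn. unfold aff, lin, ht; autorewrite with r3. ring. Qed.

Let py_turn p : py (turn p) = b2 + hc * (px p - b1) + hd * (py p - b2).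
Proof. unfold turn. rewrite Hturn. unfold aff, lin, ht; autorewrite with r3. ring. Qed.

Let turnK p : turn (turn p) = p.
Proof.
apply R3_eq; rewrite ?px_turn, ?py_turn, ?pz_turn, ?px_turn, ?py_turn.
- transitivity (b1 + (hc * hc + hd * hd) * (px p - b1)); [ring | rewrite Hhcd; ring].
- transitivity (b2 + (hc * hc + hd * hd) * (py p - b2)); [ring | rewrite Hhcd; ring].
- ring.
Qed.

Let turn_centre s t : turn (b1 + s * e1, b2 + s * e2, t) = (b1 - s * e1, b2 - s * e2, 2 * z0 - t).
Proof.
apply R3_eq; rewrite ?px_turn, ?py_turn, ?pz_turn; autorewrite with r3; unfold hc, hd.
- transitivity (b1 - s * e1 * (e1 * e1 + e2 * e2)); [ring | rewrite He; ring].
- transitivity (b2 - s * e2 * (e1 * e1 + e2 * e2)); [ring | rewrite He; ring].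
- ring.
Qed.

Let near0 (e : R) : 0 < e -> at_right 0 (fun h => 0 < h < e).
Proof.
intros H. exists (mkposreal e H). intros y Hy Hy0. change (Rabs (y - 0) < e) in Hy.
destruct (Rabs_def2 _ _ Hy). lra.
Qed.

Let lim_r : filterlim r (at_right 0) (locally 0).
Proof.
destruct Hcone as [H _]. revert H. rewrite HP. apply filterlim_ext.
intros h. f_equal. ring.
Qed.

Let lim_cx : filterlim cx (at_right 0) (locally (px P)).
Proof.
destruct Hcone as [_ [H _]]. revert H. rewrite HP. apply filterlim_ext.
intros h. f_equal. ring.
Qed.

Let lim_cy : filterlim cy (at_right 0) (locally (py P)).
Proof.
destruct Hcone as [_ [_ [H _]]]. revert H. rewrite HP. apply filterlim_ext.
intros h. f_equal. ring.
Qed.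

Let cP := e1 * (px P - b1) + e2 * (py P - b2).

Let c_close eps : 0 < eps -> exists e, 0 < e <= z0 /\ forall t, 0 < t < e ->
  Rabs (cx t - px P) < eps /\ Rabs (cy t - py P) < eps.
Proof.
intros Heps.
assert (H1 := proj1 (filterlim_locally _ _) lim_cx (mkposreal eps Heps)).
assert (H2 := proj1 (filterlim_locally _ _) lim_cy (mkposreal eps Heps)).
destruct (filter_and _ _ H1 H2) as [e H].
exists (Rmin e z0). split; [split; [apply Rmin_pos; [apply cond_pos | exact Hz0] | apply Rmin_r] |].
intros t Ht. assert (L := Rmin_l e z0).
apply (H t); [| lra]. change (Rabs (t - 0) < e). apply Rabs_def1; lra.
Qed.

Let e_bounded u v eps : Rabs u < eps -> Rabs v < eps -> Rabs (e1 * u + e2 * v) < 2 * eps.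
Proof.
intros Hu Hv.
assert (A1 := Rabs_le_1 e1 ltac:(nra)). assert (A2 := Rabs_le_1 e2 ltac:(nra)).
eapply Rle_lt_trans; [apply Rabs_triang |]. rewrite !Rabs_mult.
assert (B1 := Rabs_pos e1). assert (B2 := Rabs_pos e2).
assert (C1 := Rabs_pos u). assert (C2 := Rabs_pos v).
assert (Rabs e1 * Rabs u <= 1 * Rabs u) by (apply Rmult_le_compat_r; lra).
assert (Rabs e2 * Rabs v <= 1 * Rabs v) by (apply Rmult_le_compat_r; lra).
lra.
Qed.

(** The centres lie on a fixed horizontal line of the frame and converge to the horizontal position
    of [P], which is therefore on it. *)
Let P_frame : px P = b1 + cP * e1 /\ py P = b2 + cP * e2.
Proof.
assert (Q : - e2 * (px P - b1) + e1 * (py P - b2) = 0).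
{ apply NNPP. intros N. apply Rabs_pos_lt in N.
  set (m := Rabs _) in N. destruct (c_close (m / 3)) as (e & He0 & H); [lra |].
  destruct (H (e / 2)) as [H1 H2]; [lra |].
  assert (Ht : 0 < e / 2 < z0) by lra. rewrite Hcx in H1 by exact Ht. rewrite Hcy in H2 by exact Ht.
  assert (B : Rabs (e1 * (b2 + c (e / 2) * e2 - py P) + e2 * - (b1 + c (e / 2) * e1 - px P)) < 2 * (m / 3))
    by (apply e_bounded; [exact H2 | now rewrite Rabs_Ropp]).
  replace (e1 * (b2 + c (e / 2) * e2 - py P) + e2 * - (b1 + c (e / 2) * e1 - px P))
    with (- (- e2 * (px P - b1) + e1 * (py P - b2))) in B by ring.
  rewrite Rabs_Ropp in B. fold m in B. lra. }
unfold cP. split.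
- transitivity (b1 + (px P - b1) * (e1 * e1 + e2 * e2)); [rewrite He; ring |].
  transitivity (b1 + (e1 * (px P - b1) + e2 * (py P - b2)) * e1
    - e2 * (- e2 * (px P - b1) + e1 * (py P - b2)) - 0); [ring | rewrite Q; ring].
- transitivity (b2 + (py P - b2) * (e1 * e1 + e2 * e2)); [rewrite He; ring |].
  transitivity (b2 + (e1 * (px P - b1) + e2 * (py P - b2)) * e2
    + e1 * (- e2 * (px P - b1) + e1 * (py P - b2)) - 0); [ring | rewrite Q; ring].
Qed.

Let c_lower t : 0 < t < z0 -> cP <= c t.
Proof.
intros Ht. apply Rnot_lt_le. intros L.
destruct (c_close ((cP - c t) / 2)) as (e & He0 & H); [lra |].
set (s := Rmin (e / 2) (t / 2)).
assert (S1 := Rmin_l (e / 2) (t / 2)). assert (S2 := Rmin_r (e / 2) (t / 2)).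
assert (Hs : 0 < s) by (apply Rmin_pos; lra). fold s in S1, S2.
destruct (H s) as [H1 H2]; [lra |].
assert (Hs' : 0 < s < z0) by lra. rewrite Hcx in H1 by exact Hs'. rewrite Hcy in H2 by exact Hs'.
assert (B := e_bounded _ _ _ H1 H2).
replace (e1 * (b1 + c s * e1 - px P) + e2 * (b2 + c s * e2 - py P)) with (c s * (e1 * e1 + e2 * e2) - cP) in B
  by (unfold cP; ring).
rewrite He in B. destruct (Rabs_def2 _ _ B). assert (c s < c t) by (apply Hcinc; lra). lra.
Qed.

Let pz_w : pz w = 2 * z0.
Proof. unfold w, period. autorewrite with r3. fold turn. rewrite pz_turn, HP. ring. Qed.

Let turn_P : turn P = (b1 - cP * e1, b2 - cP * e2, 2 * z0).
Proof.
destruct P_frame as [E1 E2].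
replace P with ((b1 + cP * e1, b2 + cP * e2, 0) : R3)
  by (apply R3_eq; autorewrite with r3; congruence).
rewrite turn_centre. f_equal. ring.
Qed.

Let px_w : px w = 2 * b1 - 2 * px P.
Proof.
unfold w, period. autorewrite with r3. fold turn. rewrite turn_P; autorewrite with r3.
destruct P_frame as [E1 _]. rewrite E1. ring.
Qed.

Let py_w : py w = 2 * b2 - 2 * py P.
Proof.
unfold w, period. autorewrite with r3. fold turn. rewrite turn_P; autorewrite with r3.
destruct P_frame as [_ E1]. rewrite E1. ring.
Qed.

Let pz_shift n p : pz (plus p (shift n)) = pz p + IZR n * (2 * z0).
Proof. unfold shift. autorewrite with r3. now rewrite pz_w. Qed.

Let shift_minus n p : plus (minus p (shift n)) (shift n) = p.
Proof. apply R3_eq; autorewrite with r3; ring. Qed.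

Let minus_shift n p : minus (plus p (shift n)) (shift n) = p.
Proof. apply R3_eq; autorewrite with r3; ring. Qed.

(* The half-turn about the n-th line, carrying M onto the piece of S above that line. *)
Let flip n p := plus (turn p) (shift n).

Let flip_aff n p : flip n p = aff hc hd (-1) (plus ht (shift n)) p.
Proof. unfold flip, turn. rewrite Hturn. apply R3_eq; unfold aff; autorewrite with r3; ring. Qed.

Let D_height p : D p -> 0 < pz p < 2 * z0.
Proof.
intros [H | H]; apply HMz in H; [lra |]. fold turn in H. rewrite pz_turn in H. lra.
Qed.

(** Only the height [z0] is shared by the two copies, and there the half-turn maps the line to
    itself. *)
Let D_low p : pz p <= z0 -> (D p <-> M p).
Proof.
intros Hp. split; [| now left]. intros [H | H]; [exact H |].
assert (H' := HMz _ H). fold turn in H, H'. rewrite pz_turn in H'.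
assert (Ez : pz p = z0) by lra.
assert (Ez' : pz (turn p) = z0) by (rewrite pz_turn; lra).
apply HMl; [exact Ez |]. apply HMl in H; [| exact Ez'].
apply Hlines. apply Hlines in H. destruct H as [_ H]. split; [exact Ez |].
rewrite px_turn, py_turn in H. unfold hc, hd in H.
transitivity (- (e1 * (b1 - (e1 * e1 - e2 * e2) * (px p - b1) + - 2 * e1 * e2 * (py p - b2) - b1)
  + e2 * (b2 + - 2 * e1 * e2 * (px p - b1) + (e1 * e1 - e2 * e2) * (py p - b2) - b2))); [| lra].
transitivity ((e1 * (px p - b1) + e2 * (py p - b2)) * (e1 * e1 + e2 * e2)); [rewrite He; ring | ring].
Qed.

Let D_turn p : D (turn p) <-> D p.
Proof. unfold D, doubled. fold turn. rewrite turnK. tauto. Qed.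

Let index_unique m n : - (2 * z0) < IZR m * (2 * z0) - IZR n * (2 * z0) < 2 * z0 -> m = n.
Proof.
intros H.
assert (L1 : IZR (m - n) < 1) by (rewrite minus_IZR; apply Rmult_lt_reg_r with (2 * z0); lra).
assert (L2 : -1 < IZR (m - n)) by (rewrite minus_IZR; apply Rmult_lt_reg_r with (2 * z0); lra).
apply lt_IZR in L1. apply lt_IZR in L2. lia.
Qed.

(** The doubled piece has heights strictly between 0 and [2 z0], so its translates occupy disjoint
    slabs and the slab determines the index. *)
Let S_slab n p : 0 < pz p < 2 * z0 -> (S (plus p (shift n)) <-> D p).
Proof.
intros Hp. split.
- intros [m H]. change (D (minus (plus p (shift n)) (shift m))) in H.
  assert (H' := D_height _ H). rewrite pz_minus, pz_shift in H'.
  replace (pz (shift m)) with (IZR m * (2 * z0)) in H' by (unfold shift; now rewrite pz_scal, pz_w).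
  assert (E : n = m) by (apply index_unique; lra).
  subst m. now rewrite minus_shift in H.
- intros H. exists n. unfold translate. fold w (shift n). now rewrite minus_shift.
Qed.

Let height n p : pz p = IZR n * (2 * z0) + pz (minus p (shift n)).
Proof. unfold shift; autorewrite with r3. rewrite pz_w. ring. Qed.

Let floor_ex t : exists n, IZR n * (2 * z0) <= t < IZR n * (2 * z0) + 2 * z0.
Proof.
exists (up (t / (2 * z0)) - 1)%Z. destruct (archimed (t / (2 * z0))) as [A1 A2].
set (x := IZR (up (t / (2 * z0)))) in *.
rewrite minus_IZR. fold x.
assert (E : t / (2 * z0) * (2 * z0) = t) by (field; lra).
assert (t / (2 * z0) * (2 * z0) < x * (2 * z0)) by (apply Rmult_lt_compat_r; lra).
assert ((x - 1) * (2 * z0) <= t / (2 * z0) * (2 * z0)) by (apply Rmult_le_compat_r; lra).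
lra.
Qed.

Let floor_ind (Q : R3 -> Prop) :
  (forall n p, 0 <= pz p < 2 * z0 -> Q (plus p (shift n))) -> forall p, Q p.
Proof.
intros H p. destruct (floor_ex (pz p)) as [n Hn].
rewrite <- (shift_minus n p). apply H. rewrite (height n p) in Hn. lra.
Qed.

Let S_edge n p : pz p = IZR n * (2 * z0) -> ~ S p.
Proof.
intros Hp [m H]. assert (H' : 0 < pz (minus p (shift m)) < 2 * z0) by exact (D_height _ H).
rewrite (height m p) in Hp.
assert (E : n = m) by (apply index_unique; lra). subst m. lra.
Qed.

Let S_low n p : 0 < pz p < z0 -> (S (plus p (shift n)) <-> M p).
Proof. intros Hp. rewrite S_slab by lra. apply D_low; lra. Qed.

Let S_high n p : 0 < pz p < z0 -> (S (flip n p) <-> M p).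
Proof.
intros Hp. unfold flip. rewrite S_slab by (rewrite pz_turn; lra).
rewrite D_turn. apply D_low; lra.
Qed.

Let S_shift p : S (plus p w) <-> S p.
Proof.
unfold S, periodic_surface, translate. fold w. split; intros [n H].
- exists (n - 1)%Z.
  replace (minus p (scal (IZR (n - 1)) w)) with (minus (plus p w) (scal (IZR n) w)); [exact H |].
  apply R3_eq; autorewrite with r3; rewrite minus_IZR; ring.
- exists (n + 1)%Z.
  replace (minus (plus p w) (scal (IZR (n + 1)) w)) with (minus p (scal (IZR n) w)); [exact H |].
  apply R3_eq; autorewrite with r3; rewrite plus_IZR; ring.
Qed.

Let S_maximal_low n p : M p -> 0 < pz p < z0 -> maximal_at S (plus p (shift n)).
Proof.
intros Mp Hp. rewrite <- affT.
apply (maximal_at_aff 0 1 1 (shift n) (part M 0 z0) S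
  (fun q => IZR n * (2 * z0) < pz q < IZR n * (2 * z0) + z0)); try ring.
- apply open_pz_interval.
- rewrite affT, pz_shift. lra.
- intros q Hq. rewrite affT in *. rewrite pz_shift in Hq. rewrite S_low by lra.
  unfold part. split; [intros H; split; [exact H | lra] | tauto].
- apply Hmax. now split.
Qed.

Let S_maximal_high n p : M p -> 0 < pz p < z0 -> maximal_at S (flip n p).
Proof.
intros Mp Hp. rewrite flip_aff.
apply (maximal_at_aff hc hd (-1) (plus ht (shift n)) (part M 0 z0) S
  (fun q => IZR n * (2 * z0) + z0 < pz q < IZR n * (2 * z0) + 2 * z0)); [exact Hhcd | ring | | | |].
- apply open_pz_interval.
- rewrite <- flip_aff. unfold flip. rewrite pz_shift, pz_turn. lra.
- intros q Hq. rewrite <- flip_aff in *. unfold flip in Hq. rewrite pz_shift, pz_turn in Hq.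
  rewrite S_high by lra.
  unfold part. split; [intros H; split; [exact H | lra] | tauto].
- apply Hmax. now split.
Qed.

Let S_maximal_line n p : M p -> pz p = z0 -> maximal_at S (plus p (shift n)).
Proof.
intros Mp Hp. rewrite <- affT.
apply (maximal_at_aff 0 1 1 (shift n) D S
  (fun q => IZR n * (2 * z0) < pz q < IZR n * (2 * z0) + 2 * z0)); try ring.
- apply open_pz_interval.
- rewrite affT, pz_shift. lra.
- intros q Hq. rewrite affT in *. rewrite pz_shift in Hq. apply S_slab. lra.
- apply Hline_max; [exact Hp | now left].
Qed.

Lemma periodic_maximal : maximal_surface S.
Proof.
intros p. pattern p. apply floor_ind. clear p. intros n p Hp HS.
change (maximal_at S (plus p (shift n))).
destruct (Req_dec (pz p) 0) as [E | E].
- exfalso. apply (S_edge n _) in HS; [exact HS |]. rewrite pz_shift, E. ring.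
- apply S_slab in HS; [| lra].
  destruct (Rtotal_order (pz p) z0) as [L | [L | L]].
  + apply S_maximal_low; [apply D_low; [lra | exact HS] | lra].
  + apply S_maximal_line; [apply D_low; [lra | exact HS] | lra].
  + replace (plus p (shift n)) with (flip n (turn p)) by (unfold flip; now rewrite turnK).
    assert (Hz : 0 < pz (turn p) < z0) by (rewrite pz_turn; lra).
    apply S_maximal_high; [| exact Hz]. apply D_low; [lra |]. now apply D_turn.
Qed.

Lemma doubled_maximal : maximal_surface D.
Proof.
intros p Dp. assert (Hp := D_height p Dp).
(* The zeroth translation is the identity, so the transport lemma localises maximality from [S] to
   [D], which agree in the slab. *)
assert (E0 : forall q, aff 0 1 1 (shift 0) q = q)
  by (intros q; rewrite affT; apply R3_eq; unfold shift; autorewrite with r3; ring).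
assert (ES : forall q, 0 < pz q < 2 * z0 -> (D q <-> S q)).
{ intros q Hq. rewrite <- (S_slab 0 q Hq), <- affT, E0. tauto. }
change (maximal_at D p). rewrite <- (E0 p).
apply (maximal_at_aff 0 1 1 (shift 0) S D (fun q => 0 < pz q < 2 * z0)); try ring.
- apply open_pz_interval.
- now rewrite E0.
- intros q. rewrite E0. apply ES.
- apply periodic_maximal. now apply ES.
Qed.

(** The floor of [t / (2 z0)]: [up] is the least integer strictly above its argument, hence the
    subtraction of 1. *)
Let idx t : Z := (up (t / (2 * z0)) - 1)%Z.

Let idx_spec n u : 0 <= u < 2 * z0 -> idx (IZR n * (2 * z0) + u) = n.
Proof.
intros Hu. unfold idx.
rewrite <- (tech_up ((IZR n * (2 * z0) + u) / (2 * z0)) (n + 1)); [lia | |].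
- rewrite plus_IZR. apply Rmult_lt_reg_r with (2 * z0); [lra |].
  unfold Rdiv; rewrite Rmult_assoc, Rinv_l, Rmult_1_r; lra.
- rewrite plus_IZR. apply Rmult_le_reg_r with (2 * z0); [lra |].
  replace (((IZR n * (2 * z0) + u) / (2 * z0) + 1) * (2 * z0))
    with (IZR n * (2 * z0) + u + 2 * z0) by (field; lra). lra.
Qed.

Definition fold_height t := t - IZR (idx t) * (2 * z0).

Definition per_radius t :=
  let u := fold_height t in if Rlt_dec u z0 then r u else r (2 * z0 - u).

(** In the upper half of a slab the half-turn reflects the centre in the point [b] of the line; [v]
    is the corresponding horizontal coordinate of the period. *)
Definition per_centre (f : R -> R) (b v : R) t :=
  let u := fold_height t in
  (if Rlt_dec u z0 then f u else 2 * b - f (2 * z0 - u)) + IZR (idx t) * v.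

Let Cx := per_centre cx b1 (px w).
Let Cy := per_centre cy b2 (py w).
Let Rad := per_radius.

Let fold_spec n u : 0 <= u < 2 * z0 -> fold_height (IZR n * (2 * z0) + u) = u.
Proof. intros Hu. unfold fold_height. rewrite idx_spec by exact Hu. ring. Qed.

Let radius_low n u : 0 <= u < z0 -> Rad (IZR n * (2 * z0) + u) = r u.
Proof.
intros Hu. unfold Rad, per_radius. rewrite fold_spec by lra. destruct (Rlt_dec u z0); [reflexivity | lra].
Qed.

Let radius_high n u : z0 <= u < 2 * z0 -> Rad (IZR n * (2 * z0) + u) = r (2 * z0 - u).
Proof.
intros Hu. unfold Rad, per_radius. rewrite fold_spec by lra. destruct (Rlt_dec u z0); [lra | reflexivity].
Qed.

Let centre_low f b v n u : 0 <= u < z0 ->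
  per_centre f b v (IZR n * (2 * z0) + u) = f u + IZR n * v.
Proof.
intros Hu. unfold per_centre. rewrite fold_spec, idx_spec by lra.
destruct (Rlt_dec u z0); [reflexivity | lra].
Qed.

Let centre_high f b v n u : z0 <= u < 2 * z0 ->
  per_centre f b v (IZR n * (2 * z0) + u) = 2 * b - f (2 * z0 - u) + IZR n * v.
Proof.
intros Hu. unfold per_centre. rewrite fold_spec, idx_spec by lra.
destruct (Rlt_dec u z0); [lra | reflexivity].
Qed.

Let M_circle p : 0 < pz p < z0 ->
  (M p <-> (px p - cx (pz p)) * (px p - cx (pz p)) + (py p - cy (pz p)) * (py p - cy (pz p))
           = r (pz p) * r (pz p)).
Proof.
apply (slice_circle M z0 cx cy r P o d Hfol); [| exact HP | exact Hbd].
intros q Hq. now apply Hlines in Hq.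
Qed.

Let S_circle_low n p : IZR n * (2 * z0) < pz p < IZR n * (2 * z0) + z0 ->
  (S p <-> (px p - Cx (pz p)) * (px p - Cx (pz p)) + (py p - Cy (pz p)) * (py p - Cy (pz p))
           = Rad (pz p) * Rad (pz p)).
Proof.
rewrite <- (shift_minus n p). set (q := minus p (shift n)). rewrite pz_shift. intros Hq.
rewrite S_low, M_circle by lra.
rewrite (Rplus_comm (pz q)), radius_low by lra. unfold Cx, Cy. rewrite !centre_low by lra.
replace (px (plus q (shift n)) - (cx (pz q) + IZR n * px w)) with (px q - cx (pz q))
  by (unfold shift; autorewrite with r3; ring).
replace (py (plus q (shift n)) - (cy (pz q) + IZR n * py w)) with (py q - cy (pz q))
  by (unfold shift; autorewrite with r3; ring).
tauto.
Qed.

Let S_circle_high n p : IZR n * (2 * z0) + z0 < pz p < IZR n * (2 * z0) + 2 * z0 ->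
  (S p <-> (px p - Cx (pz p)) * (px p - Cx (pz p)) + (py p - Cy (pz p)) * (py p - Cy (pz p))
           = Rad (pz p) * Rad (pz p)).
Proof.
set (q := turn (minus p (shift n))).
assert (Ep : p = flip n q) by (unfold flip, q; now rewrite turnK, shift_minus).
clearbody q. subst p.
assert (Ez : pz (flip n q) = IZR n * (2 * z0) + (2 * z0 - pz q))
  by (unfold flip; rewrite pz_shift, pz_turn; ring).
rewrite Ez. intros Hq.
assert (Hq' : 0 < pz q < z0) by lra.
rewrite S_high, M_circle by lra.
rewrite radius_high by lra. unfold Cx, Cy. rewrite !centre_high by lra.
replace (2 * z0 - (2 * z0 - pz q)) with (pz q) by ring.
rewrite Hcx, Hcy by exact Hq'.
set (x := px q - (b1 + c (pz q) * e1)). set (y := py q - (b2 + c (pz q) * e2)).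
(* Relative to the centre of the turned circle, the turned point has coordinates obtained by an
   orthogonal matrix from those of [q] relative to the original centre. *)
replace (px (flip n q) - (2 * b1 - (b1 + c (pz q) * e1) + IZR n * px w)) with (- hd * x + hc * y).
2: { unfold flip, shift; autorewrite with r3. rewrite px_turn. unfold x, y, hc, hd.
     transitivity (- (e1 * e1 - e2 * e2) * (px q - b1) + - 2 * e1 * e2 * (py q - b2)
       + c (pz q) * e1 * (e1 * e1 + e2 * e2)); [ring | rewrite He; ring]. }
replace (py (flip n q) - (2 * b2 - (b2 + c (pz q) * e2) + IZR n * py w)) with (hc * x + hd * y).
2: { unfold flip, shift; autorewrite with r3. rewrite py_turn. unfold x, y, hc, hd.
     transitivity (- 2 * e1 * e2 * (px q - b1) + (e1 * e1 - e2 * e2) * (py q - b2)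
       + c (pz q) * e2 * (e1 * e1 + e2 * e2)); [ring | rewrite He; ring]. }
replace ((- hd * x + hc * y) * (- hd * x + hc * y) + (hc * x + hd * y) * (hc * x + hd * y))
  with (x * x + y * y); [tauto |].
transitivity ((x * x + y * y) * (hc * hc + hd * hd)); [rewrite Hhcd; ring | ring].
Qed.

Lemma periodic_foliation n :
  foliated_by_circles S (IZR n * z0) (IZR (n + 1) * z0) Cx Cy Rad.
Proof.
destruct Hfol as (Sx & Sy & Sr & Hf).
destruct (Z.Even_or_Odd n) as [[m ->] | [m ->]].
- replace (IZR (2 * m + 1) * z0) with (IZR m * (2 * z0) + z0) by (rewrite plus_IZR, mult_IZR; ring).
  replace (IZR (2 * m) * z0) with (IZR m * (2 * z0)) by (rewrite mult_IZR; ring).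
  assert (Hu : forall t, IZR m * (2 * z0) < t < IZR m * (2 * z0) + z0 ->
    t = IZR m * (2 * z0) + (1 * t + - (IZR m * (2 * z0))) /\ 0 < 1 * t + - (IZR m * (2 * z0)) < z0)
    by (intros t Ht; split; lra).
  apply foliated_of_circles; [| | | | apply S_circle_low].
  + apply (smooth_on_affine cx _ 0 z0 _ _ (IZR m * px w) 1 1 (- (IZR m * (2 * z0))) Sx);
      intros t Ht; destruct (Hu t Ht) as [E U]; [exact U |].
    rewrite E at 1. unfold Cx. rewrite centre_low by lra. ring.
  + apply (smooth_on_affine cy _ 0 z0 _ _ (IZR m * py w) 1 1 (- (IZR m * (2 * z0))) Sy);
      intros t Ht; destruct (Hu t Ht) as [E U]; [exact U |].
    rewrite E at 1. unfold Cy. rewrite centre_low by lra. ring.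
  + apply (smooth_on_affine r _ 0 z0 _ _ 0 1 1 (- (IZR m * (2 * z0))) Sr);
      intros t Ht; destruct (Hu t Ht) as [E U]; [exact U |].
    rewrite E at 1. rewrite radius_low by lra. ring.
  + intros t Ht. destruct (Hu t Ht) as [E U]. rewrite E, radius_low by lra. now apply Hf.
- replace (IZR (2 * m + 1) * z0) with (IZR m * (2 * z0) + z0) by (rewrite plus_IZR, mult_IZR; ring).
  replace (IZR (2 * m + 1 + 1) * z0) with (IZR m * (2 * z0) + 2 * z0)
    by (rewrite !plus_IZR, mult_IZR; ring).
  assert (Hu : forall t, IZR m * (2 * z0) + z0 < t < IZR m * (2 * z0) + 2 * z0 ->
    t = IZR m * (2 * z0) + (2 * z0 - (-1 * t + (IZR m * (2 * z0) + 2 * z0)))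
    /\ 0 < -1 * t + (IZR m * (2 * z0) + 2 * z0) < z0)
    by (intros t Ht; split; lra).
  assert (Hs : forall u, 2 * z0 - (2 * z0 - u) = u) by (intros u; ring).
  apply foliated_of_circles; [| | | | apply S_circle_high].
  + apply (smooth_on_affine cx _ 0 z0 _ _ (2 * b1 + IZR m * px w) (-1) (-1)
      (IZR m * (2 * z0) + 2 * z0) Sx); intros t Ht; destruct (Hu t Ht) as [E U]; [exact U |].
    rewrite E at 1. unfold Cx. rewrite centre_high, Hs by lra. ring.
  + apply (smooth_on_affine cy _ 0 z0 _ _ (2 * b2 + IZR m * py w) (-1) (-1)
      (IZR m * (2 * z0) + 2 * z0) Sy); intros t Ht; destruct (Hu t Ht) as [E U]; [exact U |].
    rewrite E at 1. unfold Cy. rewrite centre_high, Hs by lra. ring.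
  + apply (smooth_on_affine r _ 0 z0 _ _ 0 1 (-1)
      (IZR m * (2 * z0) + 2 * z0) Sr); intros t Ht; destruct (Hu t Ht) as [E U]; [exact U |].
    rewrite E at 1. rewrite radius_high, Hs by lra. ring.
  + intros t Ht. destruct (Hu t Ht) as [E U]. rewrite E, radius_high, Hs by lra. now apply Hf.
Qed.

Lemma periodic_lines n p : pz p = IZR (2 * n + 1) * z0 -> (S p <-> translate n w (line o d) p).
Proof.
intros Hp. unfold translate. fold (shift n).
assert (Hq : pz (minus p (shift n)) = z0).
{ rewrite (height n p) in Hp. rewrite plus_IZR, mult_IZR in Hp. lra. }
rewrite <- (shift_minus n p) at 1. rewrite S_slab, D_low by lra. now apply HMl.
Qed.

Lemma translated_line_height n p : translate n w (line o d) p -> pz p = IZR (2 * n + 1) * z0.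
Proof.
unfold translate. fold (shift n). intros H. apply Hlines in H. destruct H as [H _].
rewrite (height n p), H, plus_IZR, mult_IZR. ring.
Qed.

(** * The boundary of the periodic surface *)

Let adherent_P : adherent (part M 0 z0) P.
Proof. apply (proj2 (Hbd P)). now left. Qed.

Let adherent_bottom p : pz p = 0 -> adherent (part M 0 z0) p -> p = P.
Proof.
intros Hp Ha. assert (B : boundary (part M 0 z0) p) by (split; [exact Ha | intros [_ H]; lra]).
apply Hbd in B. destruct B as [B | B]; [exact B |]. apply Hlines in B. lra.
Qed.

Let flip_P n : flip n P = plus P (shift (n + 1)).
Proof.
unfold flip, shift. replace (turn P) with (plus P w).
- apply R3_eq; autorewrite with r3; rewrite plus_IZR; ring.
- unfold w, period. fold turn. apply R3_eq; autorewrite with r3; ring.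
Qed.

(** Approach from above or from below is carried, by a translation or by a translation and a
    half-turn, to the bottom of [M], whose closure meets that plane only at [P]. *)
Let boundary_edge n p : pz p = IZR n * (2 * z0) -> adherent S p -> p = plus P (shift n).
Proof.
intros Hp Ha.
assert (Ha' : adherent (fun q =>
    (IZR n * (2 * z0) < pz q < IZR n * (2 * z0) + z0 /\ S q) \/
    (IZR n * (2 * z0) - z0 < pz q < IZR n * (2 * z0) /\ S q)) p).
{ apply (adherent_local S _ (fun q => IZR n * (2 * z0) - z0 < pz q < IZR n * (2 * z0) + z0));
    [apply open_pz_interval | lra | | exact Ha].
  intros q Hq Sq. destruct (Rtotal_order (pz q) (IZR n * (2 * z0))) as [L | [L | L]].
  - right. split; [lra | exact Sq].
  - exfalso. exact (S_edge n q L Sq).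
  - left. split; [lra | exact Sq]. }
apply adherent_or in Ha'. destruct Ha' as [A | A].
- rewrite <- (shift_minus n p). f_equal. apply adherent_bottom; [rewrite (height n p) in Hp; lra |].
  replace (minus p (shift n)) with (aff 0 1 1 (opp (shift n)) p) by (rewrite affT; reflexivity).
  revert A. apply adherent_aff. intros q [Hq Sq]. rewrite affT.
  change (plus q (opp (shift n))) with (minus q (shift n)).
  rewrite (height n q) in Hq. split; [| lra].
  rewrite <- (shift_minus n q) in Sq. now apply S_low in Sq; [| lra].
(* From below, the nearby points belong to the upper half of the preceding slab, so the index drops
   by one before turning. *)
- assert (E : turn (minus p (shift (n - 1))) = P).
  { apply adherent_bottom.
    - rewrite pz_turn. rewrite (height (n - 1) p), minus_IZR in Hp. lra.
    - unfold turn. rewrite Hturn.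
      replace (minus p (shift (n - 1))) with (aff 0 1 1 (opp (shift (n - 1))) p)
        by (rewrite affT; reflexivity).
      apply (adherent_aff hc hd (-1) ht (fun q => pz q < 2 * z0 /\ z0 < pz q /\ D q)).
      + intros q (H1 & H2 & H3). rewrite <- Hturn. fold turn.
        assert (Hz : 0 < pz (turn q) < z0) by (rewrite pz_turn; lra).
        split; [| exact Hz]. apply D_low; [lra | now apply D_turn].
      + revert A. apply adherent_aff. intros q [Hq Sq]. rewrite affT.
        change (plus q (opp (shift (n - 1)))) with (minus q (shift (n - 1))).
        rewrite (height (n - 1) q), minus_IZR in Hq. split; [lra | split; [lra |]].
        rewrite <- (shift_minus (n - 1) q) in Sq. now apply S_slab in Sq; [| lra]. }
  rewrite <- (shift_minus (n - 1) p), <- (turnK (minus p (shift (n - 1)))), E.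
  change (flip (n - 1) P = plus P (shift n)). rewrite flip_P. do 2 f_equal. lia.
Qed.

Lemma cone_points_boundary n : boundary S (plus P (shift n)).
Proof.
split.
- rewrite <- affT. apply (adherent_aff 0 1 1 (shift n) (part M 0 z0)); [| exact adherent_P].
  intros q [Mq Hq]. rewrite affT. now apply S_low.
- apply (S_edge n). rewrite pz_shift, HP. ring.
Qed.

(* Between two planes of cone points S is the zero set of a continuous function, so it is closed
   there. *)
Lemma periodic_boundary p : boundary S p <-> exists n, p = plus P (shift n).
Proof.
split; [| intros [n ->]; apply cone_points_boundary].
pattern p. apply floor_ind. clear p. intros n p Hp [Ha HS].
destruct (Req_dec (pz p) 0) as [E | E].
- exists n. apply boundary_edge; [rewrite pz_shift, E; ring | exact Ha].
- exfalso. apply HS. apply S_slab; [lra |]. apply HF; [lra |].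
  apply (adherent_closed (fun p : R3 => F (px p - b1) (py p - b2) (pz p)) D).
  + apply HFc. lra.
  + intros q Dq. apply HF; [now apply D_height | exact Dq].
  + rewrite <- (minus_shift n p) .
    replace (minus (plus p (shift n)) (shift n)) with (aff 0 1 1 (opp (shift n)) (plus p (shift n)))
      by (rewrite affT; reflexivity).
    apply (adherent_aff 0 1 1 (opp (shift n))
      (fun q => IZR n * (2 * z0) < pz q < IZR n * (2 * z0) + 2 * z0 /\ S q)).
    * intros q [Hq Sq]. rewrite affT. change (plus q (opp (shift n))) with (minus q (shift n)).
      rewrite (height n q) in Hq. rewrite <- (shift_minus n q) in Sq.
      now apply S_slab in Sq; [| lra].
    * apply (adherent_local S _ (fun q => IZR n * (2 * z0) < pz q < IZR n * (2 * z0) + 2 * z0));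
        [apply open_pz_interval | rewrite pz_shift; lra | tauto | exact Ha].
Qed.

Lemma periodic_edge n p : pz p = IZR (2 * n) * z0 ->
  ~ S p /\ (boundary S p <-> p = plus P (shift n)).
Proof.
intros Hp. assert (Hp' : pz p = IZR n * (2 * z0)) by (rewrite Hp, mult_IZR; ring).
split; [now apply (S_edge n) |]. split; [intros [H _]; now apply boundary_edge |].
intros ->. apply cone_points_boundary.
Qed.

(** * Conelike points from both sides *)

Let lim_above (f g : R -> R) l a b n :
  filterlim f (at_right 0) (locally l) ->
  (forall u, 0 < u < z0 -> g (IZR n * (2 * z0) + u) = a * f u + b) ->
  filterlim (fun h => g (pz (plus P (shift n)) + 1 * h)) (at_right 0) (locally (a * l + b)).
Proof.
intros Hf Hg. apply (filterlim_ext_loc (fun u => a * f u + b)).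
- generalize (near0 z0 Hz0). apply filter_imp. intros u Hu. rewrite <- Hg by exact Hu.
  f_equal. rewrite pz_shift, HP. ring.
- now apply filterlim_affine; [apply at_right_proper_filter |].
Qed.

Let lim_below (f g : R -> R) l a b n :
  filterlim f (at_right 0) (locally l) ->
  (forall u, 0 < u < z0 -> g (IZR (n - 1) * (2 * z0) + (2 * z0 - u)) = a * f u + b) ->
  filterlim (fun h => g (pz (plus P (shift n)) + -1 * h)) (at_right 0) (locally (a * l + b)).
Proof.
intros Hf Hg. apply (filterlim_ext_loc (fun u => a * f u + b)).
- generalize (near0 z0 Hz0). apply filter_imp. intros u Hu. rewrite <- Hg by exact Hu.
  f_equal. rewrite pz_shift, HP, minus_IZR. ring.
- now apply filterlim_affine; [apply at_right_proper_filter |].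
Qed.

Let cone_M v : tangent_cone (fun p => M p /\ 0 < 1 * (pz p - pz P)) P v
  <-> (lprod v v = 0 /\ 0 <= 1 * pz v).
Proof. apply Hcone. Qed.

Lemma conelike_above n : conelike S Cx Cy Rad (plus P (shift n)) 1.
Proof.
split; [|split; [|split]].
- replace 0 with (1 * 0 + 0) at 2 by ring. apply (lim_above r); [exact lim_r |].
  intros u Hu. rewrite radius_low by lra. ring.
- replace (px (plus P (shift n))) with (1 * px P + IZR n * px w)
    by (unfold shift; autorewrite with r3; ring).
  apply (lim_above cx); [exact lim_cx |].
  intros u Hu. unfold Cx. rewrite centre_low by lra. ring.
- replace (py (plus P (shift n))) with (1 * py P + IZR n * py w)
    by (unfold shift; autorewrite with r3; ring).
  apply (lim_above cy); [exact lim_cy |].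
  intros u Hu. unfold Cy. rewrite centre_low by lra. ring.
- rewrite <- affT.
  apply (light_cone_aff 0 1 1 (shift n) (fun p => M p /\ 0 < 1 * (pz p - pz P)) _ P z0);
    [ring | ring | exact Hz0 | | exact cone_M].
  intros p Hp. rewrite !affT. destruct (Rabs_def2 _ _ Hp).
  replace (1 * (pz (plus p (shift n)) - pz (plus P (shift n)))) with (1 * (pz p - pz P))
    by (rewrite !pz_shift; ring).
  split; intros [H1 H2]; (split; [| exact H2]); (apply S_low in H1 || apply S_low); auto; lra.
Qed.

Lemma conelike_below n : conelike S Cx Cy Rad (plus P (shift n)) (-1).
Proof.
split; [|split; [|split]].
- replace 0 with (1 * 0 + 0) at 2 by ring. apply (lim_below r); [exact lim_r |].
  intros u Hu. rewrite radius_high by lra. replace (2 * z0 - (2 * z0 - u)) with u by ring. ring.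
- replace (px (plus P (shift n))) with (-1 * px P + (2 * b1 + IZR (n - 1) * px w))
    by (unfold shift; autorewrite with r3; rewrite minus_IZR, px_w; ring).
  apply (lim_below cx); [exact lim_cx |].
  intros u Hu. unfold Cx. rewrite centre_high by lra.
  replace (2 * z0 - (2 * z0 - u)) with u by ring. ring.
- replace (py (plus P (shift n))) with (-1 * py P + (2 * b2 + IZR (n - 1) * py w))
    by (unfold shift; autorewrite with r3; rewrite minus_IZR, py_w; ring).
  apply (lim_below cy); [exact lim_cy |].
  intros u Hu. unfold Cy. rewrite centre_high by lra.
  replace (2 * z0 - (2 * z0 - u)) with u by ring. ring.
(* Below the [n]-th conelike point the surface is the image of the bottom of [M] under the half-turn
   about the preceding line, which sends [P] to this point. *)
- assert (En : plus P (shift n) = aff hc hd (-1) (plus ht (shift (n - 1))) P)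
    by (rewrite <- flip_aff, flip_P; do 2 f_equal; lia).
  rewrite En.
  apply (light_cone_aff hc hd (-1) (plus ht (shift (n - 1))) (fun p => M p /\ 0 < 1 * (pz p - pz P)) _ P z0);
    [exact Hhcd | ring | exact Hz0 | | exact cone_M].
  intros p Hp. rewrite <- !flip_aff. destruct (Rabs_def2 _ _ Hp).
  replace (-1 * (pz (flip (n - 1) p) - pz (flip (n - 1) P))) with (1 * (pz p - pz P))
    by (unfold flip; rewrite !pz_shift, !pz_turn; ring).
  split; intros [H1 H2]; (split; [| exact H2]); (apply S_high in H1 || apply S_high); auto; lra.
Qed.

(** Heights of distinct members differ by at least [2 z0], so a ball of radius [z0 / 2] meets only
    one. *)
Let spread (A : Z -> R3 -> Prop) (a : R) :
  (forall n p, A n p -> pz p = IZR n * (2 * z0) + a) -> discrete_family A.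
Proof.
intros HA p. assert (Hh : 0 < z0 / 2) by lra. exists (mkposreal _ Hh).
intros m n (q & Aq & Bq) (q' & Aq' & Bq').
apply ball3 in Bq. apply ball3 in Bq'. cbn [pos] in *.
destruct Bq as (_ & _ & B). destruct Bq' as (_ & _ & B').
rewrite (HA _ _ Aq) in B. rewrite (HA _ _ Aq') in B'.
destruct (Rabs_def2 _ _ B). destruct (Rabs_def2 _ _ B').
apply index_unique. lra.
Qed.

Lemma lines_discrete : discrete_family (fun n => translate n w (line o d)).
Proof.
apply (spread _ z0). intros n p H. rewrite (translated_line_height n p H), plus_IZR, mult_IZR. ring.
Qed.

Lemma cone_points_discrete : discrete_family (fun n p => p = plus P (shift n)).
Proof. apply (spread _ 0). intros n p ->. rewrite pz_shift, HP. ring. Qed.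

(** Below a level [t1 < z0] the radius is at most [r t1], and the centre lies between its limit [cP]
    at the conelike point and [c t1]. *)
Let M_bounded eps : 0 < eps -> exists B, forall p, M p -> pz p <= z0 - eps ->
  sqrt ((px p - b1) * (px p - b1) + (py p - b2) * (py p - b2)) <= B.
Proof.
intros Heps. set (t1 := z0 - Rmin eps (z0 / 2)).
assert (E1 := Rmin_l eps (z0 / 2)). assert (E2 := Rmin_r eps (z0 / 2)).
assert (E3 : 0 < Rmin eps (z0 / 2)) by (apply Rmin_pos; lra).
assert (Ht1 : 0 < t1 < z0) by (unfold t1; lra).
exists (r t1 + (Rabs cP + Rabs (c t1)) * Rabs e1 + (Rabs cP + Rabs (c t1)) * Rabs e2).
intros p Mp Hp. assert (Hz := HMz p Mp). assert (Hz' : 0 < pz p < z0) by lra.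
apply M_circle in Mp; [| exact Hz'].
assert (Hpt : pz p <= t1).
{ unfold t1. unfold Rmin. destruct (Rle_dec eps (z0 / 2)); [lra |].
  lra. }
assert (Hr1 : r (pz p) <= r t1).
{ destruct Hpt as [L | ->]; [apply Rlt_le, Hrinc; lra | lra]. }
assert (Hc1 : c (pz p) <= c t1).
{ destruct Hpt as [L | ->]; [apply Rlt_le, Hcinc; lra | lra]. }
assert (Hc0 := c_lower _ Hz').
assert (Hr0 : 0 < r (pz p)) by now apply Hfol.
assert (Hca : Rabs (c (pz p)) <= Rabs cP + Rabs (c t1)).
{ assert (A1 := Rle_abs (- cP)). assert (A2 := Rle_abs (c t1)). rewrite Rabs_Ropp in A1.
  assert (A3 := Rabs_pos cP). assert (A4 := Rabs_pos (c t1)). apply Rabs_le. lra. }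
set (t := pz p) in *.
replace (px p - b1) with ((px p - cx t) + c t * e1) by (rewrite Hcx by exact Hz'; ring).
replace (py p - b2) with ((py p - cy t) + c t * e2) by (rewrite Hcy by exact Hz'; ring).
eapply Rle_trans; [apply norm_shift |]. rewrite Mp, sqrt_square by lra. rewrite !Rabs_mult.
assert (Rabs (c t) * Rabs e1 <= (Rabs cP + Rabs (c t1)) * Rabs e1)
  by (apply Rmult_le_compat_r; [apply Rabs_pos | exact Hca]).
assert (Rabs (c t) * Rabs e2 <= (Rabs cP + Rabs (c t1)) * Rabs e2)
  by (apply Rmult_le_compat_r; [apply Rabs_pos | exact Hca]).
lra.
Qed.

Let turn_norm p :
  (px (turn p) - b1) * (px (turn p) - b1) + (py (turn p) - b2) * (py (turn p) - b2)
  = (px p - b1) * (px p - b1) + (py p - b2) * (py p - b2).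
Proof.
rewrite px_turn, py_turn.
transitivity (((px p - b1) * (px p - b1) + (py p - b2) * (py p - b2)) * (hc * hc + hd * hd));
  [ring | rewrite Hhcd; ring].
Qed.

(** Away from the plane the circles stay in a bounded region, by [M_bounded] for the lower half and
    its half-turned image for the upper. Conversely, over each far point of the plane [HFfar] finds
    a point of the surface at nearly the same height. *)
Lemma periodic_asymptotic n :
  asymptotic_to_horizontal_plane
    (part S (IZR (2 * n) * z0) (IZR (2 * n + 2) * z0)) (IZR (2 * n + 1) * z0).
Proof.
replace (IZR (2 * n) * z0) with (IZR n * (2 * z0)) by (rewrite mult_IZR; ring).
replace (IZR (2 * n + 2) * z0) with (IZR n * (2 * z0) + 2 * z0) by (rewrite plus_IZR, mult_IZR; ring).
replace (IZR (2 * n + 1) * z0) with (IZR n * (2 * z0) + z0) by (rewrite plus_IZR, mult_IZR; ring).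
intros eps. assert (Heps := cond_pos eps).
destruct (M_bounded eps Heps) as [B HB].
set (de := Rmin (eps / 2) (z0 / 2)).
assert (D1' := Rmin_l (eps / 2) (z0 / 2)). assert (D2' := Rmin_r (eps / 2) (z0 / 2)).
assert (Hde : 0 < de < z0) by (split; [apply Rmin_pos; lra | unfold de; lra]).
destruct (HFfar de Hde) as [R0 HR0].
(* The horizontal position of a point of the [n]-th line; distances from it and from the axis differ
   by a constant. *)
set (a1 := b1 + IZR n * px w). set (a2 := b2 + IZR n * py w).
assert (Hnorm : forall p, horizontal_norm p <=
  sqrt ((px p - a1) * (px p - a1) + (py p - a2) * (py p - a2)) + Rabs a1 + Rabs a2).
{ intros p. unfold horizontal_norm.
  replace (px p * px p + py p * py p) with
    ((px p - a1 + a1) * (px p - a1 + a1) + (py p - a2 + a2) * (py p - a2 + a2)) by ring.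
  apply norm_shift. }
exists (Rmax B R0 + Rabs a1 + Rabs a2). split.
- intros p [Sp Hp] Hfar. specialize (Hnorm p). assert (HBm := Rmax_l B R0).
  rewrite <- (shift_minus n p) in Sp. rewrite (height n p) in Hp |- *.
  set (q := minus p (shift n)) in *. apply S_slab in Sp; [| lra].
  assert (Eq : (px p - a1) * (px p - a1) + (py p - a2) * (py p - a2)
    = (px q - b1) * (px q - b1) + (py q - b2) * (py q - b2))
    by (unfold q, shift, a1, a2; autorewrite with r3; ring).
  rewrite Eq in Hnorm. apply Rnot_le_lt. intros Hge.
  assert (Hq : pz q <= z0 - eps \/ z0 + eps <= pz q).
  { unfold Rabs in Hge. destruct (Rcase_abs _) in Hge; lra. }
  destruct Hq as [Hq | Hq].
  + assert (L := HB q (proj1 (D_low q ltac:(lra)) Sp) Hq). lra.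
  + assert (Mt : M (turn q)) by (apply D_low; [rewrite pz_turn; lra | now apply D_turn]).
    assert (L := HB _ Mt ltac:(rewrite pz_turn; lra)). rewrite turn_norm in L. lra.
- intros q Hq Hfar. specialize (Hnorm q). assert (HRm := Rmax_r B R0).
  destruct (HR0 (px q - a1) (py q - a2)) as (z & Hz & Ez); [lra |].
  exists (px q, py q, z + IZR n * (2 * z0)). split; [split |].
  + set (p := (px q - IZR n * px w, py q - IZR n * py w, z) : R3).
    replace ((px q, py q, z + IZR n * (2 * z0)) : R3) with (plus p (shift n))
      by (unfold p, shift; apply R3_eq; autorewrite with r3; rewrite ?pz_w; ring).
    apply S_slab; [unfold p; autorewrite with r3; lra |].
    apply HF; [unfold p; autorewrite with r3; lra |].
    unfold p; autorewrite with r3. rewrite <- Ez. f_equal; unfold a1, a2; ring.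
  + autorewrite with r3. lra.
  + apply ball3. autorewrite with r3. rewrite !Rminus_diag, Rabs_R0, Hq.
    split; [exact Heps | split; [exact Heps |]]. fold de in D1'. apply Rabs_def1; lra.
Qed.

Lemma periodic_surface_properties : periodic_maximal_continuation M z0 P o d.
Proof.
split; [exact doubled_maximal |].
split; [exact periodic_maximal |].
split; [intros E; assert (E' : pz w = pz zero) by exact (f_equal pz E); rewrite pz_w in E'; change (2 * z0 = 0) in E'; lra |].
split; [exact S_shift |].
split.
{ exists Cx, Cy, Rad.
  split; [exact periodic_foliation |].
  split; [exact periodic_lines |].
  split; [exact periodic_edge |].
  split; [exact periodic_boundary |].
  intros n. split; [apply conelike_above | apply conelike_below]. }
split; [exact lines_discrete |].
split; [exact translated_line_height |].
split; [exact cone_points_discrete | exact periodic_asymptotic].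
Qed.

End Periodic.

(** * Choice of the frame and assembly *)

Lemma horizontal_direction e1 e2 (d : R3) :
  e1 * e1 + e2 * e2 = 1 -> e1 * px d + e2 * py d = 0 -> pz d = 0 -> d <> zero ->
  exists de, de <> 0 /\ px d = - (de * e2) /\ py d = de * e1.
Proof.
intros He Hed Hdz Hd. exists (- e2 * px d + e1 * py d).
set (de := - e2 * px d + e1 * py d).
assert (Ex : px d = - (de * e2)).
{ transitivity (px d * (e1 * e1 + e2 * e2)); [rewrite He; ring |].
  transitivity (e1 * (e1 * px d + e2 * py d) - de * e2); [unfold de; ring | rewrite Hed; ring]. }
assert (Ey : py d = de * e1).
{ transitivity (py d * (e1 * e1 + e2 * e2)); [rewrite He; ring |].
  transitivity (e2 * (e1 * px d + e2 * py d) + de * e1); [unfold de; ring | rewrite Hed; ring]. }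
split; [| now split].
intros E. apply Hd. apply R3_eq; [rewrite Ex, E | rewrite Ey, E | rewrite Hdz];
[change (px zero) with 0 | change (py zero) with 0 | reflexivity]; ring.
Qed.

Lemma half_turn_aff e1 e2 b1 b2 z0 (o d : R3) :
  e1 * e1 + e2 * e2 = 1 -> e1 * px d + e2 * py d = 0 -> pz d = 0 -> d <> zero -> pz o = z0 ->
  e1 * (px o - b1) + e2 * (py o - b2) = 0 ->
  forall p, half_turn o d p = aff (- 2 * e1 * e2) (e1 * e1 - e2 * e2) (-1)
    (b1 + (e1 * e1 - e2 * e2) * b1 - - 2 * e1 * e2 * b2,
     b2 - - 2 * e1 * e2 * b1 - (e1 * e1 - e2 * e2) * b2, 2 * z0) p.
Proof.
intros He Hed Hdz Hd Hoz Hob p.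
destruct (horizontal_direction e1 e2 d He Hed Hdz Hd) as (de & Hde & Ex & Ey).
assert (Edd : lprod d d = de * de).
{ unfold lprod. rewrite Hdz, Ex, Ey.
  transitivity (de * de * (e1 * e1 + e2 * e2)); [ring | rewrite He; ring]. }
set (u := - e2 * (px p - px o) + e1 * (py p - py o)).
assert (Epd : lprod (minus p o) d / lprod d d = u / de).
{ rewrite Edd. unfold lprod, u; autorewrite with r3. rewrite Hdz, Ex, Ey. field. exact Hde. }
assert (Hc : e2 * e2 = 1 - e1 * e1) by lra.
assert (Ho : e2 * py o = e1 * b1 + e2 * b2 - e1 * px o) by lra.
apply R3_eq; unfold half_turn; autorewrite with r3; rewrite Epd; unfold aff, lin; autorewrite with r3.
- replace (u / de * px d) with (- (u * e2)) by (rewrite Ex; field; exact Hde).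
  unfold u. ring [Hc Ho].
- replace (u / de * py d) with (u * e1) by (rewrite Ey; field; exact Hde).
  assert (Q : 2 * py o - 2 * (e1 * e1) * py o = 2 * e2 * (e1 * b1 + e2 * b2 - e1 * px o)).
  { rewrite <- Ho. transitivity (2 * (1 - e1 * e1) * py o); [ring | rewrite <- Hc; ring]. }
  transitivity ((2 * py o - 2 * (e1 * e1) * py o) + 2 * e1 * e2 * px o - 2 * e1 * e2 * px p
    + 2 * (e1 * e1) * py p - py p); [unfold u; ring | rewrite Q; ring [Hc]].
- rewrite Hdz, Hoz. ring.
Qed.

Section Assembly.

Variables (M : R3 -> Prop) (z0 : R) (cx cy r : R -> R) (P o d : R3).
Hypothesis Hz0 : 0 < z0.
Hypothesis Hmax : maximal_surface (part M 0 z0).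
Hypothesis Hrot : ~ rotational (part M 0 z0).
Hypothesis Hfol : foliated_by_circles (part M 0 z0) 0 z0 cx cy r.
Hypothesis Hbdl : bounded_by_cone_and_line M z0 cx cy r P o d.
Hypothesis Hd : d <> zero.
Hypothesis Hdz : pz d = 0.
Hypothesis Hoz : pz o = z0.

Let r1 := Derive r.
Let r2 := Derive (Derive r).

Let Dr t : 0 < t < z0 -> is_derive r t (r1 t).
Proof. intros Ht. apply Derive_correct. exact (proj1 (proj2 (proj2 Hfol)) t Ht 1%nat). Qed.

Let Dr1 t : 0 < t < z0 -> is_derive r1 t (r2 t).
Proof. intros Ht. apply Derive_correct. exact (proj1 (proj2 (proj2 Hfol)) t Ht 2%nat). Qed.

Lemma continuation_in_frame e1 e2 b1 b2 c c1 c2 lam :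
  e1 * e1 + e2 * e2 = 1 -> e1 * px d + e2 * py d = 0 -> e1 * (px o - b1) + e2 * (py o - b2) = 0 ->
  (forall t, 0 < t < z0 -> cx t = b1 + c t * e1) ->
  (forall t, 0 < t < z0 -> cy t = b2 + c t * e2) ->
  (forall t, 0 < t < z0 -> is_derive c t (c1 t)) ->
  (forall t, 0 < t < z0 -> is_derive c1 t (c2 t)) ->
  (forall t, 0 < t < z0 -> c1 t = lam * (r t * r t)) -> 0 < lam ->
  periodic_maximal_continuation M z0 P o d.
Proof.
intros He Hed Hob Hcx Hcy Dc Dc1 Hc1 Hlam.
destruct Hbdl as (HMz & Hlz & HMl & HP & Hcone & Hbd).
assert (Hlim : filterlim r (at_right 0) (locally 0)).
{ destruct Hcone as [H _]. revert H. rewrite HP. apply filterlim_ext. intros h. f_equal. ring. }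
assert (Hrpos : forall t, 0 < t < z0 -> 0 < r t) by (intros t Ht; now apply Hfol).
assert (O2 := slice_ode2 M z0 cx cy r P o d Hmax Hfol Hlz HP Hbd b1 b2 e1 e2 c c1 c2 r1 r2
  He Hcx Hcy Dr Dr1 Dc Dc1).
destruct (radius_first_integral z0 r r1 r2 c1 Hz0 Hrpos Dr Dr1 O2 lam Hc1) as [K HK].
assert (Hlines : forall p, line o d p <->
  (pz p = z0 /\ e1 * (px p - b1) + e2 * (py p - b2) = 0)).
{ intros p. split.
  - intros Hp. split; [now apply Hlz |]. destruct Hp as [s ->]. autorewrite with r3.
    transitivity (e1 * (px o - b1) + e2 * (py o - b2) + s * (e1 * px d + e2 * py d)); [ring |].
    rewrite Hob, Hed. ring.
  - intros [Hpz Hp]. destruct (horizontal_direction e1 e2 d He Hed Hdz Hd) as (de & Hde & Ex & Ey).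
    set (u := - e2 * (px p - px o) + e1 * (py p - py o)).
    assert (Q : e1 * (px p - px o) + e2 * (py p - py o) = 0) by lra.
    exists (u / de). apply R3_eq; autorewrite with r3.
    + rewrite Ex. replace (u / de * - (de * e2)) with (- u * e2) by (field; exact Hde).
      transitivity (px o + (px p - px o) * (e1 * e1 + e2 * e2)); [rewrite He; ring |].
      transitivity (px o + e1 * (e1 * (px p - px o) + e2 * (py p - py o)) - u * e2);
        [unfold u; ring | rewrite Q; ring].
    + rewrite Ey. replace (u / de * (de * e1)) with (u * e1) by (field; exact Hde).
      transitivity (py o + (py p - py o) * (e1 * e1 + e2 * e2)); [rewrite He; ring |].
      transitivity (py o + e2 * (e1 * (px p - px o) + e2 * (py p - py o)) + u * e1);
        [unfold u; ring | rewrite Q; ring].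
    + rewrite Hpz, Hdz, Hoz. ring. }
assert (Hturn := half_turn_aff e1 e2 b1 b2 z0 o d He Hed Hdz Hd Hoz Hob).
assert (Hturn' : forall p,
  pz (half_turn o d p) = 2 * z0 - pz p /\
  e1 * (px (half_turn o d p) - b1) + e2 * (py (half_turn o d p) - b2)
  = - (e1 * (px p - b1) + e2 * (py p - b2)) /\
  (px (half_turn o d p) - b1) * (px (half_turn o d p) - b1)
  + (py (half_turn o d p) - b2) * (py (half_turn o d p) - b2)
  = (px p - b1) * (px p - b1) + (py p - b2) * (py p - b2)).
{ intros p. rewrite Hturn. unfold aff, lin; autorewrite with r3.
  set (x := px p); set (y := py p). split; [ring | split].
  - transitivity (- (e1 * (x - b1) + e2 * (y - b2)) * (e1 * e1 + e2 * e2)); [ring | rewrite He; ring].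
  - transitivity (((x - b1) * (x - b1) + (y - b2) * (y - b2))
      * ((e1 * e1 + e2 * e2) * (e1 * e1 + e2 * e2))); [ring | rewrite He; ring]. }
destruct (doubled_implicit M z0 cx cy r P o d Hz0 Hmax Hfol Hlz HP Hbd b1 b2 e1 e2 c c1 c2 r1 r2
  He Hcx Hcy Dr Dr1 Dc Dc1 lam K Hlam Hc1 HK Hlim Hlines HMz HMl Hturn') as (F & F1 & F2 & F3 & F4).
apply (periodic_surface_properties M z0 cx cy r P o d Hz0 Hmax Hfol HMz HMl HP Hcone Hbd b1 b2 e1 e2 c He
  Hcx Hcy) with (F := F); try assumption.
- exact (radius_increasing M z0 cx cy r P o d Hmax Hfol Hlz HP Hbd b1 b2 e1 e2 c c1 c2 r1 r2
    He Hcx Hcy Dr Dr1 Dc Dc1 lam Hlam Hc1 Hlim).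
- exact (centre_increasing M z0 cx cy r Hfol c c1 Dc lam Hlam Hc1).
Qed.

Hypothesis Hcen : forall s t, 0 < s < z0 -> 0 < t < z0 ->
  (cx s - cx t) * px d + (cy s - cy t) * py d = 0.

Lemma continuation_exists : periodic_maximal_continuation M z0 P o d.
Proof.
set (L := sqrt (px d * px d + py d * py d)).
assert (Hdd : 0 < px d * px d + py d * py d).
{ destruct (Rle_lt_dec (px d * px d + py d * py d) 0) as [Q | Q]; [exfalso | exact Q].
  apply Hd. apply R3_eq; [| | exact Hdz];
  [change (px zero) with 0 | change (py zero) with 0]; nra. }
assert (HL : 0 < L) by now apply sqrt_lt_R0.
assert (HLL : L * L = px d * px d + py d * py d) by (apply sqrt_sqrt; lra).
(* [e] is the horizontal unit normal to the line, so [(- e2, e1)] is its unit direction. *)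
set (e1 := py d / L). set (e2 := - px d / L).
assert (He : e1 * e1 + e2 * e2 = 1).
{ unfold e1, e2. transitivity ((px d * px d + py d * py d) / (L * L)); [field; lra |].
  rewrite HLL. field. lra. }
assert (Hed : e1 * px d + e2 * py d = 0) by (unfold e1, e2; field; lra).
set (t0 := z0 / 2). assert (Ht0 : 0 < t0 < z0) by (unfold t0; lra).
(* The position of the centres along the line, measured from [o]; [Hcen] makes it the same at every
   height. The base point [b] is thus where the line meets the plane of the centres. *)
set (y0 := - e2 * (cx t0 - px o) + e1 * (cy t0 - py o)).
set (b1 := px o - e2 * y0). set (b2 := py o + e1 * y0).
assert (Hob : e1 * (px o - b1) + e2 * (py o - b2) = 0) by (unfold b1, b2; ring).
set (c := fun t => e1 * (cx t - b1) + e2 * (cy t - b2)).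
assert (Hperp : forall t, 0 < t < z0 -> - e2 * (cx t - b1) + e1 * (cy t - b2) = 0).
{ intros t Ht. assert (Q := Hcen t t0 Ht Ht0).
  transitivity (- e2 * (cx t - px o) + e1 * (cy t - py o) - y0 * (e1 * e1 + e2 * e2));
    [unfold b1, b2; ring |].
  rewrite He. unfold y0.
  transitivity (((cx t - cx t0) * px d + (cy t - cy t0) * py d) / L);
    [unfold e1, e2; field; lra | rewrite Q; field; lra]. }
assert (Hcx : forall t, 0 < t < z0 -> cx t = b1 + c t * e1).
{ intros t Ht. assert (Q := Hperp t Ht). unfold c.
  transitivity (b1 + (cx t - b1) * (e1 * e1 + e2 * e2)); [rewrite He; ring |].
  transitivity (b1 + (e1 * (cx t - b1) + e2 * (cy t - b2)) * e1
    - e2 * (- e2 * (cx t - b1) + e1 * (cy t - b2)) + 0); [ring | rewrite Q; ring]. }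
assert (Hcy : forall t, 0 < t < z0 -> cy t = b2 + c t * e2).
{ intros t Ht. assert (Q := Hperp t Ht). unfold c.
  transitivity (b2 + (cy t - b2) * (e1 * e1 + e2 * e2)); [rewrite He; ring |].
  transitivity (b2 + (e1 * (cx t - b1) + e2 * (cy t - b2)) * e2
    + e1 * (- e2 * (cx t - b1) + e1 * (cy t - b2)) + 0); [ring | rewrite Q; ring]. }
set (c1 := fun t => e1 * Derive cx t + e2 * Derive cy t).
set (c2 := fun t => e1 * Derive (Derive cx) t + e2 * Derive (Derive cy) t).
assert (Dc : forall t, 0 < t < z0 -> is_derive c t (c1 t)).
{ intros t Ht.
  apply (is_derive_ext (fun t => e1 * cx t + e2 * cy t + - (e1 * b1 + e2 * b2))).
  - intros s. change (e1 * cx s + e2 * cy s + - (e1 * b1 + e2 * b2) = c s). unfold c. ring.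
  - apply is_derive_lin; apply Derive_correct;
    [exact (proj1 Hfol t Ht 1%nat) | exact (proj1 (proj2 Hfol) t Ht 1%nat)]. }
assert (Dc1 : forall t, 0 < t < z0 -> is_derive c1 t (c2 t)).
{ intros t Ht. apply (is_derive_ext (fun t => e1 * Derive cx t + e2 * Derive cy t + 0)).
  - intros s. apply Rplus_0_r.
  - apply is_derive_lin; apply Derive_correct;
    [exact (proj1 Hfol t Ht 2%nat) | exact (proj1 (proj2 Hfol) t Ht 2%nat)]. }
assert (Hrpos : forall t, 0 < t < z0 -> 0 < r t) by (intros t Ht; now apply Hfol).
destruct Hbdl as (_ & Hlz & _ & HP & _ & Hbd).
assert (O1 := slice_ode1 M z0 cx cy r P o d Hmax Hfol Hlz HP Hbd b1 b2 e1 e2 c c1 c2 r1 r2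
  He Hcx Hcy Dr Dr1 Dc Dc1).
destruct (centre_first_integral z0 r r1 c1 c2 Hz0 Hrpos Dr Dc1 O1) as [lam Hlam].
assert (Hnz := centre_moves M z0 cx cy r P o d Hz0 Hrot Hfol Hlz HP Hbd b1 b2 e1 e2 c c1
  Hcx Hcy Dc lam Hlam).
(* If [lam] is negative, reversing [e] changes the sign of the centre coordinate and of [lam], which
   reduces to the positive case. *)
destruct (Rtotal_order lam 0) as [Q | [Q | Q]]; [| now apply Hnz in Q |].
- apply (continuation_in_frame (- e1) (- e2) b1 b2 (fun t => - c t) (fun t => - c1 t)
    (fun t => - c2 t) (- lam)); try lra.
  + intros t Ht. rewrite (Hcx t Ht) at 1. ring.
  + intros t Ht. rewrite (Hcy t Ht) at 1. ring.
  + intros t Ht. apply (is_derive_opp (V := R_NormedModule) c t (c1 t)). now apply Dc.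
  + intros t Ht. apply (is_derive_opp (V := R_NormedModule) c1 t (c2 t)). now apply Dc1.
  + intros t Ht. change (- c1 t = - lam * (r t * r t)). rewrite (Hlam t Ht). ring.
- now apply (continuation_in_frame e1 e2 b1 b2 c c1 c2 lam).
Qed.

End Assembly.

Theorem corollary3p9 :
  forall (M : R3 -> Prop) (z0 : R) (cx cy r : R -> R)
         (Pi : R3 -> Prop) (P o d : R3),
    0 < z0 ->
    spacelike_riemann_example (part M 0 z0) 0 z0 cx cy r ->
    vertical_plane Pi ->
    (forall t, 0 < t < z0 -> Pi (cx t, cy t, t)) ->
    d <> zero ->
    orthogonal_to_plane d Pi ->
    bounded_by_cone_and_line M z0 cx cy r P o d ->
    let w := period P o d in
    let S := periodic_surface M P o d in
    (* reflection across L, and periodicity *)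
    maximal_surface (doubled M o d) /\
    maximal_surface S /\
    w <> zero /\ (forall p, S (plus p w) <-> S p) /\
    (* circles, straight lines and conelike points *)
    (exists Cx Cy Rad : R -> R,
       (forall n : Z,
          foliated_by_circles S (IZR n * z0) (IZR (n + 1) * z0) Cx Cy Rad) /\
       (forall (n : Z) p, pz p = IZR (2 * n + 1) * z0 ->
          (S p <-> translate n w (line o d) p)) /\
       (forall (n : Z) p, pz p = IZR (2 * n) * z0 ->
          ~ S p /\ (boundary S p <-> p = plus P (scal (IZR n) w))) /\
       (forall p, boundary S p <-> exists n : Z, p = plus P (scal (IZR n) w)) /\
       (forall n : Z,
          conelike S Cx Cy Rad (plus P (scal (IZR n) w)) 1 /\
          conelike S Cx Cy Rad (plus P (scal (IZR n) w)) (-1))) /\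
    discrete_family (fun n => translate n w (line o d)) /\
    (forall (n : Z) p, translate n w (line o d) p -> pz p = IZR (2 * n + 1) * z0) /\
    discrete_family (fun n p => p = plus P (scal (IZR n) w)) /\
    (* behaviour at the heights of the lines *)
    (forall n : Z,
       asymptotic_to_horizontal_plane
         (part S (IZR (2 * n) * z0) (IZR (2 * n + 2) * z0))
         (IZR (2 * n + 1) * z0)).
Proof.
intros M z0 cx cy r Pi P o d Hz0 (_ & Hmax & Hrot & Hfol) _ HPi Hd Hort Hbdl.
assert (Hlz : forall p, line o d p -> pz p = z0) by apply Hbdl.
assert (Hoz : pz o = z0).
{ apply Hlz. exists 0. apply R3_eq; autorewrite with r3; ring. }
assert (Hdz : pz d = 0).
{ assert (H : pz (plus o (scal 1 d)) = z0) by (apply Hlz; now exists 1).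
  autorewrite with r3 in H. lra. }
apply (continuation_exists M z0 cx cy r P o d Hz0 Hmax Hrot Hfol Hbdl Hd Hdz Hoz).
intros s t Hs Ht. assert (H := Hort _ _ (HPi s Hs) (HPi t Ht)).
unfold lprod in H. autorewrite with r3 in H. rewrite Hdz in H. lra.
Qed.
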